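(* Let $\Omega\subset\mathbb{R}^d$ be a bounded Lipschitz domain and let $u\in L^2_{loc}(\mathbb{R}^d)$ be such that $u\in H^{s_0}(Q_\Omega)$ for some $s_0\in(0,1)$. Assume moreover that $u|_{\Omega^c}$ is bounded and measurable and that, writing $u=u(r,\theta)$ in polar coordinates $(r,\theta)\in[0,+\infty)\times\mathbb{S}^{d-1}$, for every $\theta\in\mathbb{S}^{d-1}$ the limit $u_\infty(\theta)=\lim_{r\to+\infty}u(r,\theta)$ exists and $$\lim_{r\to+\infty}\|u(r,\cdot)-u_\infty\|_{L^\infty(\mathbb{S}^{d-1})}=0 .$$ Then $$\lim_{s\to0^+}\frac{s}{2}[u]_{H^s(Q_\Omega)}^2=\frac12\int_\Omega\int_{\mathbb{S}^{d-1}}|u(x)-u_\infty(\theta)|^2\,d\mathcal{H}^{d-1}(\theta)\,dx .$$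
   Context: $Q_\Omega=(\mathbb{R}^d\times\mathbb{R}^d)\setminus(\Omega^c\times\Omega^c)$, where $\Omega^c=\mathbb{R}^d\setminus\Omega$. For $s\in(0,1)$, $$[u]^2_{H^s(Q_\Omega)}=\iint_{Q_\Omega}\frac{|u(x)-u(y)|^2}{|x-y|^{d+2s}}\,dx\,dy,$$ and $u\in H^{s}(Q_\Omega)$ means that $u:\mathbb{R}^d\to\mathbb{R}$ is measurable, $u\in L^2(\Omega)$ and $[u]_{H^s(Q_\Omega)}<+\infty$. $\mathbb{S}^{d-1}$ is the unit sphere of $\mathbb{R}^d$ and $\mathcal{H}^{d-1}$ the $(d-1)$-dimensional Hausdorff measure. Polar coordinates identify $(r,\theta)$ with the point $r\theta\in\mathbb{R}^d$; since $\Omega$ is bounded, the limits as $r\to+\infty$ involve only $u|_{\Omega^c}$. *)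

(* Defs.v *)
From HB Require Import structures.
From mathcomp Require Import all_boot all_order all_algebra.
From mathcomp Require Import all_classical all_reals all_analysis.

Set Implicit Arguments.
Unset Strict Implicit.
Unset Printing Implicit Defensive.

Import Order.TTheory GRing.Theory Num.Theory.
Import numFieldNormedType.Exports.

Local Open Scope classical_set_scope.
Local Open Scope ring_scope.

(* The norm that the library puts on 'rV[R]_d is the sup norm. It gives the
   usual topology and the usual bounded sets, but distances, the unit sphere,
   diameters and Lipschitz constants have to be Euclidean. *)
Section euclidean.
Context {R : realType} {d : nat}.
Implicit Types x y : 'rV[R]_d.

Definition edot x y : R := \sum_i x 0 i * y 0 i.
Definition enorm x : R := Num.sqrt (edot x x).
Definition esphere : set 'rV[R]_d := [set x | enorm x = 1].
Definition ediam (A : set 'rV[R]_d) : \bar R :=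
  ereal_sup [set (enorm (z.1 - z.2))%:E | z in A `*` A].

Lemma ediam_ge0 A : A !=set0 -> (0 <= ediam A)%E.
Proof.
move=> [a Aa]; apply: le_ereal_sup_tmp; exists (enorm (a - a))%:E.
  by exists (a, a).
by rewrite lee_fin sqrtr_ge0.
Qed.

End euclidean.

Section esum_facts.
Context {R : realType} {I J : choiceType}.
Local Open Scope ereal_scope.

Lemma esum_subset (A B : set I) (w : I -> \bar R) :
  A `<=` B -> \esum_(i in A) w i <= \esum_(i in B) w i.
Proof.
move=> AB; apply: ereal_sup_le => _ [F [finF FA] <-].
by exists F => //; split => //; exact: subset_trans AB.
Qed.

Lemma esum_image_le (f : I -> J) (A : set I) (w : J -> \bar R) :
  (forall i, A i -> 0 <= w (f i)) ->
  \esum_(j in f @` A) w j <= \esum_(i in A) w (f i).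
Proof.
move=> w0; have [->|/set0P[i0 Ai0]] := eqVneq A set0.
  by rewrite image_set0 !esum_set0.
have /choice[g Hg] : forall j, exists i, (f @` A) j -> A i /\ f i = j.
  move=> j; have [[i Ai <-]|nj] := pselect ((f @` A) j).
    by exists i.
  by exists i0 => /nj.
rewrite (reindex_esum (g @` (f @` A)) (f @` A) f); last first.
  split.
  - by move=> i [j fj <-]; have [_ ->] := Hg j fj.
  - move=> i1 i2; rewrite !inE => -[j1 fj1 <-] [j2 fj2 <-].
    by have [_ ->] := Hg _ fj1; have [_ ->] := Hg _ fj2 => ->.
  - by move=> j fj; exists (g j); [exists j|exact: (Hg j fj).2].
by apply: esum_subset => i [j fj <-]; exact: (Hg j fj).1.
Qed.

Lemma esum_bigcup_le (F : nat -> set I) (w : I -> \bar R) :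
  (forall n i, F n i -> 0 <= w i) ->
  \esum_(i in \bigcup_n F n) w i <= \sum_(n <oo) \esum_(i in F n) w i.
Proof.
move=> w0; rewrite seqDU_bigcup_eq esum_bigcup; first last.
- by move=> i [n _ Fni]; exact: w0 (subset_seqDU Fni).
- by apply: sub_trivIset (trivIset_seqDU F).
rewrite nneseries_esumT; last by move=> n; apply: esum_ge0 => i; exact: w0.
by apply: le_esum => n _; apply: esum_subset; exact: subset_seqDU.
Qed.

End esum_facts.

(* Outer measures built from countable covers: the infimum of the total weights
   of the countable sets of indices in P whose sets E i cover A. *)
Section cover_outer.
Context {R : realType} {T : Type} {I : choiceType}.
Variables (E : I -> set T) (P : set I) (w : I -> \bar R).
Local Open Scope ereal_scope.

Definition is_cover (A : set T) (C : set I) :=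
  [/\ countable C, C `<=` P & A `<=` \bigcup_(i in C) E i].

Definition cover_outer (A : set T) : \bar R :=
  ereal_inf [set \esum_(i in C) w i | C in is_cover A].

Lemma cover_outer_le A C : is_cover A C -> cover_outer A <= \esum_(i in C) w i.
Proof. by move=> AC; apply: ereal_inf_lbound; exists C. Qed.

Lemma le_cover_outer : {homo cover_outer : A B / A `<=` B >-> A <= B}.
Proof.
move=> A B AB; apply: le_ereal_inf_tmp => _ [C [cC CP BC] <-].
by apply: cover_outer_le; split => //; exact: subset_trans BC.
Qed.

Hypothesis w_ge0 : forall i, P i -> 0 <= w i.

Lemma cover_outer_ge0 A : 0 <= cover_outer A.
Proof.
apply: le_ereal_inf_tmp => _ [C [_ CP _] <-].
by apply: esum_ge0 => i /CP /w_ge0.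
Qed.

Lemma cover_outer0 : cover_outer set0 = 0.
Proof.
apply/eqP; rewrite eq_le cover_outer_ge0 andbT -(esum_set0 w).
by apply: cover_outer_le; split => //; exact: countable0.
Qed.

Lemma cover_outer_sigma_subadditive : sigma_subadditive cover_outer.
Proof.
move=> A; have [[i ioo]|] := pselect (exists i, cover_outer (A i) = +oo).
  rewrite (eseries_pinfty _ _ ioo) ?leey// => n _.
  by rewrite -ltNye (lt_le_trans _ (cover_outer_ge0 _)).
rewrite -forallNE => Aoo.
suff add2e (e : {posnum R}) :
    cover_outer (\bigcup_n A n) <= \sum_(i <oo) cover_outer (A i) + e%:num%:E.
  by apply/lee_addgt0Pr => _/posnumP[].
rewrite (le_trans _ (epsilon_trick _ _ _))//; last first.
  by move=> n; exact: cover_outer_ge0.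
have /choice[C HC] : forall n, exists C, is_cover (A n) C /\
    \esum_(i in C) w i <= cover_outer (A n) + (e%:num / (2 ^ n.+1)%:R)%:E.
  move=> n; have en : (0 < e%:num / (2 ^ n.+1)%:R :> R)%R by [].
  have fA : cover_outer (A n) \is a fin_num.
    by rewrite ge0_fin_numE ?cover_outer_ge0// ltey; apply/eqP/Aoo.
  have [x [C AC <-] xS] := lb_ereal_inf_adherent en fA.
  by exists C; split => //; exact/ltW.
apply: (@le_trans _ _ (\esum_(i in \bigcup_n C n) w i)).
  apply: cover_outer_le; split.
  - by apply: bigcup_countable => // n _; have [[]] := HC n.
  - by move=> i [n _ Cni]; have [[_ CP _] _] := HC n; exact: CP.
  - move=> x [n _ Ax]; have [[_ _ /(_ _ Ax)[i Ci Ei]] _] := HC n.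
    by exists i => //; exists n.
have C0 n i : C n i -> 0 <= w i.
  by move=> Cni; have [[_ CP _] _] := HC n; apply: w_ge0; exact: CP.
apply: le_trans (esum_bigcup_le C0) _.
apply: lee_nneseries => n *; last exact: (HC n).2.
by apply: esum_ge0 => i; exact: C0.
Qed.

End cover_outer.

(* An index of a box is the pair of its extreme corners. *)
Section boxes.
Context {R : realType} {d : nat}.
Implicit Types ab : 'rV[R]_d * 'rV[R]_d.

Definition box ab : set 'rV[R]_d :=
  [set x | forall i : 'I_d, ab.1 0 i <= x 0 i <= ab.2 0 i].
Definition is_box : set ('rV[R]_d * 'rV[R]_d) :=
  [set ab : 'rV[R]_d * 'rV[R]_d | forall i : 'I_d, ab.1 0 i <= ab.2 0 i].
Definition box_volume ab : \bar R := (\prod_(i < d) (ab.2 0 i - ab.1 0 i))%:E.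

Lemma box_volume_ge0 ab : is_box ab -> (0 <= box_volume ab)%E.
Proof. by move=> h; rewrite lee_fin prodr_ge0// => i _; rewrite subr_ge0. Qed.

Definition set_coord (x : 'rV[R]_d) (i : 'I_d) (t : R) : 'rV[R]_d :=
  \row_j if j == i then t else x 0 j.

Definition clamp (i : 'I_d) (t : R) ab : R :=
  Num.max (ab.1 0 i) (Num.min t (ab.2 0 i)).
Definition box_below i t ab := (ab.1, set_coord ab.2 i (clamp i t ab)).
Definition box_above i t ab := (set_coord ab.1 i (clamp i t ab), ab.2).

Lemma is_box_below i t ab : is_box ab -> is_box (box_below i t ab).
Proof.
move=> h j; rewrite /= mxE; case: ifPn => // /eqP ->.
by rewrite le_max lexx.
Qed.

Lemma is_box_above i t ab : is_box ab -> is_box (box_above i t ab).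
Proof.
move=> h j; rewrite /= mxE; case: ifPn => // /eqP ->.
by rewrite ge_max h ge_min lexx orbT.
Qed.

Lemma box_belowP i t ab x : box ab x -> x 0 i <= t -> box (box_below i t ab) x.
Proof.
move=> h xt j; have /andP[h1 h2] := h j; rewrite /= mxE h1/=.
case: ifPn => // /eqP ji; rewrite ji in h1 h2 *.
by rewrite le_max le_min xt h2 orbT.
Qed.

Lemma box_aboveP i t ab x : box ab x -> t < x 0 i -> box (box_above i t ab) x.
Proof.
move=> h xt j; have /andP[h1 h2] := h j; rewrite /= mxE h2 andbT.
case: ifPn => // /eqP ji; rewrite ji in h1 h2 *.
by rewrite ge_max h1/= ge_min (ltW xt).
Qed.

Lemma box_volume_split i t ab :
  (box_volume ab = box_volume (box_below i t ab) + box_volume (box_above i t ab))%E.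
Proof.
rewrite /box_volume -EFinD; congr EFin.
rewrite (bigD1 i)//= [X in _ = X + _](bigD1 i)//= [X in _ = _ + X](bigD1 i)//=.
rewrite !mxE eqxx.
under [X in _ = _ * X + _]eq_bigr => j ji do rewrite mxE (negbTE ji).
under [X in _ = _ + _ * X]eq_bigr => j ji do rewrite mxE (negbTE ji).
by rewrite -mulrDl; congr (_ * _); rewrite [RHS]addrC addrA subrK.
Qed.

End boxes.

Section lebesgue.
Variables (R : realType) (d : nat).
Local Open Scope ereal_scope.

Definition lebesgue_outer : set 'rV[R]_d -> \bar R :=
  cover_outer box is_box box_volume.

HB.instance Definition _ := isOuterMeasure.Build R 'rV[R]_d lebesgue_outer
  (cover_outer0 box box_volume_ge0)
  (cover_outer_ge0 box box_volume_ge0)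
  (@le_cover_outer _ _ _ box is_box box_volume)
  (cover_outer_sigma_subadditive box box_volume_ge0).

(* R^d with the sigma-algebra of all Lebesgue measurable sets *)
Definition Rlebesgue := caratheodory_type lebesgue_outer.
HB.instance Definition _ := Measurable.on Rlebesgue.

Definition lebesgue : set Rlebesgue -> \bar R := lebesgue_outer.
HB.instance Definition _ := isMeasure.Build _ Rlebesgue R lebesgue
  (@caratheodory_measure0 _ _ lebesgue_outer)
  (@caratheodory_measure_ge0 _ _ lebesgue_outer)
  (@caratheodory_measure_sigma_additive _ _ lebesgue_outer).

Lemma measurable_halfspace (i : 'I_d) (t : R) :
  measurable ([set x | x 0 i <= t]%R : set Rlebesgue).
Proof.
apply: le_caratheodory_measurable => X.
apply: le_ereal_inf_tmp => _ [C [cC CP XC] <-].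
apply: (@le_trans _ _ (\esum_(ab in box_below i t @` C) box_volume ab +
                       \esum_(ab in box_above i t @` C) box_volume ab)).
  apply: leeD; apply: cover_outer_le; split.
  - exact: sub_countable (card_image_le _ _) cC.
  - by move=> _ [ab /CP h <-]; exact: is_box_below.
  - move=> x [/XC[ab Cab xab] /= xt].
    by exists (box_below i t ab); [exists ab|exact: box_belowP].
  - exact: sub_countable (card_image_le _ _) cC.
  - by move=> _ [ab /CP h <-]; exact: is_box_above.
  - move=> x [/XC[ab Cab xab] /= /negP]; rewrite -ltNge => xt.
    by exists (box_above i t ab); [exists ab|exact: box_aboveP].
under [leRHS]eq_esum do rewrite (box_volume_split i t).
rewrite esumD; first last.
- by move=> ab /CP h; apply: box_volume_ge0; exact: is_box_above.
- by move=> ab /CP h; apply: box_volume_ge0; exact: is_box_below.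
apply: leeD; apply: esum_image_le => ab /CP h; apply: box_volume_ge0.
- exact: is_box_below.
- exact: is_box_above.
Qed.

Lemma lebesgue_sigma_finite : sigma_finite setT lebesgue.
Proof.
pose F (n : nat) : set Rlebesgue :=
  \bigcap_(i in [set: 'I_d])
    ([set x | x 0 i <= n%:R]%R `\` [set x | x 0 i <= - n%:R]%R).
exists F => [|n].
  apply/esym/seteqP; split => // x _.
  pose M := (\sum_i `|(x : 'rV[R]_d) 0 i|)%R.
  exists (Num.truncn M).+1 => // i _ /=.
  have xM : (`|(x : 'rV[R]_d) 0 i| <= M)%R.
    by rewrite /M (bigD1 i)//= lerDl sumr_ge0.
  have Mn : (M < (Num.truncn M).+1%:R)%R by exact: truncnS_gt.
  have := le_lt_trans xM Mn; rewrite ltr_norml => /andP[h1 h2].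
  by split; [exact: ltW|apply/negP; rewrite -ltNge].
split.
  apply: fin_bigcap_measurable => // i _.
  by apply: measurableD; exact: measurable_halfspace.
pose ab : 'rV[R]_d * 'rV[R]_d := (const_mx (- n%:R), const_mx n%:R)%R.
have bab : is_box ab.
  by move=> i; rewrite !mxE (@le_trans _ _ 0%R)// oppr_le0.
apply: (@le_lt_trans _ _ (\esum_(c in [set ab]) box_volume c)).
  apply: cover_outer_le; split.
  - exact: countable1.
  - by move=> _ ->.
  - move=> x Fx; exists ab => // i; rewrite !mxE.
    by have [/= -> /negP] := Fx i I; rewrite -ltNge => /ltW ->.
by rewrite esum_set1 ?ltry//; exact: box_volume_ge0.
Qed.

HB.instance Definition _ :=
  Measure_isSigmaFinite.Build _ Rlebesgue R lebesgue lebesgue_sigma_finite.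

End lebesgue.
Arguments lebesgue {R} d.

(* The k-dimensional Hausdorff measure, with the normalisation that makes it
   the Lebesgue measure when k = d: a set E of a cover has weight
   omega_k (diam E / 2)^k. In particular it is the counting measure for k = 0,
   as omega_0 = 1 and a power with exponent 0 is 1. *)
Section hausdorff.
Variables (R : realType) (k d : nat).
Local Open Scope ereal_scope.

Definition unit_ball_volume : \bar R :=
  lebesgue k [set x : 'rV[R]_k | enorm x <= 1]%R.

Definition hausdorff_weight (E : set 'rV[R]_d) : \bar R :=
  unit_ball_volume * (ediam E * 2^-1%:E) ^+ k.

Definition small_set (delta : R) : set (set 'rV[R]_d) :=
  [set E | E !=set0 /\ ediam E <= delta%:E].

Definition hausdorff_delta (delta : R) : set 'rV[R]_d -> \bar R :=
  cover_outer id (small_set delta) hausdorff_weight.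

Definition hausdorff_outer (A : set 'rV[R]_d) : \bar R :=
  ereal_sup [set hausdorff_delta delta A | delta in [set delta | 0 < delta]%R].

Lemma hausdorff_weight_ge0 delta E :
  small_set delta E -> 0 <= hausdorff_weight E.
Proof.
move=> [E0 _]; apply: mule_ge0; first exact: outer_measure_ge0.
by apply: expe_ge0; apply: mule_ge0; [exact: ediam_ge0|rewrite lee_fin].
Qed.

Lemma hausdorff_delta_le delta A :
  (0 < delta)%R -> hausdorff_delta delta A <= hausdorff_outer A.
Proof. by move=> d0; apply: ereal_sup_ubound; exists delta. Qed.

Lemma hausdorff_outer_ge0 A : 0 <= hausdorff_outer A.
Proof.
apply: le_trans (hausdorff_delta_le A ltr01).
exact: (cover_outer_ge0 id (@hausdorff_weight_ge0 1%R)).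
Qed.

Lemma hausdorff_outer0 : hausdorff_outer set0 = 0.
Proof.
apply/eqP; rewrite eq_le hausdorff_outer_ge0 andbT.
apply: ge_ereal_sup => _ [delta _ <-].
by rewrite /hausdorff_delta (cover_outer0 id (@hausdorff_weight_ge0 delta)).
Qed.

Lemma le_hausdorff_outer :
  {homo hausdorff_outer : A B / A `<=` B >-> A <= B}.
Proof.
move=> A B AB; apply: ge_ereal_sup => _ [delta d0 <-].
exact: le_trans (le_cover_outer _ _ _ AB) (hausdorff_delta_le _ d0).
Qed.

Lemma hausdorff_outer_sigma_subadditive : sigma_subadditive hausdorff_outer.
Proof.
move=> A; apply: ge_ereal_sup => _ [delta d0 <-].
apply: le_trans
  (cover_outer_sigma_subadditive id (@hausdorff_weight_ge0 delta) A) _.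
apply: lee_nneseries => n *; last exact: hausdorff_delta_le.
exact: (cover_outer_ge0 id (@hausdorff_weight_ge0 delta)).
Qed.

HB.instance Definition _ := isOuterMeasure.Build R 'rV[R]_d hausdorff_outer
  hausdorff_outer0 hausdorff_outer_ge0
  le_hausdorff_outer hausdorff_outer_sigma_subadditive.

Definition Rhausdorff := caratheodory_type hausdorff_outer.
HB.instance Definition _ := Measurable.on Rhausdorff.

Definition hausdorff : set Rhausdorff -> \bar R := hausdorff_outer.
HB.instance Definition _ := isMeasure.Build _ Rhausdorff R hausdorff
  (@caratheodory_measure0 _ _ hausdorff_outer)
  (@caratheodory_measure_ge0 _ _ hausdorff_outer)
  (@caratheodory_measure_sigma_additive _ _ hausdorff_outer).

End hausdorff.
Arguments hausdorff {R} k d.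

Section domains.
Context {R : realType} {d : nat}.
Implicit Types Omega : set 'rV[R]_d.

(* Near each boundary point, Omega is the strict epigraph, in some direction e,
   of a Lipschitz function on the hyperplane orthogonal to e. *)
Definition lipschitz_boundary Omega := forall p, (closure Omega `\` Omega°) p ->
  exists (e : 'rV[R]_d) (gamma : 'rV[R]_d -> R) (rho L : R),
    [/\ enorm e = 1, 0 < rho,
        (forall y z, edot y e = 0 -> edot z e = 0 ->
           `|gamma y - gamma z| <= L * enorm (y - z)) &
        (forall x, enorm (x - p) < rho ->
           (Omega x <-> gamma (x - edot x e *: e) < edot x e))].

Definition bounded_lipschitz_domain Omega :=
  [/\ Omega !=set0, open Omega, connected Omega, bounded_set Omega &
      lipschitz_boundary Omega].

End domains.

Section fractional_spaces.
Context {R : realType} {d : nat}.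
Implicit Types (Omega : set 'rV[R]_d) (u : 'rV[R]_d -> R) (s : R).
Local Open Scope ereal_scope.

Definition lebesgue_measurable_fun (D : set 'rV[R]_d) u :=
  measurable_fun (D : set (Rlebesgue R d)) u.

Definition L2 (D : set 'rV[R]_d) u :=
  lebesgue_measurable_fun D u /\
  \int[lebesgue d]_(x in D) ((u x ^+ 2)%R)%:E < +oo.

Definition L2loc u :=
  lebesgue_measurable_fun setT u /\ forall K, compact K -> L2 K u.

Definition QOmega Omega : set ('rV[R]_d * 'rV[R]_d) :=
  ~` ((~` Omega) `*` (~` Omega)).

Definition Hs_seminorm2 s Omega u : \bar R :=
  \int[lebesgue d \x lebesgue d]_(z in QOmega Omega)
    ((`|u z.1 - u z.2| ^+ 2 / (enorm (z.1 - z.2)) `^ (d%:R + 2 * s))%R)%:E.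

Definition Hs s Omega u :=
  [/\ lebesgue_measurable_fun setT u, L2 Omega u &
      Hs_seminorm2 s Omega u < +oo].

End fractional_spaces.

(* Main.v *)
(** The pairs of QOmega at distance at most R from the origin contribute at most
    a constant times the seminorm of order s0, so s/2 times their contribution
    vanishes with s. The two remaining parts, Omega x {|y| > R} and its mirror
    image, contribute equally. On them |x - y| is |y| up to a factor close to 1,
    so each is close to the integral of f(y) |y|^-(d + 2s) over {|y| > R}, where
    f(y) is the integral of |u(x) - u(y)|^2 over x in Omega. Cut {|y| > R} into
    the annuli {lam^j < |y| <= lam^(j+1)}: rescaled to j = 0, the integral of f
    over them converges to that of g = lim f(r y) (dominated convergence), and
    the weights form a geometric series of ratio lam^(-2s), whose sum times s
    tends to 1 / (2 ln lam). Letting lam tend to 1 gives d/2 times the integral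
    of g over the unit ball, which is half the integral of g over the sphere by
    polar coordinates.

    The polar coordinates rest on the fact that the Hausdorff measure of a part A
    of the sphere is d times the Lebesgue measure of the cone over A. Small pieces
    of the sphere are almost isometric to pieces of a hyperplane, where Hausdorff
    and Lebesgue measure agree; that agreement is the isodiametric inequality,
    obtained by Steiner symmetrisation. *)
From HB Require Import structures.
Require Import Defs.
From mathcomp Require Import all_boot all_order all_algebra.
From mathcomp Require Import all_classical all_reals all_analysis.
From mathcomp Require Import measurable_realfun ring lra zify.

Set Implicit Arguments.
Unset Strict Implicit.
Unset Printing Implicit Defensive.

Import Order.TTheory GRing.Theory Num.Theory.
Import numFieldNormedType.Exports.

Local Open Scope classical_set_scope.
Local Open Scope ring_scope.

(** * Euclidean norm *)

(** Lebesgue measure is given here by countable covers with boxes, so neither slicing nor rotations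
    come for free. Slicing a cover gives one-sided Fubini inequalities; for a bounded open set the
    opposite one follows by passing to the complement in a box, and symmetrisation needs no more.
    Lipschitz estimates, reflections included, come only after the identification with Hausdorff
    measure, which depends on distances alone. In that identification the isodiametric inequality
    gives one direction; the other starts from a crude constant on cubes and improves it by filling
    each cube with its inscribed ball, until the constant tends to 1. On the sphere the two
    directions are also different in nature: one follows the covers that define Hausdorff measure,
    the other a countable partition into small caps. Since u is square integrable on the bounded set
    Omega, f(y) is q(u(y)) for a quadratic polynomial q, which settles measurability, boundedness
    and passage to the limit together. The parameters are chosen in the order tolerance, lam = 1 +
    e, inner radius lam^m, and only then s, so the large constant of the near part is harmless. *)

Section euclidean_norm.
Context {R : realType}.
Implicit Types d : nat.

Lemma edotC d (x y : 'rV[R]_d) : edot x y = edot y x.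
Proof. by apply: eq_bigr => i _; rewrite mulrC. Qed.

Lemma edotDl d (x y z : 'rV[R]_d) : edot (x + y) z = edot x z + edot y z.
Proof. by rewrite -big_split; apply: eq_bigr => i _; rewrite mxE mulrDl. Qed.

Lemma edotZl d a (x z : 'rV[R]_d) : edot (a *: x) z = a * edot x z.
Proof. by rewrite mulr_sumr; apply: eq_bigr => i _; rewrite mxE mulrA. Qed.

Lemma edotNl d (x z : 'rV[R]_d) : edot (- x) z = - edot x z.
Proof. by rewrite -scaleN1r edotZl mulN1r. Qed.

Lemma edotBl d (x y z : 'rV[R]_d) : edot (x - y) z = edot x z - edot y z.
Proof. by rewrite edotDl edotNl. Qed.

Lemma edotDr d (x y z : 'rV[R]_d) : edot z (x + y) = edot z x + edot z y.
Proof. by rewrite edotC edotDl !(edotC z). Qed.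

Lemma edotBr d (x y z : 'rV[R]_d) : edot z (x - y) = edot z x - edot z y.
Proof. by rewrite edotC edotBl !(edotC z). Qed.

Lemma edotZr d a (x z : 'rV[R]_d) : edot z (a *: x) = a * edot z x.
Proof. by rewrite edotC edotZl edotC. Qed.

Lemma edot_ge0 d (x : 'rV[R]_d) : 0 <= edot x x.
Proof. by apply: sumr_ge0 => i _; rewrite -expr2 sqr_ge0. Qed.

Lemma enorm_ge0 d (x : 'rV[R]_d) : 0 <= enorm x.
Proof. exact: sqrtr_ge0. Qed.
Hint Resolve enorm_ge0 : core.

Lemma enorm_sqr d (x : 'rV[R]_d) : enorm x ^+ 2 = edot x x.
Proof. by rewrite sqr_sqrtr// edot_ge0. Qed.

Lemma enorm0 d : enorm (0 : 'rV[R]_d) = 0.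
Proof.
by rewrite /enorm /edot big1 ?sqrtr0// => i _; rewrite mxE mul0r.
Qed.

Lemma enorm_le_sqr d (x : 'rV[R]_d) a : 0 <= a -> (enorm x <= a) = (edot x x <= a ^+ 2).
Proof. by move=> a0; rewrite -enorm_sqr ler_pXn2r// nnegrE. Qed.

Lemma enormZ d a (x : 'rV[R]_d) : enorm (a *: x) = `|a| * enorm x.
Proof. by rewrite /enorm edotZl edotZr mulrA -expr2 sqrtrM ?sqr_ge0// sqrtr_sqr. Qed.

Lemma enormN d (x : 'rV[R]_d) : enorm (- x) = enorm x.
Proof. by rewrite -scaleN1r enormZ normrN1 mul1r. Qed.

Lemma enormB d (x y : 'rV[R]_d) : enorm (x - y) = enorm (y - x).
Proof. by rewrite -opprB enormN. Qed.

Lemma normr_coord_le d (x : 'rV[R]_d) i : `|x 0 i| <= enorm x.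
Proof.
rewrite -(@ler_pXn2r _ 2)// ?nnegrE// enorm_sqr real_normK ?num_real//.
rewrite /edot (bigD1 i)//= -expr2 lerDl.
by apply: sumr_ge0 => j _; rewrite -expr2 sqr_ge0.
Qed.

Lemma enorm_eq0 d (x : 'rV[R]_d) : (enorm x == 0) = (x == 0).
Proof.
apply/eqP/eqP => [x0|->]; last exact: enorm0.
apply/rowP => i; rewrite mxE; apply/eqP; rewrite -normr_eq0 eq_le normr_ge0 andbT.
by rewrite -x0 normr_coord_le.
Qed.

Lemma enorm_gt0 d (x : 'rV[R]_d) : (0 < enorm x) = (x != 0).
Proof. by rewrite lt_neqAle enorm_ge0 andbT eq_sym enorm_eq0. Qed.

Lemma edot_le d (x y : 'rV[R]_d) : edot x y <= enorm x * enorm y.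
Proof.
have [->|y0] := eqVneq y 0.
  by rewrite enorm0 mulr0 edotC -(scale0r (0 : 'rV[R]_d)) edotZl mul0r.
have ny : 0 < enorm y by rewrite enorm_gt0.
have [->|x0] := eqVneq x 0.
  by rewrite enorm0 mul0r -(scale0r (0 : 'rV[R]_d)) edotZl mul0r.
have nx : 0 < enorm x by rewrite enorm_gt0.
have := edot_ge0 ((enorm x)^-1 *: x - (enorm y)^-1 *: y).
rewrite !(edotBl, edotBr, edotZl, edotZr) (edotC y x) -!enorm_sqr.
set a := enorm x; set b := enorm y; set c := edot x y.
move=> h.
have : 0 <= 2 * (1 - c / (a * b)).
  by apply: le_trans h _; rewrite le_eqVlt; apply/orP; left; apply/eqP; field; rewrite !gt_eqF.
rewrite pmulr_rge0// subr_ge0 ler_pdivrMr ?mul1r//.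
exact: mulr_gt0.
Qed.

Lemma enormD d (x y : 'rV[R]_d) : enorm (x + y) <= enorm x + enorm y.
Proof.
rewrite enorm_le_sqr ?addr_ge0// edotDl !edotDr (edotC y x) sqrrD !enorm_sqr.
have := edot_le x y; lra.
Qed.

Lemma ler_enorm_dist d (x y : 'rV[R]_d) : `|enorm x - enorm y| <= enorm (x - y).
Proof.
have h (a b : 'rV[R]_d) : enorm a - enorm b <= enorm (a - b).
  by rewrite lerBlDr; apply: le_trans (enormD _ _); rewrite subrK.
by rewrite ler_norml h andbT lerNl opprB enormB h.
Qed.

Lemma enorm_triangle d (z x y : 'rV[R]_d) : enorm (x - y) <= enorm (x - z) + enorm (z - y).
Proof. by apply: le_trans (enormD _ _); rewrite addrA subrK. Qed.

(** The constant [d%:R] in place of its square root is crude, but all uses need only comparability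
    with the sup norm. *)
Lemma enorm_le_coord d (x : 'rV[R]_d) a : (forall i, `|x 0 i| <= a) -> enorm x <= d%:R * a.
Proof.
move=> xa; have [d0|d0] := posnP d.
  subst d; rewrite mul0r; have -> : x = 0 by apply/rowP => -[].
  by rewrite enorm0.
have a0 : 0 <= a by exact: le_trans (normr_ge0 _) (xa (Ordinal d0)).
rewrite enorm_le_sqr ?mulr_ge0//.
apply: (@le_trans _ _ (\sum_(i < d) a ^+ 2)).
  apply: ler_sum => i _; rewrite -expr2 -real_normK ?num_real//.
  by rewrite ler_pXn2r ?nnegrE.
rewrite sumr_const card_ord -[_ *+ _]mulr_natl exprMn ler_wpM2r ?sqr_ge0//.
by rewrite -natrX ler_nat expnS expn1 leq_pmulr.
Qed.

Lemma nbhs_enormP d (x : 'rV[R]_d) (P : set 'rV[R]_d) :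
  nbhs x P <-> exists2 e, 0 < e & forall y, enorm (y - x) < e -> P y.
Proof.
split=> [/nbhs_ballP[e /= e0 eP]|[e e0 eP]].
  exists e => // y yx; apply: eP; split=> // i j.
  rewrite /ball/= (ord1 i); apply: le_lt_trans yx.
  by apply: le_trans (normr_coord_le _ j); rewrite !mxE distrC.
(* Dividing by [d.+1] rather than [d] keeps the final inequality strict and covers d = 0. *)
apply/nbhs_ballP; exists (e / d.+1%:R) => /=; first by rewrite divr_gt0.
move=> y xy; apply: eP; rewrite enormB.
apply: (@le_lt_trans _ _ (d%:R * (e / d.+1%:R))).
  apply: enorm_le_coord => i; rewrite !mxE.
  by have [_ /(_ 0 i)/ltW] := xy.
rewrite mulrA ltr_pdivrMr// mulrC ltr_pM2l// ltr_nat//.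
Qed.

Lemma open_enormP d (U : set 'rV[R]_d) :
  open U <-> forall x, U x -> exists2 e, 0 < e & forall y, enorm (y - x) < e -> U y.
Proof.
rewrite openE; split=> h x /h; first by move/nbhs_enormP.
by move=> ?; apply/nbhs_enormP.
Qed.

Lemma open_enorm_gt d (x : 'rV[R]_d) r : open [set y | r < enorm (y - x)].
Proof.
apply/open_enormP => y /= yr; exists (enorm (y - x) - r); first by rewrite subr_gt0.
move=> z zy; have := enorm_triangle z y x; rewrite (enormB y z); lra.
Qed.

End euclidean_norm.
#[global] Hint Resolve enorm_ge0 : core.

(** * Lebesgue outer measure *)

Section cover_outer_sequences.
Context {R : realType} {T : Type} {I : choiceType}.
Variables (E : I -> set T) (P : set I) (w : I -> \bar R).
Local Open Scope ereal_scope.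
Hypothesis w_ge0 : forall i, P i -> 0 <= w i.

(** Turns the unordered sum over a countable set of indices into a series, so that covers can be
    integrated term by term. A number that codes no index is sent to [None], which stands for the
    empty set with weight 0. *)
Lemma cover_outer_seq A a : cover_outer E P w A < a ->
  exists c : nat -> option I,
    [/\ forall n i, c n = Some i -> P i,
        A `<=` \bigcup_n oapp E set0 (c n) &
        \sum_(n <oo) oapp w 0 (c n) < a].
Proof.
move=> /ereal_inf_lt[_ [C [cC CP AC] <-] Ca].
have /countable_injP[f finj] := cC.
have /choice[c Hc] : forall n, exists oi, match oi with
    | Some i => C i /\ f i = n | None => forall i, C i -> f i <> n end.
  move=> n; have [[i [Ci fi]]|h] := pselect (exists i, C i /\ f i = n).
    by exists (Some i).
  by exists None => i Ci fi; apply: h; exists i.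
have cf i : C i -> c (f i) = Some i.
  move=> Ci; have := Hc (f i); case: (c (f i)) => [j [Cj fji]|/(_ i Ci)//].
  by congr Some; apply: finj => //; exact/mem_set.
have cP n i : c n = Some i -> P i.
  by move=> cn; have := Hc n; rewrite cn => -[/CP].
exists c; split => //.
  move=> x /AC[i Ci Ex]; exists (f i) => //; by rewrite cf.
have w0 n : 0 <= oapp w 0 (c n).
  by case cn : (c n) => [i|//=]; apply: w_ge0; exact: cP cn.
rewrite nneseries_esumT//.
suff -> : \esum_(n in [set: nat]) oapp w 0 (c n) = \esum_(i in C) w i by [].
transitivity (\esum_(n in f @` C) oapp w 0 (c n)).
  rewrite [RHS]esum_mkcond; apply: eq_esum => n _; case: ifPn => // /negP nC.
  case cn : (c n) => [i|//=]; exfalso; apply: nC; apply/mem_set.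
  by have := Hc n; rewrite cn => -[Ci fi]; exists i.
by rewrite esum_image; [apply: eq_esum => i Ci; rewrite cf|exact: finj].
Qed.

Lemma cover_outer_index i : P i -> cover_outer E P w (E i) <= w i.
Proof.
move=> Pi; rewrite -[leRHS](@esum_set1 _ _ i)//; last exact: w_ge0.
apply: cover_outer_le; split; first exact: countable1.
  by move=> _ ->.
by move=> x Ex; exists i.
Qed.

(** The universal property of an outer measure built from covers: it dominates every monotone
    sigma-subadditive function that its weights dominate. The comparisons of outer measures below
    reduce to a single index through it. *)
Lemma le_cover_outer_of_index (mu : set T -> \bar R) (c : R) A :
  (0 < c)%R -> (forall B, 0 <= mu B) -> mu set0 = 0 ->
  {homo mu : B1 B2 / B1 `<=` B2 >-> B1 <= B2} -> sigma_subadditive mu ->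
  (forall i, P i -> mu (E i) <= c%:E * w i) ->
  mu A <= c%:E * cover_outer E P w A.
Proof.
move=> c0 mu_ge0 mu0 mu_le mu_sub h.
have [A_oo|] := eqVneq (cover_outer E P w A) +oo.
  by rewrite A_oo gt0_muley ?leey// lte_fin.
rewrite -ltey -ge0_fin_numE ?cover_outer_ge0// => A_fin.
apply/lee_addgt0Pr => e e0.
(* The slack is e / c because it gets multiplied by c at the end. *)
have [|s [sP As sA]] := @cover_outer_seq A (cover_outer E P w A + (e / c)%:E).
  by rewrite lteDl// lte_fin divr_gt0.
have s0 n : 0 <= oapp w 0 (s n).
  by case sn : (s n) => [i|//=]; apply: w_ge0; exact: sP sn.
apply: (le_trans (mu_le _ _ As)); apply: (le_trans (mu_sub _)).
apply: (@le_trans _ _ (\sum_(n <oo) c%:E * oapp w 0 (s n))).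
  apply: lee_nneseries => // n _.
  by case sn : (s n) => [i|]/=; [exact/h/(sP _ _ sn)|rewrite mu0 mule0].
rewrite nneseriesZl; last by move=> *; exact: s0.
apply: le_trans (lee_wpmul2l _ (ltW sA)) _; first by rewrite lee_fin ltW.
rewrite ge0_muleDr ?cover_outer_ge0// ?lee_fin ?divr_ge0 ?(ltW e0) ?(ltW c0)//.
by rewrite -EFinM mulrC divfK// gt_eqF.
Qed.

End cover_outer_sequences.

Section lebesgue_basics.
Context {R : realType}.
Local Open Scope ereal_scope.
Implicit Types d : nat.
Notation L := (@lebesgue_outer R _).

Lemma lebesgue_box_le d (ab : 'rV[R]_d * 'rV[R]_d) :
  is_box ab -> L (box ab) <= box_volume ab.
Proof. exact: (cover_outer_index box box_volume_ge0). Qed.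

Lemma le_lebesgue_outer_of_box d (mu : set 'rV[R]_d -> \bar R) (c : R) A :
  (0 < c)%R -> (forall B, 0 <= mu B) -> mu set0 = 0 ->
  {homo mu : B1 B2 / B1 `<=` B2 >-> B1 <= B2} -> sigma_subadditive mu ->
  (forall ab, is_box ab -> mu (box ab) <= c%:E * box_volume ab) ->
  mu A <= c%:E * L A.
Proof. exact: (le_cover_outer_of_index box_volume_ge0). Qed.

(** B |-> L (f^-1 B) is again monotone and sigma-subadditive, so boxes suffice. *)
Lemma lebesgue_preimage_le d (f : 'rV[R]_d -> 'rV[R]_d) (c : R) A :
  (0 < c)%R ->
  (forall ab, is_box ab -> L (f @^-1` box ab) <= c%:E * box_volume ab) ->
  L (f @^-1` A) <= c%:E * L A.
Proof.
move=> c0; apply: (le_lebesgue_outer_of_box (mu := fun B => L (f @^-1` B))) => //.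
- by move=> B; exact: outer_measure_ge0.
- by rewrite preimage_set0; exact: outer_measure0.
- by move=> B1 B2 B12; apply: le_outer_measure => x; exact: B12.
- move=> F; rewrite preimage_bigcup.
  exact: (outer_measure_sigma_subadditive (@lebesgue_outer R d)).
Qed.

Lemma lebesgue_scale_le d (a : R) (A : set 'rV[R]_d) : (0 < a)%R ->
  L (( *:%R a) @^-1` A) <= ((a ^- d)%R)%:E * L A.
Proof.
move=> a0; apply: lebesgue_preimage_le; first by rewrite invr_gt0 exprn_gt0.
move=> ab bab; pose ab' := (a^-1 *: ab.1, a^-1 *: ab.2)%R.
have -> : ( *:%R a) @^-1` box ab = box ab'.
  apply/seteqP; split => x /= h i; have := h i; rewrite !mxE.
    by rewrite ![(a^-1 * _)%R]mulrC ler_pdivrMr// ler_pdivlMr// ![(_ * a)%R]mulrC.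
  by rewrite ![(a^-1 * _)%R]mulrC ler_pdivrMr// ler_pdivlMr// ![(_ * a)%R]mulrC.
apply: le_trans (lebesgue_box_le _) _.
  by move=> i; rewrite !mxE ler_pM2l ?invr_gt0.
rewrite -EFinM lee_fin -exprVn -[X in (_ ^+ X)%R](card_ord d) -prodr_const -big_split/=.
by apply: ler_prod => i _; rewrite !mxE -mulrBr lexx andbT mulr_ge0 ?invr_ge0 ?(ltW a0)// subr_ge0.
Qed.

(** The reverse inequality is the same bound for [a^-1], applied to the preimage. *)
Lemma lebesgue_scale d (a : R) (A : set 'rV[R]_d) : (0 < a)%R ->
  L (( *:%R a) @^-1` A) = ((a ^- d)%R)%:E * L A.
Proof.
move=> a0; apply/eqP; rewrite eq_le lebesgue_scale_le//=.
have ai0 : (0 < a^-1)%R by rewrite invr_gt0.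
have := lebesgue_scale_le (( *:%R a) @^-1` A) ai0.
have -> : ( *:%R a^-1%R) @^-1` (( *:%R a) @^-1` A) = A.
  by apply/seteqP; split => x /=; rewrite scalerA divff ?gt_eqF// scale1r.
move=> h; apply: le_trans (lee_wpmul2l _ h) _.
  by rewrite lee_fin invr_ge0 exprn_ge0// ltW.
by rewrite muleA -EFinM exprVn invrK mulVf ?mul1e// gt_eqF// exprn_gt0.
Qed.

Lemma lebesgue_translate_le d (v : 'rV[R]_d) A :
  L (( +%R v) @^-1` A) <= L A.
Proof.
rewrite -[leRHS]mul1e; apply: lebesgue_preimage_le; first exact: ltr01.
move=> ab bab; pose ab' := (ab.1 - v, ab.2 - v)%R.
have -> : ( +%R v) @^-1` box ab = box ab'.
  apply/seteqP; split => x /= h i; have := h i; rewrite !mxE.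
    by rewrite lerBlDl lerBrDl.
  by rewrite lerBlDl lerBrDl.
apply: le_trans (lebesgue_box_le _) _.
  by move=> i; rewrite !mxE lerB.
rewrite mul1e lee_fin le_eqVlt; apply/orP; left; apply/eqP/eq_bigr => i _.
by rewrite !mxE opprB addrA subrK.
Qed.

Lemma lebesgue_translate d (v : 'rV[R]_d) A :
  L (( +%R v) @^-1` A) = L A.
Proof.
apply/eqP; rewrite eq_le lebesgue_translate_le//=.
have := lebesgue_translate_le (- v) (( +%R v) @^-1` A).
congr (L _ <= _); apply/seteqP; split => x /=; by rewrite ?addrA ?subrr ?addNr ?add0r.
Qed.

Lemma measurable_coord d (i : 'I_d) :
  measurable_fun (setT : set (Rlebesgue R d)) (fun x : 'rV[R]_d => x ord0 i).
Proof.
apply: (measurability _ (measurable_realfun.RGenOInfty.measurableE R)).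
move=> _ [_ [y ->] <-]; rewrite setTI.
have -> : (fun x : 'rV[R]_d => x ord0 i) @^-1` `]y, +oo[%classic =
   ~` [set x : 'rV[R]_d | x 0 i <= y]%R.
  by apply/seteqP; split => x /=; rewrite in_itv/= andbT ltNge => /negP.
exact/measurableC/measurable_halfspace.
Qed.

Lemma measurable_box d (ab : 'rV[R]_d * 'rV[R]_d) :
  measurable (box ab : set (Rlebesgue R d)).
Proof.
rewrite (_ : box ab = \bigcap_(i in [set: 'I_d])
   ((fun x : 'rV[R]_d => x ord0 i) @^-1` `[ab.1 ord0 i, ab.2 ord0 i]%classic)).
  apply: fin_bigcap_measurable => // i _; rewrite -[X in measurable X]setTI.
  exact: measurable_coord.
apply/seteqP; split => [x h i _ /=|x h i]; first by rewrite in_itv/=; exact: h.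
by have := h i I; rewrite /= in_itv.
Qed.

(** An open set is the union of the boxes with rational centre and half-side 1 / (n + 1) that it
    contains, and these are countably many. *)
Lemma measurable_open d (U : set 'rV[R]_d) : open U ->
  measurable (U : set (Rlebesgue R d)).
Proof.
move=> /open_enormP oU.
pose I := ('rV[rat]_d * nat)%type.
pose Q (q : I) : 'rV[R]_d * 'rV[R]_d :=
  (map_mx ratr q.1 - const_mx q.2.+1%:R^-1, map_mx ratr q.1 + const_mx q.2.+1%:R^-1)%R.
rewrite (_ : U = \bigcup_(q in [set q : I | box (Q q) `<=` U]) box (Q q)).
  rewrite bigcup_mkcond; apply: countable_bigcupT_measurable => [|q].
    exact: countableP.
  by case: ifP => _; [exact: measurable_box|exact: measurable0].
apply/seteqP; split => [x Ux|x [q /= QU] /QU//].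
have [e e0 eU] := oU x Ux.
have [n ne] : exists n : nat, (d%:R * (2 * n.+1%:R^-1) < e)%R.
  exists (Num.truncn (d%:R * 2 / e)%R).
  rewrite mulrA ltr_pdivrMr// -ltr_pdivrMl// [ltLHS]mulrC.
  exact: truncnS_gt.
have /choice[q qP] : forall i, exists q : rat, (`|x 0 i - ratr q| < n.+1%:R^-1)%R.
  move=> i; have [q] := @rat_in_itvoo R (x 0 i - n.+1%:R^-1)%R (x 0 i + n.+1%:R^-1)%R
     ltac:(by rewrite ltrD2l gtrN ?invr_gt0).
  by rewrite in_itv/= -ltr_distl distrC; exists q.
exists (\row_i q i, n)%R; last first.
  by move=> i; rewrite !mxE -ler_distl ltW.
move=> y yQ; apply: eU; apply: le_lt_trans ne; apply: enorm_le_coord => i.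
rewrite !mxE; have := yQ i; rewrite !mxE/= -ler_distl => h.
apply: le_trans (ler_distD (ratr (q i)) _ _) _.
by rewrite mulr2n mulrDl mul1r lerD// distrC ltW.
Qed.

End lebesgue_basics.

(** * Steiner symmetrisation *)

Section coordinate_slices.
Context {R : realType} {n : nat}.
Variable i : 'I_n.+1.
Implicit Types (x y : 'rV[R]_n.+1) (z : 'rV[R]_n) (t : R).

(** Identifies R x R^n with R^(n+1) along axis [i]; [col' i] is the projection that forgets this
    coordinate. *)
Definition ins t z : 'rV[R]_n.+1 :=
  \row_j oapp (fun j' => z 0 j') t (unlift i j).

Lemma ins_at t z : ins t z 0 i = t.
Proof. by rewrite mxE unlift_none. Qed.

Lemma ins_lift t z j : ins t z 0 (lift i j) = z 0 j.
Proof. by rewrite mxE liftK. Qed.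

Lemma col'_ins t z : col' i (ins t z) = z.
Proof. by apply/rowP => j; rewrite mxE ins_lift. Qed.

Lemma ins_col' x : ins (x 0 i) (col' i x) = x.
Proof.
by apply/rowP => j; case: (unliftP i j) => [k ->|->]; rewrite ?ins_at// ins_lift mxE.
Qed.

Lemma edot_ins x y : edot x y = x 0 i * y 0 i + edot (col' i x) (col' i y).
Proof.
rewrite /edot (bigD1_ord i)//=; congr (_ + _).
by apply: eq_bigr => j _; rewrite !mxE.
Qed.

Definition box_del (ab : 'rV[R]_n.+1 * 'rV[R]_n.+1) := (col' i ab.1, col' i ab.2).

Lemma box_ins ab t z :
  box ab (ins t z) <-> ab.1 0 i <= t <= ab.2 0 i /\ box (box_del ab) z.
Proof.
split=> [h|[h1 h2] j].
  by split; [have := h i; rewrite ins_at|move=> j; have := h (lift i j); rewrite ins_lift !mxE].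
case: (unliftP i j) => [k ->|->]; last by rewrite ins_at.
by have := h2 k; rewrite ins_lift !mxE.
Qed.

Lemma is_box_del ab : is_box ab -> is_box (box_del ab).
Proof. by move=> h j; rewrite !mxE. Qed.

Lemma box_volume_del ab :
  box_volume ab = ((ab.2 0 i - ab.1 0 i)%:E * box_volume (box_del ab))%E.
Proof.
rewrite /box_volume -EFinM (bigD1_ord i)//=; congr (_ * _)%:E.
by apply: eq_bigr => j _; rewrite !mxE.
Qed.

Definition fiber (A : set 'rV[R]_n.+1) z : set R := [set t | A (ins t z)].

Definition cylinder (I : set R) (B : set 'rV[R]_n) : set 'rV[R]_n.+1 :=
  [set x : 'rV[R]_n.+1 | I (x 0 i) /\ B (col' i x)].

Lemma fiber_box ab z : box (box_del ab) z ->
  fiber (box ab) z = `[ab.1 0 i, ab.2 0 i]%classic.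
Proof.
move=> h; apply/seteqP; split => t.
  by move/box_ins => [h1 _]; rewrite /= in_itv.
by rewrite /= in_itv => h1; apply/box_ins.
Qed.

Lemma fiber_box0 ab z : ~ box (box_del ab) z -> fiber (box ab) z = set0.
Proof. by move=> h; apply/seteqP; split => t // /box_ins[]. Qed.

Local Open Scope ereal_scope.
Notation L := (@lebesgue_outer R _).
Notation lam := (@lebesgue_measure R).

Lemma measurable_fiber_box ab z : measurable (fiber (box ab) z).
Proof.
by have [h|h] := pselect (box (box_del ab) z); [rewrite fiber_box|rewrite fiber_box0].
Qed.

Lemma fiber_box_measure ab z : is_box ab ->
  lam (fiber (box ab) z) = (ab.2 ord0 i - ab.1 ord0 i)%:E * (\1_(box (box_del ab)) z)%:E.
Proof.
move=> bab; rewrite indicE; have [h|h] := pselect (box (box_del ab) z).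
  rewrite mem_set// mule1 fiber_box// lebesgue_measure_itv/= lte_fin.
  case: ltP => // ba; have := bab i => /(conj ba)/andP.
  by rewrite -eq_le => /eqP ->; rewrite subrr.
by rewrite memNset// mule0 fiber_box0// measure0.
Qed.

(** A cover of A by boxes cuts every fiber into a cover by intervals; the length of the slice of a
    box integrates to at most its volume. Summing over the cover bounds the integral by the total
    volume. *)
Lemma integral_fiber_le (A : set 'rV[R]_n.+1) :
  (forall z, measurable (fiber A z)) ->
  measurable_fun (setT : set (Rlebesgue R n)) (fun z => lam (fiber A z)) ->
  \int[lebesgue n]_z lam (fiber A z) <= L A.
Proof.
move=> mA mlA; rewrite leNgt; apply/negP => /(cover_outer_seq box_volume_ge0)[c [cb Ac cA]].
have c0 m : 0 <= oapp box_volume 0 (c m).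
  by case cm : (c m) => [ab|//=]; apply: box_volume_ge0; exact: cb cm.
move: cA; apply/negP; rewrite -leNgt.
pose g m z := lam (fiber (oapp box set0 (c m)) z).
have fib0 z : fiber set0 z = set0 by apply/seteqP; split.
have mg m : measurable_fun (setT : set (Rlebesgue R n)) (g m).
  rewrite /g; case cm : (c m) => [ab|]/=; last first.
    by under eq_fun do rewrite fib0 measure0; exact: measurable_cst.
  under eq_fun do rewrite (fiber_box_measure _ (cb _ _ cm)).
  apply: measurable_funeM; apply/measurable_EFinP.
  by apply: measurable_indic; exact: measurable_box.
apply: (@le_trans _ _ (\int[lebesgue n]_z (\sum_(m <oo) g m z))).
  apply: ge0_le_integral.
  - exact: measurableT.
  - by move=> z _; exact: measure_ge0.
  - exact: mlA.
  - by apply: ge0_emeasurable_sum => // m z _ _; exact: measure_ge0.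
  - move=> z _; apply: measure_sigma_subadditive => //.
      move=> m; case: (c m) => [ab|]/=; last by rewrite fib0.
      exact: measurable_fiber_box.
    - exact: mA.
    - by move=> t At; have [m _ cm] := Ac _ At; exists m.
rewrite integral_nneseries//.
apply: lee_nneseries => [m _ _|m _]; first by apply: integral_ge0 => *; exact: measure_ge0.
rewrite /g; case cm : (c m) => [ab|]/=; last first.
  by under eq_integral do rewrite fib0 measure0; rewrite integral0.
have bab := cb _ _ cm.
under eq_integral do rewrite (fiber_box_measure _ bab).
rewrite ge0_integralZl//; first last.
- by rewrite lee_fin subr_ge0; exact: bab.
- apply/measurable_EFinP.
  by apply: measurable_indic; exact: measurable_box.
rewrite integral_indic//; last exact: measurable_box.
rewrite setIT box_volume_del lee_wpmul2l//.
  by rewrite lee_fin subr_ge0; exact: bab.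
exact/lebesgue_box_le/is_box_del.
Qed.

(** Integration in the other order: for fixed t in I, the bases of those boxes of the cover whose
    side contains t cover B. As B enters only through its outer measure it can be arbitrary, which
    matters for images under charts. *)
Lemma cylinder_ge (I : set R) (B : set 'rV[R]_n) : measurable I ->
  lam I * L B <= L (cylinder I B).
Proof.
move=> mI; rewrite leNgt; apply/negP => /(cover_outer_seq box_volume_ge0)[c [cb Ac cA]].
have c0 m : 0 <= oapp box_volume 0 (c m).
  by case cm : (c m) => [ab|//=]; apply: box_volume_ge0; exact: cb cm.
move: cA; apply/negP; rewrite -leNgt.
pose J (ab : 'rV[R]_n.+1 * 'rV[R]_n.+1) := `[ab.1 ord0 i, ab.2 ord0 i]%classic.
pose g m t := oapp (fun ab => box_volume (box_del ab) * (\1_(J ab) t)%:E) 0 (c m).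
have g0 m t : 0 <= g m t.
  rewrite /g; case cm : (c m) => [ab|//=]; apply: mule_ge0 => //.
  exact/box_volume_ge0/is_box_del/(cb _ _ cm).
have mg m : measurable_fun I (g m).
  rewrite /g; case cm : (c m) => [ab|]/=; last exact: measurable_cst.
  apply: measurable_funeM; apply/measurable_EFinP; apply: measurable_indic.
  exact: measurable_itv.
apply: (@le_trans _ _ (\int[lam]_(t in I) (\sum_(m <oo) g m t))).
  rewrite muleC -integral_cst//; apply: ge0_le_integral => //.
  - by move=> t _; exact: outer_measure_ge0.
  - by apply: (ge0_emeasurable_sum (h := g) (P := xpredT)) => // m t _ _; exact: g0.
  - move=> t It.
    apply: (@le_trans _ _ (L (\bigcup_m oapp (fun ab => if t \in J ab then box (box_del ab) else set0) set0 (c m)))).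
      apply: le_outer_measure => z Bz.
      have [|m _] := Ac (ins t z); first by rewrite /cylinder/= ins_at col'_ins.
      case cm : (c m) => [ab|]//= /box_ins[h1 h2].
      by exists m => //; rewrite cm/= mem_set//= /J/= in_itv.
    apply: (le_trans (outer_measure_sigma_subadditive (@lebesgue_outer R n) _)).
    apply: lee_nneseries => m _; first by move=> _; exact: outer_measure_ge0.
    rewrite /g; case cm : (c m) => [ab|]/=; last by rewrite outer_measure0.
    rewrite indicE; case: ifPn => _; last by rewrite outer_measure0 mule0.
    by rewrite mule1; exact/lebesgue_box_le/is_box_del/(cb _ _ cm).
rewrite integral_nneseries//.
apply: lee_nneseries => [m _ _|m _]; first by apply: integral_ge0 => *; exact: g0.
rewrite /g; case cm : (c m) => [ab|]/=; last by rewrite integral0.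
have bab := cb _ _ cm.
rewrite ge0_integralZl//; first last.
- exact/box_volume_ge0/is_box_del.
- by apply/measurable_EFinP; apply: measurable_indic; exact: measurable_itv.
rewrite integral_indic//; last exact: measurable_itv.
rewrite box_volume_del muleC lee_wpmul2r//.
  exact/box_volume_ge0/is_box_del.
apply: (@le_trans _ _ (lam (J ab))); first last.
  rewrite lebesgue_measure_itv/=; case: ifPn => // _.
  by rewrite lee_fin subr_ge0; exact: bab.
apply: le_measure; [apply/mem_set|apply/mem_set|exact: subIsetl].
  by apply: measurableI => //; exact: measurable_itv.
exact: measurable_itv.
Qed.

Lemma cylinder_le (a b : R) (B : set 'rV[R]_n) : (a < b)%R ->
  L (cylinder `[a, b]%classic B) <= (b - a)%:E * L B.
Proof.
move=> ab; apply: (le_lebesgue_outer_of_box (mu := fun B => L (cylinder `[a, b]%classic B))).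
- by rewrite subr_gt0.
- by move=> C; exact: outer_measure_ge0.
- rewrite (_ : cylinder _ _ = set0) ?outer_measure0//.
  by apply/seteqP; split => x // [].
- by move=> B1 B2 B12; apply: le_outer_measure => x [h1 h2]; split => //; exact: B12.
- move=> F; apply: le_trans (outer_measure_sigma_subadditive (@lebesgue_outer R n.+1) _).
  by apply: le_outer_measure => x [h1 [m _ Fm]]; exists m.
- move=> Q bQ; pose P := (ins a Q.1, ins b Q.2).
  have bP : is_box P.
    move=> j; case: (unliftP i j) => [k ->|->]; rewrite /= ?ins_at ?ins_lift; first exact: bQ.
    exact: ltW.
  have PQ : box_del P = Q by rewrite /box_del/= !col'_ins; case: (Q).
  rewrite (_ : cylinder _ _ = box P).
    by apply: le_trans (lebesgue_box_le bP) _; rewrite box_volume_del PQ/= !ins_at.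
  apply/seteqP; split => x.
    move=> [h1 h2]; rewrite -(ins_col' x); apply/box_ins.
    by rewrite PQ/= !ins_at; move: h1; rewrite /= in_itv.
  rewrite -{1}(ins_col' x) => /box_ins; rewrite PQ/= !ins_at => -[h1 h2].
  by split => //=; rewrite in_itv.
Qed.

End coordinate_slices.

(** * The Lebesgue measure of a box *)

Section box_measure.
Context {R : realType}.
Local Open Scope ereal_scope.
Notation L := (@lebesgue_outer R _).

(** In dimension 0 a box is the single point, with the empty product 1 as volume, and a cover of a
    nonempty set uses at least one box. *)
Lemma lebesgue0_ge1 (A : set 'rV[R]_0) : A !=set0 -> 1 <= L A.
Proof.
move=> [x Ax]; rewrite leNgt; apply/negP => /(cover_outer_seq box_volume_ge0)[c [cb Ac cA]].
have c0 m : 0 <= oapp box_volume 0 (c m).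
  by case cm : (c m) => [ab|//=]; apply: box_volume_ge0; exact: cb cm.
move: cA; apply/negP; rewrite -leNgt.
have [m _] := Ac _ Ax; case cm : (c m) => [ab|]//= _.
apply: (@le_trans _ _ (\sum_(0 <= k < m.+1) oapp box_volume 0 (c k))).
  rewrite big_nat_recr//= cm/= {2}/box_volume big_ord0 leeDr//.
  by apply: sume_ge0.
by apply: nneseries_lim_ge.
Qed.

(** The lower bound goes by induction on the dimension: a box is the cylinder over a box of one
    dimension less, and [cylinder_ge] multiplies the measures. *)
Lemma lebesgue_box d (ab : 'rV[R]_d * 'rV[R]_d) :
  is_box ab -> L (box ab) = box_volume ab.
Proof.
elim: d ab => [|n ih] ab bab; apply/eqP; rewrite eq_le lebesgue_box_le//=.
  rewrite /box_volume big_ord0; apply: lebesgue0_ge1.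
  by exists 0%R => -[].
apply: le_trans (le_trans (cylinder_ge ord0 (box (box_del ord0 ab)) (I := `[ab.1 ord0 ord0, ab.2 ord0 ord0]%classic) _) _) => //.
  rewrite ih; last exact: is_box_del.
  rewrite (box_volume_del ord0) lebesgue_measure_itv/= lte_fin.
  case: ltP => // ba; have := bab ord0 => /(conj ba)/andP.
  by rewrite -eq_le => /eqP ->; rewrite subrr.
apply: le_outer_measure => x [/=]; rewrite in_itv/= => h1 h2.
by rewrite -(ins_col' ord0 x); apply/box_ins.
Qed.

End box_measure.

(** * Symmetrisation of open sets along one axis *)

Section steiner.
Context {R : realType} {n : nat}.
Variable i : 'I_n.+1.
Implicit Types (U : set 'rV[R]_n.+1) (z : 'rV[R]_n).
Notation L := (@lebesgue_outer R _).
Notation lam := (@lebesgue_measure R).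

Lemma enorm_ins_sqr t s z w :
  enorm (ins i t z - ins i s w) ^+ 2 = (t - s) ^+ 2 + enorm (z - w) ^+ 2.
Proof.
have -> : ins i t z - ins i s w = ins i (t - s) (z - w).
  apply/rowP => j; rewrite !mxE; by case: (unliftP i j) => [k _|_] /=; rewrite ?mxE.
by rewrite !enorm_sqr (edot_ins i) ins_at col'_ins expr2.
Qed.

Lemma col'_enorm_le (x y : 'rV[R]_n.+1) :
  enorm (col' i x - col' i y) <= enorm (x - y).
Proof.
rewrite -ler_sqr ?nnegrE ?enorm_ge0//.
by rewrite -{2}(ins_col' i x) -{2}(ins_col' i y) enorm_ins_sqr lerDr sqr_ge0.
Qed.

Lemma enorm_ins_same t z w : enorm (ins i t z - ins i t w) = enorm (z - w).
Proof.
by apply/eqP; rewrite -(@eqrXn2 _ 2) ?enorm_ge0// enorm_ins_sqr subrr expr0n/= add0r.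
Qed.

Lemma enorm_ins_at t s z : enorm (ins i t z - ins i s z) = `|t - s|.
Proof.
apply/eqP; rewrite -(@eqrXn2 _ 2) ?enorm_ge0// enorm_ins_sqr subrr enorm0 expr0n/= addr0.
by rewrite real_normK// num_real.
Qed.

Lemma open_fiber U z : open U -> open (fiber i U z).
Proof.
move=> /open_enormP oU; rewrite openE => t /oU[e e0 eU].
apply/nbhs_ballP; exists e => //= s; rewrite /ball/= distrC => ts.
by apply: eU; rewrite enorm_ins_at.
Qed.

Lemma measurable_fiber U z : open U -> measurable (fiber i U z).
Proof. by move=> oU; apply: open_measurable; exact: open_fiber. Qed.

(** The fiber is the increasing union of the closed sets [W m] of those t around which the ball of
    radius 1 / (m + 1) stays in U. By continuity from below some [W m] is already longer than c, and
    it is contained in the fiber over every w that close to z. *)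
Lemma fiber_length_lsc U z c : open U -> (c%:E < lam (fiber i U z))%E ->
  exists2 e, 0 < e & forall w, enorm (w - z) < e -> (c%:E < lam (fiber i U w))%E.
Proof.
move=> oU cU.
pose W m := [set t | forall x, enorm (x - ins i t z) < m.+1%:R^-1 -> U x].
have closedW m : closed (W m).
  rewrite -[W m]setCK; apply: open_closedC; rewrite openE => t /= /existsNP[x /not_implyP[xt nUx]].
  apply/nbhs_ballP; exists (m.+1%:R^-1 - enorm (x - ins i t z)) => /=; first by rewrite subr_gt0.
  move=> s; rewrite /ball/= => ts /(_ x); apply/not_implyP; split => //.
  by apply: le_lt_trans (enorm_triangle (ins i t z) _ _) _; rewrite enorm_ins_at -ltrBrDl.
have mW m : measurable (W m) by exact: closed_measurable.
have UW : fiber i U z = \bigcup_m W m.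
  apply/seteqP; split => t; last first.
    by move=> [m _]; apply; rewrite subrr enorm0 invr_gt0.
  move=> /(open_enormP U).1 => /(_ oU)[e e0 eU].
  exists (Num.truncn e^-1) => // x xt; apply: eU; apply: lt_trans xt _.
  by rewrite invf_plt ?posrE// truncnS_gt.
have [m cm] : exists m, (c%:E < lam (W m))%E.
  apply: contrapT => /forallNP h; move: cU; apply/negP; rewrite -leNgt UW.
  have ndW : nondecreasing_seq W.
    move=> p q pq; apply/subsetPset => t Wt x xt; apply: Wt; apply: lt_le_trans xt _.
    by rewrite lef_pV2 ?posrE// ler_nat ltnS.
  have cv := nondecreasing_cvg_mu (mu := lam) mW (bigcup_measurable (fun k _ => mW k)) ndW.
  rewrite -(cvg_lim _ cv)//; apply: lime_le; first by apply/cvg_ex; eexists; exact: cv.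
  by apply: nearW => m; rewrite leNgt; apply/negP/h.
exists m.+1%:R^-1 => [|w wz]; first by rewrite invr_gt0.
apply: lt_le_trans cm _; apply: le_measure; rewrite ?inE.
- exact: mW.
- exact: measurable_fiber.
by move=> t; apply; rewrite enorm_ins_same.
Qed.

Lemma measurable_fiber_length U : open U ->
  measurable_fun (setT : set (Rlebesgue R n)) (fun z => lam (fiber i U z)).
Proof.
move=> oU; apply: (measurability _ (ErealGenOInfty.measurableE R)).
move=> _ [_ [c ->] <-]; rewrite setTI; apply: measurable_open.
apply/open_enormP => z /=; rewrite in_itv/= andbT => /(fiber_length_lsc oU)[e e0 h].
by exists e => // w /h; rewrite in_itv/= andbT.
Qed.

(** Each fiber along axis [i] is replaced by the open interval of the same length centred at 0, or
    by the whole line if the length is infinite. The strict inequality keeps the result open. *)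
Definition steiner U : set 'rV[R]_n.+1 :=
  [set x : 'rV[R]_n.+1 | ((2 * `|x 0 i|)%:E < lam (fiber i U (col' i x)))%E].

Lemma open_steiner U : open U -> open (steiner U).
Proof.
move=> oU; apply/open_enormP => x; rewrite /steiner/= => xU.
have [c xc cU] : exists2 c : R, 2 * `|x 0 i| < c & (c%:E < lam (fiber i U (col' i x)))%E.
  case: (lam _) xU => [r| |]//; rewrite ?lte_fin => h.
    by exists ((2 * `|x 0 i| + r) / 2); [|rewrite lte_fin]; lra.
  by exists (2 * `|x 0 i| + 1); [lra|rewrite ltry].
have [e e0 eU] := fiber_length_lsc oU cU.
exists (Num.min e ((c - 2 * `|x 0 i|) / 2)).
  by rewrite lt_min e0/= divr_gt0// subr_gt0.
move=> y; rewrite lt_min => /andP[ye yc].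
apply: le_lt_trans (eU _ (le_lt_trans (col'_enorm_le _ _) ye)).
rewrite lee_fin; have := normr_coord_le (y - x) i; rewrite !mxE => h.
by have := ler_normD (y 0 i - x 0 i) (x 0 i); rewrite subrK; lra.
Qed.

Lemma fiber_steiner U z a : lam (fiber i U z) = a%:E ->
  fiber i (steiner U) z = `]- (a / 2), a / 2[%classic.
Proof.
move=> Ua; apply/seteqP; split => t; rewrite /fiber /steiner /= ins_at col'_ins Ua in_itv/= lte_fin -ltr_norml => h; lra.
Qed.

Lemma fiber_length_steiner U z : (lam (fiber i U z) < +oo)%E ->
  lam (fiber i (steiner U) z) = lam (fiber i U z).
Proof.
case Ua : (lam (fiber i U z)) => [a| |]//= _.
  have a0 : 0 <= a by rewrite -lee_fin -Ua measure_ge0.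
  rewrite (fiber_steiner Ua) lebesgue_measure_itv/= lte_fin.
  case: ifPn => h; first by rewrite -EFinD; congr EFin; lra.
  by congr EFin; lra.
by have : (0 <= lam (fiber i U z))%E by []; rewrite Ua.
Qed.

Lemma lam_le_of_subset_itv (P : set R) (p q : R) : measurable P -> p <= q ->
  (forall t, P t -> p <= t <= q) -> (lam P <= (q - p)%:E)%E.
Proof.
move=> mP pq h; apply: (@le_trans _ _ (lam `[p, q]%classic)).
  by apply: le_measure; rewrite ?inE// => t /h; rewrite /= in_itv.
by rewrite lebesgue_measure_itv/=; case: ifPn => // _; rewrite lee_fin subr_ge0.
Qed.

(** Put c = |x_i - y_i|. If all points of the fibers P and Q were closer than c, then P would lie in
    [sup Q - c, inf Q + c], so the lengths of P and Q would add up to at most 2c; but they exceed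
    2|x_i| and 2|y_i|. Hence some p in P and q in Q are at least c apart, and the points of U above
    them are at least as far apart as x and y. *)
Lemma steiner_diam U D : open U ->
  (forall x y, U x -> U y -> enorm (x - y) <= D) ->
  forall x y, steiner U x -> steiner U y -> enorm (x - y) <= D.
Proof.
move=> oU dU x y; rewrite /steiner /=.
set P := fiber i U (col' i x); set Q := fiber i U (col' i y) => xU yU.
have mP : measurable P by exact: measurable_fiber.
have mQ : measurable Q by exact: measurable_fiber.
pose c := `|x 0 i - y 0 i|.
have [p [q [Pp Qq pqc]]] : exists p q, [/\ P p, Q q & c <= `|p - q|].
  apply: contrapT => h.
  have {}h p q : P p -> Q q -> `|p - q| < c.
    by move=> Pp Qq; rewrite ltNge; apply/negP => ?; apply: h; exists p, q.
  have P0 : P !=set0.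
    apply/set0P/eqP => P0; move: xU; rewrite P0 measure0 lte_fin; have := normr_ge0 (x 0 i); lra.
  have Q0 : Q !=set0.
    apply/set0P/eqP => Q0; move: yU; rewrite Q0 measure0 lte_fin; have := normr_ge0 (y 0 i); lra.
  have [p0 Pp0] := P0; have [q0 Qq0] := Q0.
  have ubQ : has_sup Q.
    split=> //; exists (p0 + c) => q Qq; have := h _ _ Pp0 Qq.
    rewrite ltr_norml; lra.
  have lbQ : has_inf Q.
    split=> //; exists (p0 - c) => q Qq; have := h _ _ Pp0 Qq.
    rewrite ltr_norml; lra.
  have Qle : (lam Q <= (sup Q - inf Q)%:E)%E.
    apply: lam_le_of_subset_itv => //.
      exact: le_trans (ge_inf lbQ.2 Qq0) (ub_le_sup ubQ.2 Qq0).
    by move=> t Qt; rewrite (ge_inf lbQ.2 Qt) (ub_le_sup ubQ.2 Qt).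
  have PI p : P p -> sup Q - c <= p <= inf Q + c.
    move=> Pp; apply/andP; split.
      rewrite lerBlDr; apply: ge_sup => // q Qq; have := h _ _ Pp Qq.
      rewrite ltr_norml; lra.
    rewrite -lerBlDr; apply: lb_le_inf => // q Qq; have := h _ _ Pp Qq.
    rewrite ltr_norml; lra.
  have Ple : (lam P <= (inf Q + c - (sup Q - c))%:E)%E.
    apply: lam_le_of_subset_itv => //; by have /andP[h1 h2] := PI _ Pp0; lra.
  have := lt_le_trans xU Ple; have := lt_le_trans yU Qle; rewrite !lte_fin.
  by have := ler_normB (x 0 i) (y 0 i); rewrite -/c; lra.
have := dU _ _ Pp Qq; apply: le_trans.
rewrite -ler_sqr ?nnegrE ?enorm_ge0// enorm_ins_sqr.
rewrite -{1}(ins_col' i x) -{1}(ins_col' i y) enorm_ins_sqr lerD2r.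
by rewrite -(real_normK (num_real (x 0 i - y 0 i))) -(real_normK (num_real (p - q))) ler_sqr ?nnegrE.
Qed.

(** The missing half of Fubini is [integral_fiber_le] for the complement of U in the box: on the box
    itself the two quantities agree, U is measurable, and everything is finite and can be
    cancelled. *)
Lemma lebesgue_le_integral_fiber U ab : open U -> is_box ab -> U `<=` box ab ->
  (L U <= \int[lebesgue n]_z lam (fiber i U z))%E.
Proof.
move=> oU bab UB; pose B := box ab.
have mU : measurable (U : set (Rlebesgue R n.+1)) by exact: measurable_open.
have mfU z : measurable (fiber i U z) by exact: measurable_fiber.
have mfB z : measurable (fiber i B z) by exact: measurable_fiber_box.
have fBU z : fiber i (B `\` U) z = fiber i B z `\` fiber i U z by [].
have fB_fin z : (lam (fiber i B z) < +oo)%E.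
  by rewrite fiber_box_measure// -EFinM ltry.
have sub z : fiber i U z `<=` fiber i B z by move=> t; exact: UB.
have mlU := measurable_fiber_length oU.
have mlB : measurable_fun (setT : set (Rlebesgue R n)) (fun z => lam (fiber i B z)).
  under eq_fun do rewrite fiber_box_measure//.
  apply: measurable_funeM; apply/measurable_EFinP.
  by apply: measurable_indic; exact: measurable_box.
have lBU z : lam (fiber i (B `\` U) z) = (lam (fiber i B z) - lam (fiber i U z))%E.
  rewrite fBU measureD; [by rewrite setIidr|exact: mfB|exact: mfU|exact: fB_fin].
have mlBU : measurable_fun (setT : set (Rlebesgue R n)) (fun z => lam (fiber i (B `\` U) z)).
  by under eq_fun do rewrite lBU; exact: emeasurable_funB.
have JBU : (\int[lebesgue n]_z lam (fiber i (B `\` U) z) <= L (B `\` U))%E.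
  by apply: integral_fiber_le => // z; rewrite fBU; exact: measurableD.
have JB : (\int[lebesgue n]_z lam (fiber i (B `\` U) z) +
           \int[lebesgue n]_z lam (fiber i U z) = L B)%E.
  rewrite -ge0_integralD//.
  transitivity (\int[lebesgue n]_z lam (fiber i B z))%E.
    apply: eq_integral => z _; rewrite lBU subeK// ge0_fin_numE ?measure_ge0//.
    apply: le_lt_trans (fB_fin z); apply: le_measure.
    - by apply/mem_set; exact: mfU.
    - by apply/mem_set; exact: mfB.
    - exact: sub.
  under eq_integral do rewrite (fiber_box_measure _ _ bab).
  rewrite ge0_integralZl//; first last.
  - by rewrite lee_fin subr_ge0; exact: bab.
  - apply/measurable_EFinP.
    by apply: measurable_indic; exact: measurable_box.
  rewrite integral_indic//; last exact: measurable_box.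
  rewrite setIT lebesgue_box// (box_volume_del i); congr (_ * _)%E.
  exact/lebesgue_box/is_box_del.
have LB : L B = (L U + L (B `\` U))%E.
  by rewrite (mU B) setIidr.
have finB : (L B < +oo)%E by rewrite lebesgue_box// ltry.
have finBU : L (B `\` U) \is a fin_num.
  rewrite ge0_fin_numE ?outer_measure_ge0//; apply: le_lt_trans finB.
  by apply: le_outer_measure => x [].
rewrite -(leeD2rE _ _ finBU) -LB -JB addeC leeD2l//.
Qed.

(** Fibers keep their length, so the two halves of Fubini, one for U and one for its symmetrisation,
    meet in the same integral. *)
Lemma lebesgue_steiner U ab : open U -> is_box ab -> U `<=` box ab ->
  (L U <= L (steiner U))%E.
Proof.
move=> oU bab UB; apply: le_trans (lebesgue_le_integral_fiber oU bab UB) _.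
have fin z : (lam (fiber i U z) < +oo)%E.
  apply: (@le_lt_trans _ _ (lam (fiber i (box ab) z))).
    apply: le_measure; rewrite ?inE; last by move=> t; exact: UB.
      exact: measurable_fiber.
    exact: measurable_fiber_box.
  by rewrite fiber_box_measure// -EFinM ltry.
have oS := open_steiner oU.
apply: le_trans (integral_fiber_le (i := i) _ (measurable_fiber_length oS)); last first.
  by move=> z; exact: measurable_fiber.
apply: ge0_le_integral.
- exact: measurableT.
- by move=> z _; exact: measure_ge0.
- exact: measurable_fiber_length.
- exact: measurable_fiber_length.
- by move=> z _; rewrite fiber_length_steiner.
Qed.

End steiner.

(** * The isodiametric inequality *)

Lemma le_of_right_limit {R : realType} (f : R -> R) (a e0 : R) : 0 < e0 ->
  {for 0, continuous f} -> (forall e, 0 < e < e0 -> a <= f e) -> a <= f 0.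
Proof.
move=> e00 fc h; have cf : f x @[x --> 0^'+] --> f 0.
  exact: cvg_at_right_filter.
rewrite -(cvg_lim _ cf)//; apply: limr_ge; first by apply/cvg_ex; exists (f 0).
near=> e; apply: h; apply/andP; split; first by near: e; exact: nbhs_right_gt.
by near: e; exact: nbhs_right_lt.
Unshelve. all: by end_near. Qed.

(** * Volumes of balls *)

Section balls.
Context {R : realType}.
Notation L := (@lebesgue_outer R _).
Notation ballv := (@unit_ball_volume R).

Definition eball d (x : 'rV[R]_d) (r : R) := [set y : 'rV[R]_d | enorm (y - x) <= r].

Lemma box_of_diam d (U : set 'rV[R]_d) D : (forall x y, U x -> U y -> enorm (x - y) <= D) ->
  exists2 ab, is_box ab & U `<=` box ab.
Proof.
move=> dU; have [->|/set0P[x0 Ux0]] := eqVneq U set0.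
  by exists (0, 0) => // i.
have D0 : 0 <= D by exact: le_trans (enorm_ge0 _) (dU _ _ Ux0 Ux0).
exists (x0 - const_mx D, x0 + const_mx D) => [i|x Ux i].
  by rewrite !mxE lerD2l; lra.
have := le_trans (normr_coord_le (x - x0) i) (dU _ _ Ux Ux0).
by rewrite !mxE -ler_distl.
Qed.

Lemma lebesgue_bounded_lt_pinfty d (U : set 'rV[R]_d) D :
  (forall x y, U x -> U y -> enorm (x - y) <= D) -> (L U < +oo)%E.
Proof.
move=> /box_of_diam[ab bab Uab]; apply: (@le_lt_trans _ _ (L (box ab))).
  exact: le_outer_measure.
by rewrite lebesgue_box// ltry.
Qed.

Lemma lebesgue_ball_le d (x : 'rV[R]_d) r : 0 <= r ->
  (L (eball x r) <= ((2 * r) ^+ d)%:E)%E.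
Proof.
move=> r0; pose ab : 'rV[R]_d * 'rV[R]_d := (x - const_mx r, x + const_mx r).
apply: (@le_trans _ _ (L (box ab))).
  apply: le_outer_measure => y /= yx i.
  have := le_trans (normr_coord_le (y - x) i) yx.
  by rewrite !mxE -ler_distl.
apply: le_trans (lebesgue_box_le _) _; first by move=> i; rewrite !mxE lerD2l; lra.
rewrite lee_fin le_eqVlt; apply/orP; left; apply/eqP.
rewrite /box_volume -[X in _ ^+ X](card_ord d) -prodr_const; apply: eq_bigr => i _.
by rewrite !mxE; ring.
Qed.

Lemma unit_ball_volume_ge0 d : (0 <= ballv d)%E.
Proof. exact: outer_measure_ge0. Qed.

Lemma unit_ball_volume_fin d : ballv d \is a fin_num.
Proof.
rewrite ge0_fin_numE ?unit_ball_volume_ge0//.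
apply: le_lt_trans (ltry ((2 * 1) ^+ d)); apply: le_trans (lebesgue_ball_le 0 ler01).
by apply: le_outer_measure => x; rewrite /eball/= subr0.
Qed.

Definition omega d : R := fine (ballv d).

Lemma omegaE d : ballv d = (omega d)%:E.
Proof. by rewrite fineK// unit_ball_volume_fin. Qed.

Lemma omega_gt0 d : 0 < omega d.
Proof.
rewrite -lte_fin -omegaE.
pose r : R := d.+1%:R^-1; have r0 : 0 < r by rewrite invr_gt0.
pose ab : 'rV[R]_d * 'rV[R]_d := (- const_mx r, const_mx r).
have bab : is_box ab by move=> i; rewrite !mxE; lra.
apply: (@lt_le_trans _ _ (L (box ab))).
  rewrite lebesgue_box// lte_fin; apply: prodr_gt0 => i _; rewrite !mxE; lra.
apply: le_outer_measure => x /= xab; apply: le_trans (enorm_le_coord (a := r) _) _.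
  by move=> i; have := xab i; rewrite !mxE -ler_norml.
by rewrite /r ler_pdivrMr// mul1r ler_nat.
Qed.

Lemma lebesgue_ball d (x : 'rV[R]_d) r : 0 < r ->
  L (eball x r) = (omega d * r ^+ d)%:E.
Proof.
move=> r0; rewrite -(lebesgue_translate x) mulrC EFinM -omegaE.
rewrite -[in RHS](invrK r) exprVn -lebesgue_scale ?invr_gt0//; congr (L _).
apply/seteqP; split => y; rewrite /eball/= addrAC subrr add0r enormZ gtr0_norm ?invr_gt0//.
  by rewrite mulrC ler_pdivrMr ?mul1r.
by rewrite mulrC ler_pdivrMr ?mul1r.
Qed.

End balls.

Section isodiametric.
Context {R : realType}.
Notation L := (@lebesgue_outer R _).

Definition flip n (i : 'I_n) (x : 'rV[R]_n) : 'rV[R]_n :=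
  \row_j (if j == i then - x 0 j else x 0 j).

Lemma flip_ins n (i j : 'I_n.+1) t (x : 'rV[R]_n.+1) : j != i ->
  ins i t (col' i (flip j x)) = flip j (ins i t (col' i x)).
Proof.
move=> ji; apply/rowP => k; case: (unliftP i k) => [l ->|->].
  by rewrite ins_lift !mxE liftK/= mxE.
by rewrite ins_at !mxE unlift_none eq_sym (negbTE ji).
Qed.

Lemma flipK n (i : 'I_n) : involutive (@flip n i).
Proof.
by move=> x; apply/rowP => j; rewrite !mxE; case: eqP => // _; rewrite opprK.
Qed.

Lemma flip_col' n (i : 'I_n.+1) (x : 'rV[R]_n.+1) : col' i (flip i x) = col' i x.
Proof. by apply/rowP => j; rewrite !mxE eq_sym (negbTE (neq_lift _ _)). Qed.

(** Symmetrising along axis i creates the symmetry [flip i] and preserves [flip j] for j != i,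
    because the fibers over a point and over its flip coincide. So the axes can be treated one after
    the other. *)
Lemma symmetrization n (U : set 'rV[R]_n.+1) D (s : seq 'I_n.+1) : open U ->
  (forall x y, U x -> U y -> enorm (x - y) <= D) ->
  exists V : set 'rV[R]_n.+1,
    [/\ open V, forall x y, V x -> V y -> enorm (x - y) <= D, (L U <= L V)%E &
        forall i, i \in s -> forall x, V x -> V (flip i x)].
Proof.
move=> oU dU; elim: s => [|i s [V [oV dV UV sV]]]; first by exists U; split.
have [ab bab Vab] := box_of_diam dV.
exists (steiner i V); split.
- exact: open_steiner.
- exact: steiner_diam.
- exact: le_trans UV (lebesgue_steiner i oV bab Vab).
move=> j; have [->|ji] := eqVneq j i.
  by move=> _ x; rewrite /steiner/= flip_col' mxE eqxx normrN.
rewrite inE (negbTE ji)/= => js x; rewrite /steiner/= mxE eq_sym (negbTE ji).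
suff -> : fiber i V (col' i (flip j x)) = fiber i V (col' i x) by [].
apply/seteqP; split => t; rewrite /fiber/= flip_ins//; last exact: sV.
by move=> /(sV _ js); rewrite flipK.
Qed.

Lemma foldr_flip n (s : seq 'I_n) (x : 'rV[R]_n) : uniq s ->
  foldr (@flip n) x s = \row_j (if j \in s then - x 0 j else x 0 j).
Proof.
elim: s => [|i s ih] /=; first by move=> _; apply/rowP => j; rewrite mxE.
move=> /andP[is_ us]; rewrite ih//; apply/rowP => j; rewrite !mxE inE.
by case: eqVneq => // ->; rewrite (negbTE is_).
Qed.

(* Steiner symmetrisation in every coordinate direction makes the set symmetric
   about 0, and then it lies in the ball of radius D / 2. *)
Lemma isodiametric_open d (U : set 'rV[R]_d) D : 0 < D -> open U ->
  (forall x y, U x -> U y -> enorm (x - y) <= D) ->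
  (L U <= (omega d * (D / 2) ^+ d)%:E)%E.
Proof.
move=> D0 oU dU; rewrite -(lebesgue_ball 0) ?divr_gt0//.
case: d U oU dU => [|n] U oU dU.
  apply: le_outer_measure => x _; rewrite /eball/= subr0.
  have -> : x = 0 by apply/rowP => -[].
  by rewrite enorm0 divr_ge0// ltW.
have [V [oV dV UV sV]] := symmetrization (enum 'I_n.+1) oU dU.
apply: le_trans UV _; apply: le_outer_measure => x Vx; rewrite /eball/=.
have VNx : V (- x).
  suff: V (foldr (@flip _) x (enum 'I_n.+1)).
    rewrite foldr_flip ?enum_uniq//; congr V; apply/rowP => j.
    by rewrite !mxE mem_enum.
  elim: (enum _) sV => //= i s ih Vs; apply: (Vs i); first by rewrite inE eqxx.
  by apply: ih => j js; apply: Vs; rewrite inE js orbT.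
have := dV _ _ Vx VNx; rewrite opprK -mulr2n -scaler_nat enormZ subr0 ger0_norm//.
by rewrite ler_pdivlMr// mulrC.
Qed.

(** The open e-neighbourhood of A has diameter at most D + 2e; apply the open case to it and let e
    tend to 0. *)
Lemma isodiametric d (A : set 'rV[R]_d) D : 0 <= D ->
  (forall x y, A x -> A y -> enorm (x - y) <= D) ->
  (L A <= (omega d * (D / 2) ^+ d)%:E)%E.
Proof.
move=> D0 dA.
have finA : L A \is a fin_num.
  by rewrite ge0_fin_numE ?outer_measure_ge0//; exact: lebesgue_bounded_lt_pinfty dA.
(* D is rewritten as D + 2 * 0, which exhibits the bound as the value at 0 of a continuous function
   of e. *)
rewrite -(fineK finA) lee_fin -[X in (X / 2) ^+ d]addr0 -[X in D + X](mulr0 2).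
apply: (@le_of_right_limit _ (fun e => omega d * ((D + 2 * e) / 2) ^+ d) _ 1) => [//||e /andP[e0 _]].
  have h : (D + 2 * e) / 2 @[e --> (0 : R)] --> (D + 2 * 0) / 2.
    apply: cvgMr_tmp; apply: cvgD; first exact: cvg_cst.
    by apply: cvgMl_tmp; exact: cvg_id.
  apply: cvgM; first exact: cvg_cst.
  exact: (cvg_comp _ _ h (@exprn_continuous _ d _)).
rewrite -lee_fin fineK//.
pose U := [set y | exists2 x, A x & enorm (y - x) < e].
apply: (@le_trans _ _ (L U)).
  by apply: le_outer_measure => x Ax; exists x; rewrite // subrr enorm0.
apply: isodiametric_open; first by lra.
  apply/open_enormP => y [x Ax yx]; exists (e - enorm (y - x)); first by rewrite subr_gt0.
  move=> z zy; exists x => //; have := enorm_triangle y z x; lra.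
move=> y y' [x Ax yx] [x' Ax' yx'].
have := enorm_triangle x y y'; have := enorm_triangle x' x y'; have := dA _ _ Ax Ax'.
rewrite (enormB x' y'); lra.
Qed.

End isodiametric.

(** * Hausdorff measure in full dimension is Lebesgue measure *)

Section hausdorff_basics.
Context {R : realType}.
Implicit Types k d : nat.
Notation L := (@lebesgue_outer R _).
Notation Hd := (@hausdorff_delta R _ _).
Notation H := (@hausdorff_outer R _ _).

HB.instance Definition _ k d (delta : R) :=
  isOuterMeasure.Build R 'rV[R]_d (@hausdorff_delta R k d delta)
  (cover_outer0 id (@hausdorff_weight_ge0 R k d delta))
  (cover_outer_ge0 id (@hausdorff_weight_ge0 R k d delta))
  (@le_cover_outer _ _ _ id (small_set delta) (@hausdorff_weight R k d))
  (cover_outer_sigma_subadditive id (@hausdorff_weight_ge0 R k d delta)).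

Lemma ediam_le d (E : set 'rV[R]_d) D :
  (forall x y, E x -> E y -> enorm (x - y) <= D) -> (ediam E <= D%:E)%E.
Proof. by move=> h; apply: ge_ereal_sup => _ [[x y] [/= Ex Ey] <-]; rewrite lee_fin h. Qed.

Lemma small_setP d (E : set 'rV[R]_d) delta : small_set delta E ->
  exists D, [/\ 0 <= D, D <= delta, ediam E = D%:E &
    forall x y, E x -> E y -> enorm (x - y) <= D].
Proof.
move=> [E0 Ed]; have e0 := ediam_ge0 E0.
have fE : ediam E \is a fin_num.
  by rewrite ge0_fin_numE//; apply: le_lt_trans Ed (ltry _).
exists (fine (ediam E)); split; rewrite -?lee_fin ?fineK//.
move=> x y Ex Ey; rewrite -lee_fin fineK//.
by apply: ereal_sup_ubound; exists (x, y).
Qed.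

Lemma hausdorff_weightE k d (E : set 'rV[R]_d) D : ediam E = D%:E ->
  hausdorff_weight k E = (omega k * (D / 2) ^+ k)%:E.
Proof. by move=> h; rewrite /hausdorff_weight h omegaE -EFinM -EFin_expe -EFinM. Qed.

Lemma hausdorff_delta_single k d (E : set 'rV[R]_d) D delta : E !=set0 ->
  (forall x y, E x -> E y -> enorm (x - y) <= D) -> D <= delta ->
  (@hausdorff_delta R k d delta E <= (omega k * (D / 2) ^+ k)%:E)%E.
Proof.
move=> E0 dE Dd.
have sE : small_set delta E.
  by split => //; apply: le_trans (ediam_le dE) _; rewrite lee_fin.
apply: le_trans (cover_outer_index id (@hausdorff_weight_ge0 R k d delta) sE) _.
have [D' [D'0 D'd ED' dE']] := small_setP sE.
rewrite (hausdorff_weightE _ ED') lee_fin ler_wpM2l ?(ltW (omega_gt0 _))//.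
have D'D : D' <= D by rewrite -lee_fin -ED' ediam_le.
apply: lerXn2r; rewrite ?nnegrE; lra.
Qed.

Lemma hausdorff_le k d (A : set 'rV[R]_d) (a : \bar R) :
  (forall delta, 0 < delta -> (@hausdorff_delta R k d delta A <= a)%E) ->
  (@hausdorff_outer R k d A <= a)%E.
Proof. by move=> h; apply: ge_ereal_sup => _ [delta d0 <-]; exact: h. Qed.

(* Maps D -> 'rV_m and D -> 'rV_n play the role of a map from the image of p to
   the image of q, so that the lemma applies to a Lipschitz map as well as to
   the inverse of an expanding one. *)
Lemma hausdorff_lipschitz k (T : Type) m n (D : set T) (p : T -> 'rV[R]_m)
    (q : T -> 'rV[R]_n) (C : R) : 0 < C ->
  (forall i j, D i -> D j -> enorm (q i - q j) <= C * enorm (p i - p j)) ->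
  (@hausdorff_outer R k n (q @` D) <= (C ^+ k)%:E * @hausdorff_outer R k m (p @` D))%E.
Proof.
move=> C0 qp; apply: hausdorff_le => delta d0.
have dC : 0 < delta / C by rewrite divr_gt0.
apply: (@le_trans _ _ ((C ^+ k)%:E * @hausdorff_delta R k m (delta / C) (p @` D))%E); last first.
  by apply: lee_wpmul2l; [rewrite lee_fin exprn_ge0// ltW|exact: hausdorff_delta_le].
pose mu (B : set 'rV[R]_m) := @hausdorff_delta R k n delta (q @` (D `&` p @^-1` B)).
have -> : hausdorff_delta k delta (q @` D) = mu (p @` D).
  congr hausdorff_delta; congr image; apply/seteqP; split => [i Di|i []//].
  by split => //; exists i.
apply: (le_cover_outer_of_index (@hausdorff_weight_ge0 R k m (delta / C)) (mu := mu)).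
- exact: exprn_gt0.
- by move=> B; exact: outer_measure_ge0.
- by rewrite /mu preimage_set0 setI0 image_set0; exact: outer_measure0.
- move=> B1 B2 B12; apply: le_outer_measure => _ [i [Di Bi] <-].
  by exists i => //; split => //; exact: B12.
- move=> F; apply: le_trans (outer_measure_sigma_subadditive (@hausdorff_delta R k n delta) _).
  apply: le_outer_measure => _ [i [Di [j _ Fj]] <-].
  by exists j => //; exists i.
- move=> E sE; have [e [e0 ed Ee dE]] := small_setP sE.
  rewrite (hausdorff_weightE _ Ee) /mu.
  have [->|/set0P ne] := eqVneq (q @` (D `&` p @^-1` E)) set0.
    rewrite outer_measure0 -EFinM lee_fin !mulr_ge0 ?exprn_ge0 ?(ltW C0)//.
      exact/ltW/omega_gt0.
    by rewrite divr_ge0.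
  apply: le_trans (hausdorff_delta_single _ (D := C * e) ne _ _) _.
  + move=> _ _ [i [Di Ei] <-] [j [Dj Ej] <-].
    by apply: le_trans (qp _ _ Di Dj) _; rewrite ler_pM2l// dE.
  + by rewrite -ler_pdivlMl// mulrC.
  + by rewrite -EFinM lee_fin -mulrA exprMn mulrCA.
Qed.

End hausdorff_basics.

Section hausdorff_lebesgue.
Context {R : realType}.
Notation L := (@lebesgue_outer R _).

Lemma cvg_prod_shift (I : Type) (s : seq I) (g : I -> R) :
  \prod_(j <- s) (g j + x) @[x --> (0 : R)] --> \prod_(j <- s) (g j + 0).
Proof.
elim: s => [|j s ih]; first by under eq_fun do rewrite big_nil; rewrite big_nil; exact: cvg_cst.
under eq_fun do rewrite big_cons; rewrite big_cons; apply: cvgM => //.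
by apply: cvgD; [exact: cvg_cst|exact: cvg_id].
Qed.

Lemma outer_measure_bigsetU_le (T : Type) (mu : {outer_measure set T -> \bar R})
    (I : Type) (s : seq I) (F : I -> set T) :
  (mu (\big[setU/set0]_(j <- s) F j) <= \sum_(j <- s) mu (F j))%E.
Proof.
elim: s => [|j s ih]; first by rewrite !big_nil outer_measure0.
by rewrite !big_cons; apply: le_trans (outer_measureU2 _ _ _) _; rewrite leeD2l.
Qed.

(** By the isodiametric inequality the weight of a covering set dominates its Lebesgue measure, at
    every scale; 1 is an arbitrary choice of scale. *)
Lemma lebesgue_le_hausdorff k (A : set 'rV[R]_k) :
  (L A <= @hausdorff_outer R k k A)%E.
Proof.
apply: le_trans (hausdorff_delta_le k A ltr01); rewrite -[leRHS]mul1e.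
apply: (le_cover_outer_of_index (@hausdorff_weight_ge0 R k k 1) (mu := L)) => //.
- by move=> B; exact: outer_measure_ge0.
- by move=> B1 B2; exact: le_outer_measure.
- move=> E sE; have [e [e0 ed Ee dE]] := small_setP sE.
  by rewrite mul1e (hausdorff_weightE _ Ee); exact: isodiametric.
Qed.

Variables (k : nat) (delta : R).
Hypothesis delta_gt0 : 0 < delta.
Notation Hd := (@hausdorff_delta R k k delta).

Definition cube (a : 'rV[R]_k) (t : R) := box (a, a + const_mx t).

(** The admissible constants, to be improved step by step down to 1. The restriction on t makes both
    the cube, of diameter at most k t, and its inscribed ball, of diameter t, small enough to be
    covering sets. *)
Definition cube_bound (C : R) := forall (a : 'rV[R]_k) (t : R),
  0 < t -> k.+1%:R * t <= delta -> (Hd (cube a t) <= (C * t ^+ k)%:E)%E.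

Lemma cubeP a t x : cube a t x <-> forall i, 0 <= x 0 i - a 0 i <= t.
Proof.
by split => h i; have := h i; rewrite !mxE/= subr_ge0 lerBlDl.
Qed.

Lemma lebesgue_cube a t : 0 <= t -> L (cube a t) = (t ^+ k)%:E.
Proof.
move=> t0; rewrite lebesgue_box; last by move=> i; rewrite !mxE lerDl.
congr EFin; rewrite -[X in _ ^+ X](card_ord k) -prodr_const; apply: eq_bigr => i _.
by rewrite !mxE addrAC subrr add0r.
Qed.

(** The starting constant comes from the cover consisting of the cube alone. *)
Lemma cube_bound0 : cube_bound (omega k * (k%:R / 2) ^+ k).
Proof.
move=> a t t0 tdelta; rewrite -mulrA -exprMn mulrAC.
apply: hausdorff_delta_single.
- by exists a; apply/cubeP => i; rewrite subrr lexx ltW.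
- move=> x y /cubeP xa /cubeP ya; apply: enorm_le_coord => i.
  have := xa i; have := ya i; rewrite !mxE => /andP[h1 h2] /andP[h3 h4].
  by rewrite ler_norml; apply/andP; split; lra.
- by apply: le_trans tdelta; rewrite ler_pM2r// ler_nat.
Qed.

(** A grid of cubes of side t covers the box, and its total volume is at most that of the box with
    every side lengthened by t; then t tends to 0. *)
Lemma cube_bound_box C ab : 0 < C -> cube_bound C -> is_box ab ->
  (Hd (box ab) <= C%:E * box_volume ab)%E.
Proof.
move=> C0 bC bab.
have step t : 0 < t < delta / k.+1%:R ->
  (Hd (box ab) <= (C * \prod_(i < k) (ab.2 0 i - ab.1 0 i + t))%:E)%E.
  move=> /andP[t0 td].
  pose n (i : 'I_k) := Num.truncn ((ab.2 0 i - ab.1 0 i) / t).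
  (* Positions in the grid: for each axis one index, with as many values as there are cubes along
     that side. *)
  pose T := {dffun forall i : 'I_k, 'I_(n i).+1}.
  pose Q (f : T) := cube (\row_i (ab.1 0 i + (f i)%:R * t)) t.
  have cov : box ab `<=` \big[setU/set0]_(f <- enum T) Q f.
    move=> x xab; rewrite -bigcup_seq.
    have hx (i : 'I_k) : (Num.truncn ((x ord0 i - ab.1 ord0 i) / t)%R < (n i).+1)%N.
      rewrite ltnS; apply: le_truncn; rewrite ler_pM2r ?invr_gt0// lerD2r.
      by have /andP[] := xab i.
    exists [ffun i => Ordinal (hx i)] => /=; first by rewrite mem_enum.
    apply/cubeP => i; rewrite mxE ffunE/=.
    have y0 : 0 <= (x 0 i - ab.1 0 i) / t.
      by rewrite divr_ge0 ?(ltW t0)// subr_ge0; have /andP[] := xab i.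
    have /andP[h1 h2] := truncn_itv y0.
    move: h1 h2; rewrite ler_pdivlMr// ltr_pdivrMr// => h1 h2.
    rewrite -natr1 mulrDl mul1r in h2.
    by apply/andP; split; lra.
  apply: le_trans (le_outer_measure Hd _ _ cov) _.
  apply: le_trans (outer_measure_bigsetU_le _ _ _) _.
  apply: (@le_trans _ _ (\sum_(f <- enum T) (C * t ^+ k)%:E)%E).
    apply: lee_sum => f _; apply: bC => //.
    by rewrite mulrC -ler_pdivlMr// ltW.
  rewrite sumEFin lee_fin big_const_seq count_predT -cardE card_dep_ffun.
  rewrite iter_addr_0 -mulr_natl mulrCA ler_pM2l//.
  rewrite foldrE big_map big_enum/= natr_prod.
  rewrite -[X in t ^+ X](card_ord k) -prodr_const -big_split/=.
  apply: ler_prod => i _; rewrite card_ord mulr_ge0 ?(ltW t0)//=.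
  rewrite -addn1 natrD mulrDl mul1r lerD2r -ler_pdivlMr//.
  have y0 : 0 <= (ab.2 0 i - ab.1 0 i) / t.
    by rewrite divr_ge0 ?(ltW t0)// subr_ge0; exact: bab.
  by have /andP[] := truncn_itv y0.
have e0 : 0 < delta / k.+1%:R by rewrite divr_gt0.
have fin : Hd (box ab) \is a fin_num.
  rewrite ge0_fin_numE ?outer_measure_ge0//.
  apply: le_lt_trans (step (delta / k.+1%:R / 2) _) (ltry _).
  by rewrite divr_gt0//= ltr_pdivrMr// ltr_pMr// ltr1n.
rewrite -(fineK fin) -EFinM lee_fin.
have -> : C * \prod_(i < k) (ab.2 0 i - ab.1 0 i) =
          C * \prod_(i < k) (ab.2 0 i - ab.1 0 i + 0).
  by congr (_ * _); apply: eq_bigr => i _; rewrite addr0.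
apply: (@le_of_right_limit _ (fun t => C * \prod_(i < k) (ab.2 0 i - ab.1 0 i + t)) _ (delta / k.+1%:R)) => //.
  apply: cvgM; first exact: cvg_cst.
  exact: cvg_prod_shift.
by move=> e he; rewrite -lee_fin fineK//; exact: step.
Qed.

Lemma cube_bound_all C A : 0 < C -> cube_bound C -> (Hd A <= C%:E * L A)%E.
Proof.
move=> C0 bC; apply: (le_lebesgue_outer_of_box (mu := Hd)) => //.
- by move=> B; exact: outer_measure_ge0.
- by move=> B1 B2; exact: le_outer_measure.
- by move=> ab; exact: cube_bound_box.
Qed.

(** The fraction of the volume of a cube filled by its inscribed ball. *)
Definition ball_ratio : R := omega k / 2 ^+ k.

Lemma ball_ratio_gt0 : 0 < ball_ratio.
Proof. by rewrite divr_gt0 ?omega_gt0// exprn_gt0. Qed.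

Lemma ball_ratio_le1 : ball_ratio <= 1.
Proof.
rewrite ler_pdivrMr ?exprn_gt0// mul1r -lee_fin -[X in X%:E]mulr1 -[X in _ * X](expr1n _ k).
rewrite -(lebesgue_ball 0)//; apply: le_trans (lebesgue_ball_le _ _) _ => //.
by rewrite mulr1.
Qed.

Lemma measurable_eball d (x : 'rV[R]_d) r : measurable (eball x r : set (Rlebesgue R d)).
Proof.
have -> : eball x r = ~` [set y | r < enorm (y - x)].
  by apply/seteqP; split => y; rewrite /eball/= leNgt => /negP.
exact/measurableC/measurable_open/open_enorm_gt.
Qed.

(* Filling a cube by its inscribed ball improves the constant, because the ball
   is extremal for the isodiametric inequality. *)
Lemma cube_bound_improve C : 0 < C -> cube_bound C ->
  cube_bound (ball_ratio + (1 - ball_ratio) * C).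
Proof.
move=> C0 bC a t t0 td.
pose c := a + const_mx (t / 2); pose B := eball c (t / 2).
have t2 : 0 < t / 2 by rewrite divr_gt0.
have LB : L B = (ball_ratio * t ^+ k)%:E.
  by rewrite lebesgue_ball// /ball_ratio expr_div_n mulrA mulrAC.
have BQ : B `<=` cube a t.
  move=> x xc; apply/cubeP => i.
  have := le_trans (normr_coord_le (x - c) i) xc; rewrite !mxE ler_norml => /andP[h1 h2].
  by apply/andP; split; lra.
have HB : (Hd B <= (ball_ratio * t ^+ k)%:E)%E.
  have -> : ball_ratio * t ^+ k = omega k * (t / 2) ^+ k.
    by rewrite /ball_ratio expr_div_n mulrA mulrAC.
  apply: hausdorff_delta_single.
  - by exists c; rewrite /B /eball/= subrr enorm0 ltW.
  - move=> x y xB yB; apply: le_trans (enorm_triangle c _ _) _.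
    by move: xB yB; rewrite /B /eball/= (enormB y); lra.
  - by apply: le_trans td; rewrite ler_peMl ?(ltW t0)// ler1n.
have LQ := lebesgue_cube a (ltW t0).
have LQB : L (cube a t `\` B) = ((1 - ball_ratio) * t ^+ k)%:E.
  have : (L (cube a t) = L (cube a t `&` B) + L (cube a t `&` ~` B))%E.
    exact: measurable_eball c (t / 2) (cube a t).
  rewrite setIidr// LQ LB.
  rewrite -setDE; case: (L (cube a t `\` B)) => [r| |]//.
  by rewrite -EFinD => -[h]; congr EFin; rewrite mulrBl mul1r; lra.
apply: (@le_trans _ _ (Hd B + Hd (cube a t `\` B))%E).
  apply: le_trans (outer_measureU2 Hd _ _); apply: le_outer_measure => x Qx.
  by have [Bx|Bx] := pselect (B x); [left|right].
apply: le_trans (leeD HB (cube_bound_all _ C0 bC)) _.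
rewrite LQB -EFinM -EFinD lee_fin le_eqVlt; apply/orP; left; apply/eqP; ring.
Qed.

(** The improvement C |-> th + (1 - th) C contracts towards its fixed point 1, so its iterates are
    admissible constants that tend to 1. *)
Lemma hausdorff_delta_le_lebesgue A : (Hd A <= L A)%E.
Proof.
have [->|] := eqVneq (L A) +oo%E; first by rewrite leey.
rewrite -ltey -ge0_fin_numE ?outer_measure_ge0// => fA.
set th := ball_ratio; have th0 := ball_ratio_gt0; have th1 := ball_ratio_le1.
(* The summand 1 makes [C0] at least 1, so that all iterates 1 + (1 - th)^n (C0 - 1) are
   positive. *)
pose C0 : R := omega k * (k%:R / 2) ^+ k + 1.
have C00 : 1 <= C0.
  by rewrite /C0 lerDr mulr_ge0 ?(ltW (omega_gt0 _))// exprn_ge0// divr_ge0.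
have bC n : cube_bound (1 + (1 - th) ^+ n * (C0 - 1)).
  elim: n => [|n ih].
    move=> a t t0 td; apply: le_trans (cube_bound0 a t0 td) _.
    rewrite expr0 mul1r lee_fin ler_pM2r ?exprn_gt0// /C0; lra.
  have -> : 1 + (1 - th) ^+ n.+1 * (C0 - 1) =
      th + (1 - th) * (1 + (1 - th) ^+ n * (C0 - 1)) by rewrite exprS; ring.
  apply: cube_bound_improve ih; rewrite ltr_wpDr// mulr_ge0 ?subr_ge0//.
  by rewrite exprn_ge0// subr_ge0.
have HA n : (Hd A <= (1 + (1 - th) ^+ n * (C0 - 1))%:E * L A)%E.
  apply: cube_bound_all (bC n); rewrite ltr_wpDr// mulr_ge0 ?subr_ge0//.
  by rewrite exprn_ge0// subr_ge0.
have LA := fineK fA.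
have fH : Hd A \is a fin_num.
  rewrite ge0_fin_numE ?outer_measure_ge0//; apply: le_lt_trans (HA 0%N) _.
  by rewrite -LA -EFinM ltry.
rewrite -LA -(fineK fH) lee_fin.
have cv : (1 + (1 - th) ^+ n * (C0 - 1)) * fine (L A) @[n --> \oo] --> (1 + 0 * (C0 - 1)) * fine (L A).
  apply: cvgMr_tmp; apply: cvgD; first exact: cvg_cst.
  apply: cvgMr_tmp; apply: cvg_expr; by rewrite ger0_norm ?subr_ge0// ltrBlDr ltrDl.
rewrite mul0r addr0 mul1r in cv; rewrite -(cvg_lim _ cv)//.
apply: limr_ge; first by apply/cvg_ex; eexists; exact: cv.
by apply: nearW => n; rewrite -lee_fin EFinM fineK// LA.
Qed.

End hausdorff_lebesgue.

Section hausdorff_eq_lebesgue.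
Context {R : realType}.
Notation L := (@lebesgue_outer R _).

Lemma hausdorff_lebesgue k (A : set 'rV[R]_k) : @hausdorff_outer R k k A = L A.
Proof.
apply/eqP; rewrite eq_le lebesgue_le_hausdorff andbT.
by apply: hausdorff_le => delta d0; exact: hausdorff_delta_le_lebesgue.
Qed.

(** Boxes are tied to the axes and behave badly under general maps; Hausdorff measure sees only
    distances, so the bound is immediate on that side. *)
Lemma lebesgue_lipschitz (T : Type) d (D : set T) (p q : T -> 'rV[R]_d) (C : R) : 0 < C ->
  (forall i j, D i -> D j -> enorm (q i - q j) <= C * enorm (p i - p j)) ->
  (L (q @` D) <= (C ^+ d)%:E * L (p @` D))%E.
Proof. by move=> C0 h; rewrite -!hausdorff_lebesgue; exact: hausdorff_lipschitz. Qed.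

End hausdorff_eq_lebesgue.

(** * Measurability of the sphere *)

Section hausdorff_measurability.
Context {R : realType} {k d : nat}.
Notation Hd := (@hausdorff_delta R k d).
Notation H := (@hausdorff_outer R k d).
Implicit Types X P Q : set 'rV[R]_d.

Lemma hausdorff_delta_antitone (e1 e2 : R) P : e1 <= e2 -> (Hd e2 P <= Hd e1 P)%E.
Proof.
move=> e12; apply: le_ereal_inf_tmp => _ [C [cC CP PC] <-].
apply: cover_outer_le; split => //.
by move=> E /CP[E0 Ee]; split => //; apply: le_trans Ee _; rewrite lee_fin.
Qed.

(** A set of diameter at most delta < eta cannot meet both P and Q, so every cover of the union
    splits into a cover of P and one of Q without counting any set twice. *)
Lemma hausdorff_delta_metric (eta delta : R) P Q : delta < eta ->
  (forall x y, P x -> Q y -> eta <= enorm (x - y)) ->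
  (Hd delta P + Hd delta Q <= Hd delta (P `|` Q))%E.
Proof.
move=> de PQ; rewrite leNgt; apply/negP.
move=> /(cover_outer_seq (@hausdorff_weight_ge0 R k d delta))[c [cs cov cw]].
move: cw; apply/negP; rewrite -leNgt.
pose w n := oapp (@hausdorff_weight R k d) 0%E (c n).
have w0 n : (0 <= w n)%E.
  by rewrite /w; case cn : (c n) => [E|//=]; exact: hausdorff_weight_ge0 (cs _ _ cn).
pose E n := oapp id set0 (c n).
have HdE n : (Hd delta (E n) <= w n)%E.
  rewrite /E /w; case cn : (c n) => [F|]/=; last by rewrite outer_measure0.
  exact: (cover_outer_index id (@hausdorff_weight_ge0 R k d delta) (cs _ _ cn)).
have part B : B `<=` P `|` Q ->
    (Hd delta B <= \sum_(n <oo) if E n `&` B == set0 then 0 else w n)%E.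
  move=> BPQ; apply: (@le_trans _ _ (Hd delta (\bigcup_n (E n `&` B)))).
    by apply: le_outer_measure => x Bx; have [n _ En] := cov _ (BPQ _ Bx); exists n.
  apply: le_trans (outer_measure_sigma_subadditive (Hd delta) _) _.
  apply: lee_nneseries => [n _ _|n _]; first exact: outer_measure_ge0.
  case: eqP => [->|_]; first by rewrite outer_measure0.
  by apply: le_trans (HdE n); apply: le_outer_measure => x [].
apply: le_trans (leeD (part P _) (part Q _)) _; [by left|by right|].
rewrite -nneseriesD; first last.
- by move=> n _ _; case: ifP.
- by move=> n _ _; case: ifP.
apply: lee_nneseries => [n _ _|n _]; first by apply: adde_ge0; case: ifP.
case: eqP => [_|/eqP/set0P[x [Ex Px]]]; first by rewrite add0e; case: ifP => _; rewrite ?w0.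
case: eqP => [_|/eqP/set0P[y [Ey Qy]]]; first by rewrite adde0.
exfalso; move: Ex Ey; rewrite /E; case cn : (c n) => [F|]//= Fx Fy.
have [D [D0 Dd _ dF]] := small_setP (cs _ _ cn).
have := PQ _ _ Px Qy; have := dF _ _ Fx Fy; lra.
Qed.

Lemma hausdorff_metric (eta : R) P Q : 0 < eta ->
  (forall x y, P x -> Q y -> eta <= enorm (x - y)) ->
  (H P + H Q <= H (P `|` Q))%E.
Proof.
move=> eta0 PQ; have [->|] := eqVneq (H (P `|` Q)) +oo%E; first by rewrite leey.
rewrite -ltey => HPQ.
have fin B : B `<=` P `|` Q -> H B \is a fin_num.
  move=> h; rewrite ge0_fin_numE ?outer_measure_ge0//.
  by apply: le_lt_trans HPQ; exact: le_outer_measure.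
have fP : H P \is a fin_num by apply: fin; left.
have step e1 e2 : 0 < e1 -> 0 < e2 -> (Hd e1 P + Hd e2 Q <= H (P `|` Q))%E.
  move=> e10 e20; pose e := Num.min (Num.min e1 e2) (eta / 2).
  have e0 : 0 < e by rewrite !lt_min e10 e20 divr_gt0.
  apply: (@le_trans _ _ (Hd e P + Hd e Q)%E).
    by apply: leeD; apply: hausdorff_delta_antitone; rewrite !ge_min lexx ?orbT.
  apply: le_trans (hausdorff_delta_le k (P `|` Q) e0).
  apply: hausdorff_delta_metric PQ; rewrite !gt_min; apply/orP; right; lra.
have finQ e2 : 0 < e2 -> Hd e2 Q \is a fin_num.
  move=> e20; rewrite ge0_fin_numE ?outer_measure_ge0//.
  by apply: le_lt_trans HPQ; apply: le_trans (step 1 e2 ltr01 e20); rewrite leeDr// outer_measure_ge0.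
rewrite addeC -leeBrDr//; apply: hausdorff_le => e2 e20.
rewrite leeBrDr// addeC -leeBrDr ?finQ//; apply: hausdorff_le => e1 e10.
by rewrite leeBrDr ?finQ//; exact: step.
Qed.

(* Caratheodory's criterion for the zero set of f: the part of X away from it is
   cut into the shells {1/(m+2) < f <= 1/(m+1)}, and shells whose indices differ
   by at least two lie at a positive distance. *)
Lemma hausdorff_measurable_zero (f : 'rV[R]_d -> R) :
  (forall x, 0 <= f x) -> (forall x y, f x - f y <= enorm (x - y)) ->
  measurable ([set x | f x = 0] : set (Defs.Rhausdorff R k d)).
Proof.
move=> f0 fl; apply: le_caratheodory_measurable => X; set S := [set x | f x = 0].
change (H (X `&` S) + H (X `&` ~` S) <= H X)%E.
have [->|] := eqVneq (H X) +oo%E; first by rewrite leey.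
rewrite -ltey => HX.
have fin B : B `<=` X -> H B \is a fin_num.
  move=> h; rewrite ge0_fin_numE ?outer_measure_ge0//.
  by apply: le_lt_trans HX; exact: le_outer_measure.
pose r m : R := m%:R^-1.
have rS m : (0 < m)%N -> r m.+1 < r m.
  by move=> m0; rewrite /r ltf_pV2 ?posrE ?ltr0n// ltr_nat.
have rle m p : (0 < m)%N -> (m <= p)%N -> r p <= r m.
  move=> m0 mp; rewrite /r lef_pV2 ?posrE ?ltr0n ?ler_nat//.
  exact: leq_trans m0 mp.
pose T m := X `&` [set x | r m < f x].
pose Sh m := X `&` [set x | r m.+2 < f x <= r m.+1].
have ShX m : Sh m `<=` X by move=> x [].
have TX m : T m `<=` X by move=> x [].
(* [b] selects the parity of the shell indices. Passing from [T p] to [T p.+2] adds the shell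
   [Sh p], which keeps a distance r p - r p.+1 from [T p], so measures add up. *)
have sep b N : (\sum_(j < N) H (Sh (2 * j + b.+1)%N) <= H (T (2 * N + b.+1)%N))%E.
  elim: N => [|N ih]; first by rewrite big_ord0 outer_measure_ge0.
  rewrite big_ord_recr/=; apply: le_trans (leeD2r _ ih) _.
  set p := (2 * N + b.+1)%N; have p0 : (0 < p)%N by rewrite /p addnS.
  apply: (@le_trans _ _ (H (T p `|` Sh p))).
    apply: (@hausdorff_metric (r p - r p.+1)); first by rewrite subr_gt0 rS.
    move=> x y [_ /= xT] [_ /= /andP[_ yS]]; apply: le_trans (fl x y); lra.
  have -> : (2 * N.+1 + b.+1 = p.+2)%N by rewrite /p mulnS; lia.
  apply: le_outer_measure => x [[Xx /= xT]|[Xx /= /andP[xS _]]]; split => //=.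
  apply: le_lt_trans xT; apply: rle => //; lia.
have sum2 N : (\sum_(j < (2 * N)%N) H (Sh j.+1) <= H X + H X)%E.
  apply: (@le_trans _ _ (H (T (2 * N + 1)%N) + H (T (2 * N + 2)%N))%E); last first.
    by apply: leeD; exact: le_outer_measure.
  apply: le_trans (leeD (sep 0%N N) (sep 1%N N)).
  elim: N => [|N ih]; first by rewrite !big_ord0 adde0.
  rewrite mulnS !big_ord_recr/= [X in (_ <= X)%E]addeACA -[X in (X <= _)%E]addeA; apply: leeD => //.
  by rewrite addn1 addn2.
have cvg_sum : (\sum_(m <oo) H (Sh m.+1) < +oo)%E.
  apply: (@le_lt_trans _ _ (H X + H X)%E); last by rewrite lte_add_pinfty.
  apply: lime_le; first by apply: is_cvg_nneseries => *; exact: outer_measure_ge0.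
  apply: nearW => N; apply: le_trans (sum2 N); rewrite big_mkord.
  rewrite -(big_mkord xpredT (fun j => H (Sh j.+1))) -(big_mkord xpredT (fun j => H (Sh j.+1))).
  apply: lee_sum_nneg_natr => //; first by move=> *; exact: outer_measure_ge0.
  lia.
have tail := nneseries_tail_cvg cvg_sum (fun m _ => outer_measure_ge0 H _).
have step n : (H (X `&` S) + H (X `&` ~` S) <= H X + \sum_(n <= m <oo) H (Sh m.+1))%E.
  have h1 : (H (X `&` S) + H (T n.+2) <= H X)%E.
    apply: (@le_trans _ _ (H (X `&` S `|` T n.+2))).
      apply: (@hausdorff_metric (r n.+2)); first by rewrite /r invr_gt0 ltr0n.
      by move=> x y [_ /= fx] [_ /= fy]; rewrite enormB; apply: le_trans (fl y x); rewrite fx subr0 ltW.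
    by apply: le_outer_measure => x [[]|[]].
  apply: le_trans (leeD2r _ h1); rewrite -addeA leeD2l//.
  apply: (@le_trans _ _ (H (T n.+2 `|` \bigcup_m Sh (n + m).+1))).
    apply: le_outer_measure => x [Xx nSx].
    have [xT|xT] := ltP (r n.+2) (f x); first by left.
    have fx0 : 0 < f x by rewrite lt_neqAle eq_sym f0 andbT; apply/eqP.
    pose q := Num.truncn (f x)^-1.
    have /andP[q1 q2] := truncn_itv (ltW (etrans (invr_gt0 _) fx0)).
    right.
    have [q0 qn] : (0 < q)%N /\ (n.+2 <= q)%N.
      suff : (n.+2 <= q)%N by lia.
      rewrite -(ler_nat R); apply: contraT; rewrite -ltNge ltr_nat ltnS => qn.
      exfalso; move: q2; apply/negP; rewrite -leNgt.
      apply: (@le_trans _ _ n.+2%:R); first by rewrite ler_nat.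
      by rewrite -[leLHS]invrK lef_pV2 ?posrE ?invr_gt0 ?ltr0n.
    exists (q - n.+2)%N => //; split => //=.
    have -> : (n + (q - n.+2)).+1 = q.-1 by lia.
    have -> : q.-1.+2 = q.+1 by lia.
    rewrite (prednK q0) /r; apply/andP; split.
      by rewrite invf_plt ?posrE ?ltr0n.
    by rewrite -[leLHS]invrK lef_pV2 ?posrE ?invr_gt0 ?ltr0n// invrK.
  apply: le_trans (outer_measureU2 H _ _) _; rewrite leeD2l//.
  apply: le_trans (outer_measure_sigma_subadditive H _) _.
  rewrite -(nneseries_addn (f := fun m => H (Sh m.+1))); last by move=> m; exact: outer_measure_ge0.
  by under eq_eseriesr do rewrite addnC.
have -> : H X = (H X + 0)%E by rewrite adde0.
have cv : (H X + \sum_(n <= m <oo) H (Sh m.+1))%E @[n --> \oo] --> (H X + 0)%E.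
  apply: cvgeD => //; first by rewrite fin_num_adde_defl// fin.
  exact: cvg_cst.
rewrite -(cvg_lim _ cv)//; apply: lime_ge; first by apply/cvg_ex; eexists; exact: cv.
exact: nearW.
Qed.

Lemma measurable_esphere : measurable (esphere : set (Defs.Rhausdorff R k d)).
Proof.
have -> : (esphere : set 'rV[R]_d) = [set x | `|enorm x - 1| = 0].
  apply/seteqP; split => x; rewrite /esphere /=; first by move=> ->; rewrite subrr normr0.
  by move/normr0_eq0/eqP; rewrite subr_eq0 => /eqP.
apply: (hausdorff_measurable_zero (f := fun x => `|enorm x - 1|)) => // x y.
apply: le_trans (ler_enorm_dist x y); apply: le_trans (lerB_dist _ _) _.
by rewrite opprB addrA subrK.
Qed.

End hausdorff_measurability.

(** * Surface measure of the sphere and cones *)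

Section cones.
Context {R : realType} {k : nat}.
Notation d := k.+1.
Notation L := (@lebesgue_outer R _).
Notation H := (@hausdorff_outer R k d).
Implicit Types (A : set 'rV[R]_d) (x y p th : 'rV[R]_d).

Definition radial x : 'rV[R]_d := (enorm x)^-1 *: x.

Lemma enorm_radial x : 0 < enorm x -> enorm (radial x) = 1.
Proof. by move=> x0; rewrite enormZ gtr0_norm ?invr_gt0// mulVf// gt_eqF. Qed.

Lemma radialK x : 0 < enorm x -> enorm x *: radial x = x.
Proof. by move=> x0; rewrite scalerA divff ?gt_eqF// scale1r. Qed.

Lemma radial_scale t x : 0 < t -> radial (t *: x) = radial x.
Proof.
move=> t0; rewrite /radial enormZ gtr0_norm// scalerA invfM mulrAC mulVf ?mul1r//.
by rewrite gt_eqF.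
Qed.

Lemma radial_sphere x : enorm x = 1 -> radial x = x.
Proof. by move=> x1; rewrite /radial x1 invr1 scale1r. Qed.

(** The origin is left out because it has no direction. [shell r A] is the outer layer of thickness
    r of this cone. *)
Definition cone A : set 'rV[R]_d := [set y | 0 < enorm y <= 1 /\ A (radial y)].
Definition shell (r : R) A : set 'rV[R]_d := [set y | 1 - r < enorm y <= 1 /\ A (radial y)].

Lemma cone_le_ball A : (L (cone A) <= ((2 * 1) ^+ d)%:E)%E.
Proof.
apply: le_trans (lebesgue_ball_le 0 ler01); apply: le_outer_measure => y [/andP[_ y1] _].
by rewrite /eball/= subr0.
Qed.

Lemma cone_fin A : L (cone A) \is a fin_num.
Proof.
by rewrite ge0_fin_numE ?outer_measure_ge0//; apply: le_lt_trans (cone_le_ball A) (ltry _).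
Qed.

(** The part of the cone inside the ball of radius 1 - r is the cone shrunk by 1 - r, and the ball,
    being measurable, splits the outer measure of the cone over an arbitrary A. *)
Lemma lebesgue_shell (r : R) A : 0 < r < 1 ->
  L (shell r A) = ((1 - (1 - r) ^+ d)%:E * L (cone A))%E.
Proof.
move=> /andP[r0 r1]; have r1' : 0 < 1 - r by rewrite subr_gt0.
have e : (L (cone A) = L (cone A `&` eball 0 (1 - r)) + L (cone A `&` ~` eball 0 (1 - r)))%E.
  exact: (measurable_eball 0 (1 - r) (cone A)).
have -> : shell r A = cone A `&` ~` eball 0 (1 - r).
  apply/seteqP; split => y; rewrite /shell /cone /eball /= subr0.
    move=> [/andP[h1 h2] h3]; split; first by rewrite h2 (lt_trans r1' h1).
    by apply/negP; rewrite -ltNge.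
  by move=> [[/andP[h1 h2] h3] /negP]; rewrite -ltNge h2 => h; split => //; rewrite h.
have e2 : L (cone A `&` eball 0 (1 - r)) = (((1 - r) ^+ d)%:E * L (cone A))%E.
  rewrite -[in RHS](invrK (1 - r)) exprVn -lebesgue_scale ?invr_gt0//; congr (L _).
  apply/seteqP; split => y; rewrite /cone /eball/= subr0 enormZ gtr0_norm ?invr_gt0//.
    move=> [[/andP[h1 h2] h3] h4]; rewrite radial_scale ?invr_gt0//; split => //.
    by rewrite mulr_gt0 ?invr_gt0//= mulrC ler_pdivrMr ?mul1r.
  rewrite radial_scale ?invr_gt0// => -[/andP[h1 h2] h3].
  rewrite pmulr_rgt0 ?invr_gt0// in h1.
  rewrite mulrC ler_pdivrMr// mul1r in h2; split => //; split => //.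
  by rewrite h1/=; lra.
move: e; rewrite e2; have := cone_fin A; have := outer_measure_ge0 (@lebesgue_outer R d) (cone A `&` ~` eball 0 (1 - r)).
case: (L (cone A)) => [a| |]//; case: (L _) => [b| |]// _ _.
by rewrite -!EFinM -EFinD => -[h]; congr EFin; rewrite mulrBl mul1r; lra.
Qed.

(** The reflection in the hyperplane orthogonal to v, and the identity for v = 0; so p need not be
    distinguished from the vector it is turned into. *)
Definition reflect v x : 'rV[R]_d := x - (2 * edot x v / edot v v) *: v.

Lemma reflectB v x y : reflect v (x - y) = reflect v x - reflect v y.
Proof.
by rewrite /reflect edotBl mulrBr mulrBl scalerBl !opprD !opprK addrACA.
Qed.

Lemma enorm_reflect v x : enorm (reflect v x) = enorm x.
Proof.
rewrite /enorm /reflect; congr Num.sqrt.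
have [v0|v0] := eqVneq (edot v v) 0; first by rewrite v0 invr0 mulr0 scale0r subr0.
rewrite !(edotBl, edotBr, edotZl, edotZr) (edotC v x).
by field.
Qed.

Lemma reflect_sphere p e : enorm p = 1 -> enorm e = 1 -> reflect (p - e) p = e.
Proof.
move=> p1 e1; have pp : edot p p = 1 by rewrite -enorm_sqr p1 expr1n.
have ee : edot e e = 1 by rewrite -enorm_sqr e1 expr1n.
have [v0|v0] := eqVneq (p - e) 0.
  by rewrite /reflect v0 scaler0 subr0; apply/eqP; rewrite -subr_eq0 v0.
have v1 : edot (p - e) (p - e) != 0 by rewrite -enorm_sqr sqrf_eq0 enorm_eq0.
have h : 2 * edot p (p - e) = edot (p - e) (p - e).
  rewrite !(edotBl, edotBr) pp ee (edotC e p); ring.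
by rewrite /reflect h divff// scale1r subKr.
Qed.

Lemma enorm_polarB t s th eta : enorm th = 1 -> enorm eta = 1 ->
  enorm (t *: th - s *: eta) ^+ 2 = (t - s) ^+ 2 + t * s * enorm (th - eta) ^+ 2.
Proof.
move=> th1 eta1; have tt : edot th th = 1 by rewrite -enorm_sqr th1 expr1n.
have ee : edot eta eta = 1 by rewrite -enorm_sqr eta1 expr1n.
rewrite !enorm_sqr !(edotBl, edotBr, edotZl, edotZr) tt ee (edotC eta th); ring.
Qed.

Section piece.
Variables (p : 'rV[R]_d) (rho : R) (A : set 'rV[R]_d).
Hypotheses (p1 : enorm p = 1) (rho0 : 0 < rho) (rho2 : rho <= 1 / 2).
Hypothesis A1 : forall th, A th -> enorm th = 1.
Hypothesis Ap : forall th, A th -> enorm (th - p) <= rho.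

Let i : 'I_d := ord0.
Let e : 'rV[R]_d := ins i 1 0.
Let T := reflect (p - e).
(* The orthogonal projection along p, once a reflection has turned p into a
   coordinate vector. *)
Definition chart th : 'rV[R]_k := col' i (T th).

Let e1 : enorm e = 1.
Proof.
apply/eqP; rewrite -(@eqrXn2 _ 2) ?enorm_ge0// enorm_sqr (edot_ins i) ins_at col'_ins.
by rewrite -enorm_sqr enorm0 expr0n/= addr0 mulr1 expr1n.
Qed.

Let TB th eta : enorm (T th - T eta) = enorm (th - eta).
Proof. by rewrite -reflectB enorm_reflect. Qed.

Lemma chart_le th eta : enorm (chart th - chart eta) <= enorm (th - eta).
Proof. by apply: le_trans (col'_enorm_le _ _ _) _; rewrite TB. Qed.

Let T_near th : A th -> (1 / 2 <= T th ord0 i) /\ enorm (chart th) <= rho.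
Proof.
have [h0 h2] : 0 < rho /\ rho <= 1 / 2 by split.
move=> Ath; have h : enorm (T th - e) <= rho.
  by rewrite -(reflect_sphere p1 e1) -/T TB Ap.
split.
  have := le_trans (normr_coord_le _ i) h; move: (T th) => z.
  by rewrite !mxE unlift_none/= ler_norml => /andP[]; lra.
by apply: le_trans h; have := col'_enorm_le i (T th) e; rewrite col'_ins subr0.
Qed.

Let T_sqr th : A th -> (T th ord0 i) ^+ 2 + enorm (chart th) ^+ 2 = 1.
Proof.
move=> Ath; rewrite expr2 [enorm _ ^+ 2]enorm_sqr -edot_ins -enorm_sqr.
by rewrite enorm_reflect A1// expr1n.
Qed.

(** Only the coordinate dropped by the chart has to be controlled. Its values a and b satisfy a^2 -
    b^2 = |chart eta|^2 - |chart th|^2 and a + b >= 1, while charts have norm at most rho, so |a -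
    b| is at most 2 rho times the distance of the charts. *)
Lemma chart_ge th eta : A th -> A eta ->
  enorm (th - eta) <= (1 + 2 * rho) * enorm (chart th - chart eta).
Proof.
have [h0 h2] : 0 < rho /\ rho <= 1 / 2 by split.
move=> Ath Aeta.
have [a1 a2] := T_near Ath; have [b1 b2] := T_near Aeta.
have a3 := T_sqr Ath; have b3 := T_sqr Aeta.
set D := enorm (chart th - chart eta); have D0 : 0 <= D by exact: enorm_ge0.
have r0 := ltW rho0.
have D1 := ler_enorm_dist (chart th) (chart eta); rewrite -/D in D1.
set a := T th ord0 i in a1 a3 *; set b := T eta ord0 i in b1 b3 *.
have ab : `|a - b| <= 2 * rho * D.
  apply: (@le_trans _ _ (`|a - b| * `|a + b|)).
    rewrite ler_peMr// ger0_norm; lra.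
  rewrite -normrM.
  have -> : (a - b) * (a + b) = (enorm (chart eta) - enorm (chart th)) * (enorm (chart eta) + enorm (chart th)).
    by rewrite -!subr_sqr; lra.
  rewrite normrM mulrC distrC; apply: ler_pM => //.
  rewrite ger0_norm ?addr_ge0 ?enorm_ge0//; lra.
rewrite -TB -ler_sqr ?nnegrE ?enorm_ge0//; last first.
  by rewrite mulr_ge0// addr_ge0// mulr_ge0.
rewrite -(ins_col' i (T th)) -(ins_col' i (T eta)) enorm_ins_sqr -/(chart th) -/(chart eta) -/D.
apply: (@le_trans _ _ ((2 * rho * D) ^+ 2 + D ^+ 2)).
  rewrite lerD2r -(real_normK (num_real _)) ler_sqr ?nnegrE//.
  by rewrite !mulr_ge0.
rewrite [leRHS]exprMn sqrrD expr1n [(2 * rho * D) ^+ 2]exprMn.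
have : 0 <= D ^+ 2 by rewrite sqr_ge0.
have : 0 <= rho * D ^+ 2 by rewrite mulr_ge0// sqr_ge0.
nra.
Qed.

(** The shell over A and the cylinder over its chart are the images of the same product I x A under
    [P] and [Q]; comparing distances under [P] and [Q] therefore compares the two volumes. *)
Let I := `]1 - rho, 1]%classic.
Let D : set (R * 'rV[R]_d) := [set z | I z.1 /\ A z.2].
Let P (z : R * 'rV[R]_d) := z.1 *: z.2.
Let Q (z : R * 'rV[R]_d) := ins i z.1 (chart z.2).

Let ID z : D z -> 1 - rho < z.1 <= 1.
Proof. by move=> [+ _]; rewrite /I /= in_itv. Qed.

Let shellE : shell rho A = P @` D.
Proof.
have [h0 h2'] : 0 < rho /\ rho <= 1 / 2 by split.
apply/seteqP; split => y.
  move=> [/andP[h1 h2] h3]; have y0 : 0 < enorm y by lra.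
  exists (enorm y, radial y); last exact: radialK.
  by split => //=; rewrite /I/= in_itv/= h1.
move=> [[t th] Dz <-]; have /= /andP[t1 t2] := ID Dz; have [_ /= Ath] := Dz.
have t0 : 0 < t by lra.
rewrite /shell /P /= radial_scale// (radial_sphere (A1 Ath)) enormZ (A1 Ath).
by rewrite mulr1 gtr0_norm// t1 t2.
Qed.

Let cylE : cylinder i I (chart @` A) = Q @` D.
Proof.
apply/seteqP; split => y.
  move=> [h1 [th Ath thy]]; exists (y ord0 i, th) => //.
  by rewrite /Q/= thy ins_col'.
by move=> [[t th] [/= h1 h2] <-]; rewrite /cylinder/Q/= ins_at col'_ins; split => //; exists th.
Qed.

Let PQ z w : D z -> D w -> enorm (P z - P w) <= (1 + 2 * rho) * enorm (Q z - Q w).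
Proof.
have [h0 h2] : 0 < rho /\ rho <= 1 / 2 by split.
move=> Dz Dw; have /andP[z1 z2] := ID Dz; have /andP[w1 w2] := ID Dw.
have [_ Az] := Dz; have [_ Aw] := Dw; have r0 := ltW rho0.
rewrite -ler_sqr ?nnegrE ?enorm_ge0//; last first.
  by rewrite mulr_ge0 ?enorm_ge0// addr_ge0// mulr_ge0.
rewrite /P (enorm_polarB _ _ (A1 Az) (A1 Aw)) /Q exprMn enorm_ins_sqr.
set C := (1 + 2 * rho) ^+ 2; have C1 : 1 <= C by rewrite exprn_ege1// lerDl mulr_ge0.
have h : enorm (z.2 - w.2) ^+ 2 <= C * enorm (chart z.2 - chart w.2) ^+ 2.
  rewrite -exprMn ler_sqr ?nnegrE ?enorm_ge0 ?chart_ge//.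
  by rewrite mulr_ge0 ?enorm_ge0// addr_ge0// mulr_ge0.
rewrite mulrDr; apply: lerD; first by rewrite ler_peMl ?sqr_ge0.
apply: le_trans h; apply: ler_piMl; first exact: sqr_ge0.
have z0 : 0 <= z.1 by lra.
have w0 : 0 <= w.1 by lra.
by rewrite mulr_ile1.
Qed.

Let QP z w : D z -> D w -> enorm (Q z - Q w) <= (1 - rho)^-1 * enorm (P z - P w).
Proof.
have [h0 h2] : 0 < rho /\ rho <= 1 / 2 by split.
move=> Dz Dw; have /andP[z1 z2] := ID Dz; have /andP[w1 w2] := ID Dw.
have [_ Az] := Dz; have [_ Aw] := Dw; have r0 := ltW rho0.
have r1 : 0 < 1 - rho by lra.
rewrite mulrC ler_pdivlMr// mulrC.
rewrite -ler_sqr ?nnegrE ?enorm_ge0//; last by rewrite mulr_ge0 ?enorm_ge0// ltW.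
rewrite /P (enorm_polarB _ _ (A1 Az) (A1 Aw)) /Q exprMn enorm_ins_sqr mulrDr; apply: lerD.
  by rewrite ler_piMl ?sqr_ge0// exprn_ile1//; lra.
apply: ler_pM; rewrite ?sqr_ge0//.
  by rewrite expr2; apply: ler_pM; lra.
by rewrite ler_sqr ?nnegrE ?enorm_ge0// chart_le.
Qed.

Lemma shell_le : (L (shell rho A) <= ((1 + 2 * rho) ^+ d)%:E * (rho%:E * L (chart @` A)))%E.
Proof.
have [h0 h2] : 0 < rho /\ rho <= 1 / 2 by split.
have c0 : 0 < 1 + 2 * rho by lra.
rewrite shellE; apply: le_trans (lebesgue_lipschitz c0 PQ) _.
apply: lee_wpmul2l; first by rewrite lee_fin exprn_ge0// ltW.
rewrite -cylE; have -> : rho = 1 - (1 - rho) by ring.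
apply: le_trans (cylinder_le i _ _); last by lra.
apply: le_outer_measure => y [yI h]; split => //; move: yI.
by rewrite /I /= !in_itv/= => /andP[/ltW -> ->].
Qed.

Lemma shell_ge : (rho%:E * L (chart @` A) <= ((1 - rho)^-1 ^+ d)%:E * L (shell rho A))%E.
Proof.
have [h0 h2] : 0 < rho /\ rho <= 1 / 2 by split.
have r1 : 0 < (1 - rho)^-1 by rewrite invr_gt0; lra.
rewrite shellE; apply: le_trans (lebesgue_lipschitz r1 QP); rewrite -cylE.
apply: le_trans (cylinder_ge i _ _); last exact: measurable_itv.
rewrite lebesgue_measure_itv/= lte_fin ifT; last by lra.
by rewrite -EFinD; have -> : 1 - (1 - rho) = rho by ring.
Qed.

(** The chart takes values in dimension k, where k-dimensional Hausdorff measure is Lebesgue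
    measure. *)
Lemma hausdorff_chart : (H A <= ((1 + 2 * rho) ^+ k)%:E * L (chart @` A))%E.
Proof.
have [h0 h2] : 0 < rho /\ rho <= 1 / 2 by split.
have c0 : 0 < 1 + 2 * rho by lra.
rewrite -hausdorff_lebesgue -[X in H X](image_id A).
exact: (hausdorff_lipschitz k c0 chart_ge).
Qed.

End piece.
End cones.

(** * Surface measure as normalised measure of cones *)

Section sphere_measure.
Context {R : realType} {k : nat}.
Notation d := k.+1.
Notation L := (@lebesgue_outer R _).
Notation H := (@hausdorff_outer R k d).
Implicit Types (A : set 'rV[R]_d) (x y p th : 'rV[R]_d).

Definition cone_measure A : \bar R := ((d%:R)%:E * L (cone A))%E.

Lemma cone_measure_ge0 A : (0 <= cone_measure A)%E.
Proof. by apply: mule_ge0; [rewrite lee_fin|exact: outer_measure_ge0]. Qed.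

(** A shell of small thickness r takes up about the fraction d r of its cone: this is the origin of
    the factor d in [cone_measure]. *)
Lemma one_sub_expr_bounds (r : R) : 0 <= r <= 1 ->
  r * (d%:R * (1 - r) ^+ k) <= 1 - (1 - r) ^+ d <= r * d%:R.
Proof.
move=> /andP[r0 r1]; have h : 1 - (1 - r) ^+ d = r * \sum_(i < d) (1 - r) ^+ i.
  by rewrite -opprB subrX1 -mulNr; congr (_ * _); ring.
have r1' : 0 <= 1 - r <= 1 by rewrite subr_ge0 r1 gerBl.
have -> : (d%:R : R) = \sum_(i < d) 1 by rewrite sumr_const card_ord.
rewrite h mulr_suml !ler_wpM2l//; apply: ler_sum => i _.
  by rewrite exprn_ile1//; case/andP: r1'.
by rewrite mul1r; apply: ler_wiXn2l; [case/andP: r1'|case/andP: r1'|rewrite -ltnS].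
Qed.

(** One crude bound for all errors on a piece of radius rho: each of the factors 1 + 2 rho and 1 /
    (1 - rho) is at most 1 + 6 rho for rho <= 1 / 2, and they occur with exponents adding up to at
    most d + d. *)
Definition distortion (rho : R) := (1 + 6 * rho) ^+ (d + d).

(** Both measures are compared with the Lebesgue measure of the chart, through the shell of
    thickness rho. The two conclusions serve the two directions of [hausdorff_cone]. *)
Lemma cone_measure_piece p rho A : enorm p = 1 -> 0 < rho <= 1 / 2 ->
  (forall th, A th -> enorm th = 1) -> (forall th, A th -> enorm (th - p) <= rho) ->
  (cone_measure A <= (distortion rho)%:E * L (chart p @` A))%E /\
  (H A <= (distortion rho)%:E * cone_measure A)%E.
Proof.
move=> p1 /andP[r0 r2] A1 Ap.
have r1 : 0 < 1 - rho by lra.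
have c1 : 1 <= 1 + 6 * rho by lra.
have hc : (1 - rho)^-1 <= 1 + 6 * rho.
  by rewrite -[leLHS]mul1r ler_pdivrMr//; nra.
have hb : 1 + 2 * rho <= 1 + 6 * rho by lra.
have h1 := shell_le p1 r0 r2 A1 Ap; have h2 := @shell_ge _ _ p _ _ r0 r2 A1.
have h3 := hausdorff_chart p1 r0 r2 A1 Ap.
have r01 : 0 < rho < 1 by apply/andP; split; lra.
rewrite lebesgue_shell// in h1 h2.
have /andP[b1 b2] : rho * (d%:R * (1 - rho) ^+ k) <= 1 - (1 - rho) ^+ d <= rho * d%:R.
  by apply: one_sub_expr_bounds; apply/andP; split; lra.
have fC : cone_measure A = (d%:R * fine (L (cone A)))%:E.
  by rewrite /cone_measure EFinM fineK// cone_fin.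
have S0 : 0 <= fine (L (cone A)) by rewrite fine_ge0// outer_measure_ge0.
have fCh : L (chart p @` A) \is a fin_num.
  rewrite ge0_fin_numE ?outer_measure_ge0//.
  apply: (@lebesgue_bounded_lt_pinfty _ _ _ (2 * rho)) => _ _ [x Ax <-] [y Ay <-].
  apply: le_trans (chart_le _ _ _) _; apply: le_trans (enorm_triangle p _ _) _.
  by have := Ap _ Ax; have := Ap _ Ay; rewrite (enormB p); lra.
rewrite -(fineK (cone_fin A)) -(fineK fCh) -!EFinM lee_fin in h1 h2.
rewrite -(fineK fCh) -EFinM in h3.
rewrite fC -(fineK fCh) -!EFinM; set S := fine (L (cone A)) in S0 h1 h2 *.
set M := fine (L (chart p @` A)) in h1 h2 h3 *.
have M0 : 0 <= M by rewrite fine_ge0// outer_measure_ge0.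
split.
  rewrite lee_fin.
  have g : rho * (d%:R * (1 - rho) ^+ k) * S <= (1 + 2 * rho) ^+ d * (rho * M).
    by apply: le_trans h1; rewrite ler_wpM2r.
  have g2 : d%:R * S <= (1 - rho)^-1 ^+ k * ((1 + 2 * rho) ^+ d * M).
    rewrite exprVn ler_pdivlMl ?exprn_gt0// -(ler_pM2l r0).
    by move: g; rewrite -!mulrA [(1 - rho) ^+ k * S]mulrC !mulrA [_ * rho * M]mulrAC; lra.
  apply: le_trans g2 _; rewrite mulrA ler_wpM2r// /distortion exprD.
  apply: ler_pM.
  - by rewrite exprn_ge0// invr_ge0 ltW.
  - by rewrite exprn_ge0//; lra.
  - apply: (@le_trans _ _ ((1 + 6 * rho) ^+ k)).
      by apply: lerXn2r; rewrite ?nnegrE ?invr_ge0//; lra.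
    by apply: ler_weXn2l.
  - by apply: lerXn2r; rewrite ?nnegrE//; lra.
apply: le_trans h3 _; rewrite lee_fin.
have g : M <= (1 - rho)^-1 ^+ d * (d%:R * S).
  rewrite lee_fin in h2; rewrite -(ler_pM2l r0); apply: le_trans h2 _.
  rewrite [leRHS]mulrCA ler_wpM2l ?exprn_ge0 ?invr_ge0 ?(ltW r1)//.
  by rewrite mulrA ler_wpM2r.
apply: (@le_trans _ _ ((1 + 2 * rho) ^+ k * ((1 - rho)^-1 ^+ d * (d%:R * S)))).
  by rewrite ler_wpM2l// exprn_ge0//; lra.
rewrite mulrA ler_wpM2r ?mulr_ge0// /distortion exprD.
apply: ler_pM.
- by rewrite exprn_ge0//; lra.
- by rewrite exprn_ge0// invr_ge0 ltW.
- apply: (@le_trans _ _ ((1 + 6 * rho) ^+ k)).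
    by apply: lerXn2r; rewrite ?nnegrE//; lra.
  by apply: ler_weXn2l.
- by apply: lerXn2r; rewrite ?nnegrE ?invr_ge0//; lra.
Qed.

Lemma cone_sphere A : cone (A `&` esphere) = cone A.
Proof.
apply/seteqP; split => y [/andP[h1 h2]]; first by move=> [h3 _]; split; [rewrite h1|].
by move=> h3; split; [rewrite h1|split => //; exact: enorm_radial].
Qed.

Lemma distortion_gt0 rho : 0 < rho -> 0 < distortion rho.
Proof. by move=> r0; rewrite exprn_gt0//; lra. Qed.

(** A covering set of diameter at most rho that meets the sphere lies within rho of one of its
    points there, so its cone is controlled by its chart. The chart does not increase diameters, and
    the isodiametric inequality bounds its measure by the weight. *)
Lemma cone_measure_le_hausdorff A rho : 0 < rho <= 1 / 2 ->
  (cone_measure A <= (distortion rho)%:E * H A)%E.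
Proof.
move=> r02; have /andP[r0 r2] := r02.
apply: (@le_trans _ _ ((distortion rho)%:E * @hausdorff_delta R k d rho A)%E); last first.
  by apply: lee_wpmul2l; [rewrite lee_fin ltW// distortion_gt0|exact: hausdorff_delta_le].
have d0 : (0 <= d%:R%:E :> \bar R)%E by rewrite lee_fin.
apply: (le_cover_outer_of_index (@hausdorff_weight_ge0 R k d rho) (mu := cone_measure)).
- exact: distortion_gt0.
- exact: cone_measure_ge0.
- rewrite /cone_measure; have -> : cone (set0 : set 'rV[R]_d) = set0 by apply/seteqP; split => y // [].
  by rewrite outer_measure0 mule0.
- move=> B1 B2 B12; apply: lee_wpmul2l => //; apply: le_outer_measure => y [h1 h2].
  by split => //; exact: B12.
- move=> F; rewrite /cone_measure nneseriesZl; last by move=> *; exact: outer_measure_ge0.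
  apply: lee_wpmul2l => //.
  apply: le_trans (outer_measure_sigma_subadditive (@lebesgue_outer R d) _).
  by apply: le_outer_measure => y [h1 [n _ h2]]; exists n.
- move=> E sE; have [D [D0 Dr ED dE]] := small_setP sE.
  rewrite (hausdorff_weightE _ ED) /cone_measure -cone_sphere -/(cone_measure _).
  have [->|/set0P[p [Ep p1]]] := eqVneq (E `&` esphere) set0.
    rewrite /cone_measure; have -> : cone (set0 : set 'rV[R]_d) = set0 by apply/seteqP; split => y // [].
    rewrite outer_measure0 mule0 -EFinM lee_fin !mulr_ge0//.
    - exact/ltW/distortion_gt0.
    - exact/ltW/omega_gt0.
    - by rewrite exprn_ge0// divr_ge0.
  have [h _] : (cone_measure (E `&` esphere) <= (distortion rho)%:E * L (chart p @` (E `&` esphere)))%E /\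
    (H (E `&` esphere) <= (distortion rho)%:E * cone_measure (E `&` esphere))%E.
    apply: cone_measure_piece => //; first by move=> th [].
    by move=> th [Eth _]; apply: le_trans Dr; exact: dE.
  apply: le_trans h _; apply: lee_wpmul2l; first by rewrite lee_fin ltW// distortion_gt0.
  apply: isodiametric => // _ _ [x [Ex _] <-] [y [Ey _] <-].
  by apply: le_trans (chart_le _ _ _) _; exact: dE.
Qed.

Definition rat_point (n : nat) : 'rV[R]_d :=
  map_mx ratr (odflt 0 (unpickle n) : 'rV[rat]_d).

Lemma rat_point_dense x e : 0 < e -> exists n, enorm (x - rat_point n) < e.
Proof.
move=> e0; pose r := e / d.+1%:R; have r0 : 0 < r by rewrite divr_gt0.
have /choice[q qP] : forall i, exists q : rat, `|x 0 i - ratr q| < r.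
  move=> i; have [q] := @rat_in_itvoo R (x 0 i - r) (x 0 i + r) ltac:(lra).
  by rewrite in_itv/= -ltr_distl distrC; exists q.
exists (pickle (\row_i q i : 'rV[rat]_d)); rewrite /rat_point pickleK/=.
apply: (@le_lt_trans _ _ (d%:R * r)).
  by apply: enorm_le_coord => i; rewrite !mxE ltW.
by rewrite /r mulrA ltr_pdivrMr// mulrC ltr_pM2l// ltr_nat.
Qed.

Lemma open_cap (q : 'rV[R]_d) (c : R) : 0 < c ->
  open [set y | 0 < enorm y /\ enorm (radial y - q) < c].
Proof.
move=> c0; apply/open_enormP => y [y0 yc].
have e0 : 0 < c * enorm y - enorm (y - enorm y *: q).
  rewrite subr_gt0 -{1}(radialK y0) -scalerBr enormZ gtr0_norm// mulrC.
  by rewrite ltr_pM2r.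
(* Moving y by a distance h changes y by h, the term |y| q by at most h |q|, and c |y| by at most c
   h; K adds up these rates. *)
pose K := 1 + enorm q + c; have K0 : 0 < K by rewrite /K; have := enorm_ge0 q; lra.
exists (Num.min (enorm y) ((c * enorm y - enorm (y - enorm y *: q)) / K)).
  by rewrite lt_min y0 divr_gt0.
move=> z; rewrite lt_min ltr_pdivlMr// => /andP[z1 z2].
have /ler_normlP[z3 z4] := ler_enorm_dist z y.
have zp : 0 < enorm z by lra.
split => //; rewrite -(ltr_pM2l zp) -[enorm z in X in X < _](gtr0_norm zp) -enormZ scalerBr radialK//.
have -> : z - enorm z *: q = (z - y) + (y - enorm y *: q) - (enorm z - enorm y) *: q.
  by apply/rowP => j; rewrite !mxE; ring.
have h1 := enormD ((z - y) + (y - enorm y *: q)) (- ((enorm z - enorm y) *: q)).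
have h2 := enormD (z - y) (y - enorm y *: q).
have h3 : enorm (- ((enorm z - enorm y) *: q)) <= enorm (z - y) * enorm q.
  by rewrite enormN enormZ ler_wpM2r ?enorm_ge0// ler_enorm_dist.
have h4 : c * (enorm y - enorm z) <= c * enorm (z - y) by rewrite ler_pM2l//; lra.
apply: le_lt_trans h1 _; rewrite mulrC.
rewrite /K in z2; nra.
Qed.

(** Here A is cut, rather than covered: caps around a countable dense set, made disjoint, split it
    into small pieces. The caps depend only on the direction, so they split the cone over A as
    well. *)
Lemma hausdorff_le_cone_measure A rho : A `<=` esphere -> 0 < rho <= 1 / 2 ->
  (H A <= (distortion rho)%:E * cone_measure A)%E.
Proof.
move=> AS r02; have /andP[r0 r2] := r02.
(* With radius rho / 2, all points of a piece are within rho of any one of them, so any point of the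
   piece can serve as its centre. *)
pose C n := [set y | 0 < enorm y /\ enorm (radial y - rat_point n) < rho / 2].
have mC n : measurable (C n : set (Rlebesgue R d)).
  by apply/measurable_open/open_cap; rewrite divr_gt0.
pose G := seqDU C.
have mG n : measurable (G n : set (Rlebesgue R d)).
  by apply: measurableD => //; exact: bigsetU_measurable.
have Crad n y : 0 < enorm y -> C n (radial y) <-> C n y.
  move=> y0; have ry1 := enorm_radial y0.
  by rewrite /C/= (radial_sphere ry1) ry1; split => -[_ h]; split.
have Grad n y : 0 < enorm y -> G n (radial y) <-> G n y.
  move=> y0; rewrite /G /seqDU; split => -[h1 h2]; split.
  - exact: (Crad n y y0).1.
  - apply: contra_not h2; rewrite -!bigcup_mkord => -[m mn Cm].
    by exists m; [exact: mn|exact: (Crad m y y0).2 Cm].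
  - exact: (Crad n y y0).2.
  - apply: contra_not h2; rewrite -!bigcup_mkord => -[m mn Cm].
    by exists m; [exact: mn|exact: (Crad m y y0).1 Cm].
have coneG n : cone (A `&` G n) = cone A `&` G n.
  apply/seteqP; split => y.
    by move=> [/andP[h1 h2] [h3 h4]]; split; [split => //; rewrite h1|exact: (Grad n y h1).1].
  by move=> [[/andP[h1 h2] h3] h4]; split; [rewrite h1|split => //; exact: (Grad n y h1).2].
have AG : A `<=` \bigcup_n (A `&` G n).
  move=> th Ath; have th1 : enorm th = 1 by exact: AS.
  have [n hn] : exists n, enorm (th - rat_point n) < rho / 2.
    by apply: rat_point_dense; rewrite divr_gt0.
  have : (\bigcup_n C n) th by exists n => //; rewrite /C/= radial_sphere// th1.
  by rewrite seqDU_bigcup_eq => -[m _ Gm]; exists m.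
apply: le_trans (le_outer_measure H _ _ AG) _.
apply: le_trans (outer_measure_sigma_subadditive H _) _.
apply: (@le_trans _ _ (\sum_(n <oo) ((distortion rho)%:E * cone_measure (A `&` G n)))%E).
  apply: lee_nneseries => [n _ _|n _]; first exact: outer_measure_ge0.
  have [->|/set0P[p [Ap Gp]]] := eqVneq (A `&` G n) set0.
    rewrite outer_measure0 mule_ge0 ?cone_measure_ge0// lee_fin.
    exact/ltW/distortion_gt0.
  have p1 : enorm p = 1 := AS _ Ap.
  have A1 th : (A `&` G n) th -> enorm th = 1 by move=> [/AS].
  suff Apn th : (A `&` G n) th -> enorm (th - p) <= rho by exact: (cone_measure_piece p1 r02 A1 Apn).2.
  move=> [Ath Gth]; have [_ hp] := subset_seqDU Gp; have [_ hth] := subset_seqDU Gth.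
  rewrite radial_sphere in hp; last exact: AS.
  rewrite radial_sphere in hth; last exact: AS.
  apply: le_trans (enorm_triangle (rat_point n) _ _) _.
  by rewrite (enormB _ p); lra.
rewrite nneseriesZl; last by move=> *; exact: cone_measure_ge0.
apply: lee_wpmul2l; first by rewrite lee_fin ltW// distortion_gt0.
rewrite /cone_measure nneseriesZl; last by move=> *; exact: outer_measure_ge0.
apply: lee_wpmul2l; first by rewrite lee_fin.
under eq_eseriesr do rewrite coneG.
(* The [G n] are disjoint and measurable, so the outer measures of their traces on the arbitrary set
   [cone A] sum to at most that of [cone A]. *)
have := caratheodory_lime_le mG (trivIset_seqDU C) (cone A).
by apply: le_trans; rewrite leeDl// outer_measure_ge0.
Qed.

Lemma le_of_distortion (a : R) (b : R) :
  (forall rho, 0 < rho <= 1 / 2 -> a <= distortion rho * b) -> a <= b.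
Proof.
move=> h; have -> : b = distortion 0 * b by rewrite /distortion mulr0 addr0 expr1n mul1r.
apply: (@le_of_right_limit _ (fun rho => distortion rho * b) _ (1 / 2)) => //.
  have c : 1 + 6 * e @[e --> (0 : R)] --> 1 + 6 * (0 : R).
    apply: cvgD; first exact: cvg_cst.
    by apply: cvgMl_tmp; exact: cvg_id.
  apply: cvgMr_tmp; exact: (cvg_comp _ _ c (@exprn_continuous _ (d + d) _)).
by move=> e /andP[e0 e2]; apply: h; rewrite e0 ltW.
Qed.

Lemma hausdorff_cone A : A `<=` esphere -> H A = cone_measure A.
Proof.
move=> AS.
have fC : cone_measure A = (d%:R * fine (L (cone A)))%:E.
  by rewrite /cone_measure EFinM fineK// cone_fin.
have fH : H A \is a fin_num.
  rewrite ge0_fin_numE ?outer_measure_ge0//.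
  apply: le_lt_trans (hausdorff_le_cone_measure AS (rho := 1 / 2) _) _; first by apply/andP; split; lra.
  by rewrite fC -EFinM ltry.
apply/eqP; rewrite eq_le fC -(fineK fH) !lee_fin; apply/andP; split.
  apply: le_of_distortion => rho h; rewrite -lee_fin EFinM -fC (fineK fH).
  exact: hausdorff_le_cone_measure.
apply: le_of_distortion => rho h; rewrite -lee_fin -fC EFinM (fineK fH).
exact: cone_measure_le_hausdorff.
Qed.

(** The measurable sphere reduces Caratheodory's condition to test sets inside it; there all
    measures are cone measures, and the condition is that of the cone over A. *)
Lemma hausdorff_measurable_cone A : A `<=` esphere ->
  measurable (cone A : set (Rlebesgue R d)) ->
  measurable (A : set (Defs.Rhausdorff R k d)).
Proof.
move=> AS mA; apply: le_caratheodory_measurable => X.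
change (H (X `&` A) + H (X `&` ~` A) <= H X)%E.
have SX : H X = (H (X `&` esphere) + H (X `&` ~` esphere))%E by exact: (measurable_esphere X).
rewrite SX.
have e1 : (H (X `&` A) + H (X `&` esphere `&` ~` A) = H (X `&` esphere))%E.
  rewrite !hausdorff_cone; first last.
  - by move=> x [_ /AS].
  - by move=> x [[]].
  - by move=> x [].
  rewrite /cone_measure -ge0_muleDr ?outer_measure_ge0//; congr (_ * _)%E.
  have h : (L (cone (X `&` esphere)) = L (cone (X `&` esphere) `&` cone A) + L (cone (X `&` esphere) `&` ~` cone A))%E.
    exact: (mA (cone (X `&` esphere))).
  have -> : cone (X `&` A) = cone (X `&` esphere) `&` cone A.
    apply/seteqP; split => y.
      by move=> [h1 [h2 h3]]; split; split => //; split => //; exact: AS.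
    by move=> [[h1 [h2 _]] [_ h3]]; split.
  have -> : cone (X `&` esphere `&` ~` A) = cone (X `&` esphere) `&` ~` cone A.
    apply/seteqP; split => y.
      by move=> [h1 [h2 h3]]; split; [split|move=> []].
    by move=> [[h1 h2] h3]; split => //; split => // h4; apply: h3; split.
  by rewrite -h.
rewrite -e1 -addeA leeD2l//; apply: le_trans (outer_measureU2 H _ _).
apply: le_outer_measure => x [Xx nA].
by have [xS|xS] := pselect (esphere x); [left|right].
Qed.

End sphere_measure.

(** * Integration over the sphere *)

Section polar_integration.
Context {R : realType} {k : nat}.
Notation d := k.+1.
Notation mu := (@lebesgue R d).
Implicit Types (A : set 'rV[R]_d) (g : 'rV[R]_d -> R).

Definition pball : set 'rV[R]_d := [set y | 0 < enorm y <= 1].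

Lemma measurable_enorm n : measurable_fun (setT : set (Rlebesgue R n)) (@enorm R n).
Proof.
apply: (measurability _ (measurable_realfun.RGenOInfty.measurableE R)).
move=> _ [_ [c ->] <-]; rewrite setTI; apply: measurable_open.
have -> : enorm @^-1` `]c, +oo[%classic = [set y : 'rV[R]_n | c < enorm (y - 0)].
  by apply/seteqP; split => y; rewrite /= in_itv/= andbT subr0.
exact: open_enorm_gt.
Qed.

Lemma measurable_enorm_itv n (I : set R) : measurable I ->
  measurable ([set y | I (enorm y)] : set (Rlebesgue R n)).
Proof.
by move=> mI; rewrite -[X in measurable X]setTI; exact: (@measurable_enorm n).
Qed.

Lemma measurable_pball : measurable (pball : set (Rlebesgue R d)).
Proof.
rewrite (_ : pball = [set y | `]0, 1]%classic (enorm y)]).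
  by apply: measurable_enorm_itv; exact: measurable_itv.
by apply/seteqP; split => y; rewrite /= in_itv.
Qed.

Lemma measurable_esphere_comp g :
  measurable_fun (pball : set (Rlebesgue R d)) (g \o radial) ->
  measurable_fun (esphere : set (Defs.Rhausdorff R k d)) g.
Proof.
move=> mg _ E mE; apply: hausdorff_measurable_cone; first by move=> x [].
rewrite setIC cone_sphere; have := mg measurable_pball E mE.
by congr (_.-measurable _); apply/seteqP; split => y.
Qed.

(** Both sides become integrals of the identity on the positive reals against image measures, under
    g and under g o radial. These agree set by set because Hausdorff measure is d times the measure
    of the cone. *)
Lemma integral_sphere g : (forall x, 0 <= g x) ->
  measurable_fun (pball : set (Rlebesgue R d)) (g \o radial) ->
  (\int[hausdorff k d]_(th in esphere) (g th)%:E =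
   d%:R%:E * \int[mu]_(y in pball) (g (radial y))%:E)%E.
Proof.
move=> g0 mg; have mS := @measurable_esphere R k d; have mB := measurable_pball.
pose phi1 := g \_ (esphere : set (Defs.Rhausdorff R k d)).
pose phi2 := (g \o radial) \_ (pball : set (Rlebesgue R d)).
have mphi1 : measurable_fun setT phi1.
  by apply/(measurable_restrictT _ mS).1; exact: measurable_esphere_comp.
have mphi2 : measurable_fun setT phi2 by apply/(measurable_restrictT _ mB).1.
(* Dropping the value 0 does not change the integrals and discards the points off the sphere and off
   the ball, where the extended functions vanish. *)
pose D : set R := `]0, +oo[%classic.
have mD : measurable D by exact: measurable_itv.
have mE : measurable_fun D (@EFin R) by exact: measurable_funTS.
have E0 : {in D, forall y, (0 <= y%:E)%E}.
  by move=> y; rewrite inE /D/= in_itv/= andbT lee_fin => /ltW.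
have e1 : (\int[hausdorff k d]_(th in esphere) (g th)%:E =
    \int[pushforward (hausdorff k d) phi1]_(y in D) y%:E)%E.
  rewrite (ge0_integral_pushforward mphi1)//.
  rewrite [LHS]integral_mkcond [RHS]integral_mkcond; congr (integral _ setT _); apply/funext => th.
  rewrite /= /phi1 !patchE; case: ifPn => thS; case: ifPn => //.
  - by move=> _; rewrite /= patchE thS.
  - rewrite notin_setE /D/= patchE thS in_itv/= andbT => /negP; rewrite -leNgt => h.
    by congr EFin; apply/eqP; rewrite eq_le h g0.
  - by rewrite inE /D/= patchE (negbTE thS) in_itv/= ltxx.
have e2 : (\int[mu]_(y in pball) (g (radial y))%:E =
    \int[pushforward mu phi2]_(y in D) y%:E)%E.
  rewrite (ge0_integral_pushforward mphi2)//.
  rewrite [LHS]integral_mkcond [RHS]integral_mkcond; congr (integral _ setT _); apply/funext => th.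
  rewrite /= /phi2 !patchE; case: ifPn => thS; case: ifPn => //.
  - by move=> _; rewrite /= patchE thS.
  - rewrite notin_setE /D/= patchE thS in_itv/= andbT => /negP; rewrite -leNgt => h.
    by congr EFin; apply/eqP; rewrite eq_le h g0.
  - by rewrite inE /D/= patchE (negbTE thS) in_itv/= ltxx.
have d0 : (0 : R) <= d%:R by [].
rewrite e1 e2 -[d%:R]/((NngNum d0)%:num).
pose m2 : {measure set R -> \bar R} := pushforward mu phi2.
rewrite -(ge0_integral_mscale (m2 mphi2) mD (NngNum d0) mE); last first.
  by move=> y Dy; apply: E0; exact/mem_set.
apply: eq_measure_integral => A mA AD.
have A0 : ~ A 0 by move=> /AD; rewrite /D/= in_itv/= ltxx.
change (hausdorff k d (phi1 @^-1` A) = d%:R%:E * mu (phi2 @^-1` A))%E.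
have -> : phi1 @^-1` A = esphere `&` g @^-1` A.
  apply/seteqP; split => th; rewrite /phi1/= patchE; case: ifPn.
  - by rewrite inE.
  - by move=> _ /A0.
  - by move=> _ [].
  - by rewrite notin_setE => nS [].
have -> : phi2 @^-1` A = cone (esphere `&` g @^-1` A).
  rewrite setIC cone_sphere; apply/seteqP; split => th; rewrite /phi2/= patchE; case: ifPn.
  - by rewrite inE.
  - by move=> _ /A0.
  - by move=> _ [].
  - by rewrite notin_setE => nS [].
by apply: hausdorff_cone => x [].
Qed.

Lemma measurable_scale (c : R) : 0 < c ->
  measurable_fun (setT : set (Rlebesgue R d)) ( *:%R c : 'rV[R]_d -> Rlebesgue R d).
Proof.
move=> c0 _ B; rewrite setTI; set A : set 'rV[R]_d := B => mA.
apply: le_caratheodory_measurable => X0; set X : set 'rV[R]_d := X0.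
pose S : 'rV[R]_d -> 'rV[R]_d := *:%R c.
(* Writing the test set as a preimage makes every set in Caratheodory's condition a rescaled one. *)
have [Y XY] : exists Y : set 'rV[R]_d, X = S @^-1` Y.
  exists (( *:%R c^-1) @^-1` X); apply/seteqP.
  by split => x /=; rewrite scalerA mulVf ?gt_eqF// scale1r.
have h : (lebesgue_outer Y = lebesgue_outer (Y `&` A) + lebesgue_outer (Y `&` ~` A))%E.
  exact: (mA Y).
change (lebesgue_outer (X `&` S @^-1` A) + lebesgue_outer (X `&` S @^-1` (~` A)) <= lebesgue_outer X)%E.
have e1 : X `&` S @^-1` A = S @^-1` (Y `&` A) by rewrite XY.
have e2 : X `&` S @^-1` (~` A) = S @^-1` (Y `&` ~` A) by rewrite XY.
rewrite e1 e2 XY !(lebesgue_scale _ c0) h.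
by rewrite ge0_muleDr; [exact: lexx|exact: outer_measure_ge0|exact: outer_measure_ge0].
Qed.

Lemma integral_scale (c : R) (D : set 'rV[R]_d) (f : 'rV[R]_d -> \bar R) : 0 < c ->
  measurable (D : set (Rlebesgue R d)) ->
  measurable_fun (D : set (Rlebesgue R d)) f -> (forall x, D x -> 0 <= f x)%E ->
  (\int[mu]_(x in ( *:%R c) @^-1` D) f (c *: x) = (c ^- d)%:E * \int[mu]_(x in D) f x)%E.
Proof.
move=> c0 mD mf f0.
rewrite -(ge0_integral_pushforward (measurable_scale c0) mu mD mf); last first.
  by move=> y; rewrite inE; exact: f0.
have c1 : 0 <= c ^- d by rewrite invr_ge0 exprn_ge0// ltW.
rewrite -[c ^- d]/((NngNum c1)%:num) -(ge0_integral_mscale mu mD (NngNum c1) mf)//.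
have ms := measurable_scale c0.
apply: eq_measure_integral => // B mB _; set A : set 'rV[R]_d := B.
change (lebesgue_outer (( *:%R c) @^-1` A) = (c ^- d)%:E * lebesgue_outer A)%E.
exact: lebesgue_scale.
Qed.

End polar_integration.

(** * Geometric annuli *)

Lemma bernoulli_ler {R : realType} (x : R) n : 0 <= x -> 1 + n%:R * x <= (1 + x) ^+ n.
Proof.
move=> x0; elim: n => [|n ih]; first by rewrite mul0r addr0 expr0.
rewrite exprS; apply: (@le_trans _ _ ((1 + x) * (1 + n%:R * x))); last first.
  by rewrite ler_wpM2l// addr_ge0.
rewrite -natr1; have : 0 <= n%:R * x * x by rewrite !mulr_ge0.
move: (n%:R : R) => z; nra.
Qed.

Lemma measurable_enorm_powR {R : realType} n (q : R) :
  measurable_fun (setT : set (Rlebesgue R n)) (fun y : 'rV[R]_n => enorm y `^ q).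
Proof.
have h : measurable_fun setT (fun t : R => t `^ q) by exact: measurable_powR.
exact: (measurableT_comp h (@measurable_enorm R n)).
Qed.

Section annuli.
Context {R : realType} {k : nat}.
Notation d := k.+1.
Notation mu := (@lebesgue R d).
Variable lam : R.
Hypothesis lam1 : 1 < lam.
Implicit Types (f g : 'rV[R]_d -> R).

Let lam0 : 0 < lam. Proof. exact: lt_trans ltr01 lam1. Qed.

Definition annulus j : set 'rV[R]_d := [set y | lam ^+ j < enorm y <= lam ^+ j.+1].

Lemma measurable_annulus j : measurable (annulus j : set (Rlebesgue R d)).
Proof.
rewrite (_ : annulus j = [set y | `]lam ^+ j, lam ^+ j.+1]%classic (enorm y)]).
  by apply: measurable_enorm_itv; exact: measurable_itv.
by apply/seteqP; split => y; rewrite /annulus /= in_itv.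
Qed.

Lemma annulus_gt0 j y : annulus j y -> 0 < enorm y.
Proof. by move=> /andP[h _]; apply: lt_trans h; rewrite exprn_gt0. Qed.

Lemma annulus_scale j : ( *:%R (lam ^+ j)) @^-1` annulus j = annulus 0.
Proof.
have lj : 0 < lam ^+ j by rewrite exprn_gt0.
apply/seteqP; split => y; rewrite /annulus /= enormZ gtr0_norm// [lam ^+ j.+1]exprSr expr0 ?expr1.
  by rewrite ler_pM2l// ltr_pMr.
by rewrite ler_pM2l// ltr_pMr.
Qed.

Lemma annulus_fin j : (mu (annulus j) < +oo)%E.
Proof.
have l0 : 0 <= lam ^+ j.+1 by rewrite exprn_ge0// ltW.
apply: le_lt_trans (ltry ((2 * lam ^+ j.+1) ^+ d)).
apply: le_trans (lebesgue_ball_le 0 l0); apply: le_outer_measure => y /andP[_ h].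
by rewrite /eball/= subr0.
Qed.

Lemma far_annuli m : [set y : 'rV[R]_d | lam ^+ m < enorm y] = \bigcup_j annulus (m + j).
Proof.
apply/seteqP; split => y /=; last first.
  move=> [j _ /andP[h _]]; apply: le_lt_trans h.
  by apply: ler_weXn2l; [exact: ltW|exact: leq_addr].
move=> ym.
have ex : exists j, enorm y <= lam ^+ (m + j).+1.
  pose N := Num.truncn (enorm y / (lam - 1)).
  exists N; apply: (@le_trans _ _ (lam ^+ N.+1)); last first.
    by apply: ler_weXn2l; [exact: ltW|rewrite ltnS leq_addl].
  have l10 : 0 < lam - 1 by rewrite subr_gt0.
  have := @bernoulli_ler R (lam - 1) N.+1 (ltW l10).
  have -> : 1 + (lam - 1) = lam by ring.
  apply: le_trans.
  have : enorm y / (lam - 1) < N.+1%:R by exact: truncnS_gt.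
  by rewrite ltr_pdivrMr// => h; rewrite (le_trans (ltW h))// lerDr.
case: (ex_minnP ex) => j hj jmin; exists j => //; rewrite /annulus/= hj andbT.
case: j hj jmin => [|j] hj jmin; first by rewrite addn0.
rewrite ltNge; apply/negP => h; have := jmin j; rewrite -addnS => /(_ h).
by rewrite ltnn.
Qed.

Lemma trivIset_annulus m : trivIset setT (fun j => annulus (m + j)).
Proof.
have annulus_lt p q y : (p < q)%N -> annulus p y -> annulus q y -> False.
  move=> pq /andP[_ h1] /andP[h2 _]; have := lt_le_trans h2 h1.
  by rewrite ltr_eXn2l// ltnS leqNgt pq.
move=> i j _ _ [y [yi yj]]; apply/eqP; case: ltngtP => // ij; exfalso.
  by apply: (annulus_lt (m + i)%N (m + j)%N y) => //; rewrite ltn_add2l.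
by apply: (annulus_lt (m + j)%N (m + i)%N y) => //; rewrite ltn_add2l.
Qed.

(** For g constant along rays, the integral over the ball of radius lam is lam^d times the one over
    the unit ball; the annulus is the difference. *)
Lemma integral_annulus0 g : (forall y, 0 <= g y) ->
  measurable_fun (setT : set (Rlebesgue R d)) g ->
  (forall c y, 0 < c -> 0 < enorm y -> g (c *: y) = g y) ->
  (\int[mu]_(y in pball) (g y)%:E < +oo)%E ->
  (\int[mu]_(y in annulus 0) (g y)%:E = (lam ^+ d - 1)%:E * \int[mu]_(y in pball) (g y)%:E)%E.
Proof.
move=> g0 mg gh gfin.
have g0' (y : 'rV[R]_d) : (0 <= (g y)%:E)%E by rewrite lee_fin.
have mgE (D : set (Rlebesgue R d)) : measurable_fun D (fun y => (g y)%:E).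
  by apply/measurable_EFinP; exact: measurable_funTS.
pose B : set 'rV[R]_d := [set y | 0 < enorm y <= lam].
have mB : measurable (B : set (Rlebesgue R d)).
  rewrite (_ : B = [set y | `]0, lam]%classic (enorm y)]).
    by apply: measurable_enorm_itv; exact: measurable_itv.
  by apply/seteqP; split => y; rewrite /B /= in_itv.
have mp := @measurable_pball R k.
have BU : B = pball `|` annulus 0.
  apply/seteqP; split => y; rewrite /B /pball /annulus /= expr0 expr1.
    by move=> /andP[h1 h2]; case: (leP (enorm y) 1) => h; [left; rewrite h1|right].
  move=> [/andP[h1 h2]|/andP[h1 h2]].
    by rewrite h1 (le_trans h2)// ltW.
  by rewrite h2 (lt_trans ltr01 h1).
have e1 : (\int[mu]_(y in B) (g y)%:E = \int[mu]_(y in pball) (g y)%:E + \int[mu]_(y in annulus 0) (g y)%:E)%E.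
  rewrite BU; apply: ge0_integral_setU => //; first exact: measurable_annulus.
  apply/disj_setPS => y [/andP[_ h1] /andP[h2 _]].
  by move: h2; rewrite expr0 ltNge h1.
have e2 := integral_scale lam0 mB (mgE B) (fun y _ => g0' y).
have e3 : ( *:%R lam) @^-1` B = pball.
  apply/seteqP; split => y; rewrite /B /pball /= enormZ gtr0_norm// pmulr_rgt0//.
    by rewrite ger_pMr.
  by rewrite ger_pMr.
have e4 : (\int[mu]_(y in pball) (g y)%:E = (lam ^- d)%:E * \int[mu]_(y in B) (g y)%:E)%E.
  rewrite -e2 e3; apply: eq_integral => y; rewrite inE => /andP[y0 _].
  by rewrite gh.
have fp : (\int[mu]_(y in pball) (g y)%:E \is a fin_num)%E.
  by rewrite ge0_fin_numE//; exact: integral_ge0.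
have e5 : (\int[mu]_(y in B) (g y)%:E = (lam ^+ d)%:E * \int[mu]_(y in pball) (g y)%:E)%E.
  by rewrite e4 muleA -EFinM divff ?mul1e// gt_eqF// exprn_gt0.
rewrite e5 in e1; rewrite -(fineK fp) in e1 *; move: e1.
case: (\int[mu]_(y in annulus 0) _)%E => [r| |]//.
by rewrite -!EFinM -EFinD => -[h]; congr EFin; rewrite mulrBl mul1r; lra.
Qed.

Section weighted.
Variables (f : 'rV[R]_d -> R) (K : R).
Hypotheses (f0 : forall y, 0 <= f y) (fK : forall y, f y <= K).
Hypothesis mf : measurable_fun (setT : set (Rlebesgue R d)) f.

(** The integral of f over the annulus j after rescaling to j = 0, not divided by the measure of the
    annulus. *)
Definition annulus_avg j : R := fine (\int[mu]_(y in annulus 0) (f (lam ^+ j *: y))%:E)%E.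

Let mfs j : measurable_fun (setT : set (Rlebesgue R d)) (fun y => f (lam ^+ j *: y)).
Proof.
have lj : 0 < lam ^+ j by rewrite exprn_gt0.
exact: (measurableT_comp mf (measurable_scale lj)).
Qed.

Lemma annulus_avgE j : (\int[mu]_(y in annulus 0) (f (lam ^+ j *: y))%:E)%E = (annulus_avg j)%:E.
Proof.
rewrite fineK// ge0_fin_numE; last by apply: integral_ge0 => y _; rewrite lee_fin.
apply: (@le_lt_trans _ _ (\int[mu]_(y in annulus 0) K%:E)%E).
  apply: ge0_le_integral => //.
  - exact: measurable_annulus.
  - by move=> y _; rewrite lee_fin.
  - by apply/measurable_EFinP; exact: measurable_funTS.
  - by move=> y _; rewrite lee_fin.
rewrite integral_cst//; last exact: measurable_annulus.
by apply: lte_mul_pinfty; [rewrite lee_fin (le_trans (f0 0))|by []|exact: annulus_fin].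
Qed.

Lemma annulus_avg_ge0 j : 0 <= annulus_avg j.
Proof. by rewrite fine_ge0//; apply: integral_ge0 => y _; rewrite lee_fin. Qed.

Lemma integral_annulus j : (\int[mu]_(y in annulus j) (f y)%:E)%E = ((lam ^+ j) ^+ d * annulus_avg j)%:E.
Proof.
have lj : 0 < lam ^+ j by rewrite exprn_gt0.
have mE (D : set (Rlebesgue R d)) : measurable_fun D (fun y => (f y)%:E).
  by apply/measurable_EFinP; exact: measurable_funTS.
have f0' (y : 'rV[R]_d) : annulus j y -> (0 <= (f y)%:E)%E by rewrite lee_fin.
have := integral_scale lj (measurable_annulus j) (mE _) f0'.
rewrite annulus_scale annulus_avgE => h.
by rewrite EFinM h muleA -EFinM divff ?mul1e// gt_eqF// exprn_gt0.
Qed.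

Lemma annulus_avg_cvg g : (forall y, 0 <= g y) ->
  measurable_fun (setT : set (Rlebesgue R d)) g ->
  (forall c y, 0 < c -> 0 < enorm y -> g (c *: y) = g y) ->
  (forall y, 0 < enorm y -> f (lam ^+ j *: y) @[j --> \oo] --> g y) ->
  (\int[mu]_(y in pball) (g y)%:E < +oo)%E ->
  annulus_avg j @[j --> \oo] --> (lam ^+ d - 1) * fine (\int[mu]_(y in pball) (g y)%:E)%E.
Proof.
move=> g0 mg gh fg gfin.
have K0 : 0 <= K by exact: le_trans (f0 0) (fK 0).
have iK : mu.-integrable (annulus 0 : set (Rlebesgue R d)) (cst K%:E).
  apply/integrableP; split; first exact: measurable_cst.
  under eq_integral do rewrite /= ger0_norm//.
  rewrite integral_cst//; last exact: measurable_annulus.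
  by apply: lte_mul_pinfty => //; exact: annulus_fin.
have [||||| _ _ h] := dominated_convergence (mu := mu) (D := annulus 0) (measurable_annulus 0)
   (f_ := fun j y => (f (lam ^+ j *: y))%:E) (f := fun y => (g y)%:E) (g := cst K%:E).
- by move=> j; apply/measurable_EFinP; exact: measurable_funTS.
- by apply/measurable_EFinP; exact: measurable_funTS.
- apply: aeW => y /annulus_gt0 y0; apply: cvg_EFin; last exact: fg.
  by apply: nearW => j.
- exact: iK.
- by apply: aeW => y j _; rewrite lee_fin ger0_norm.
have fp : (\int[mu]_(y in pball) (g y)%:E \is a fin_num)%E.
  by rewrite ge0_fin_numE//; apply: integral_ge0 => y _; rewrite lee_fin.
rewrite integral_annulus0// -(fineK fp) -EFinM in h.
exact: (fine_cvg h).
Qed.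

Variable s : R.
Hypothesis s0 : 0 < s.
Let p := d%:R + 2 * s.
Let nu := lam `^ (2 * s).

Let nu1 : 1 < nu.
Proof.
rewrite /nu -(powRr0 lam) /powR !gt_eqF// ltr_expR mul0r mulr_gt0 ?mulr_gt0//.
exact: ln_gt0.
Qed.

Let lamp : lam `^ p = lam ^+ d * nu.
Proof.
by rewrite /p powRD ?powR_mulrn ?(ltW lam0)//; apply/implyP => _; rewrite gt_eqF.
Qed.

Let lampj j : (lam ^+ j) `^ p = (lam ^+ d * nu) ^+ j.
Proof.
elim: j => [|j ih]; first by rewrite !expr0 powR1.
rewrite [lam ^+ j.+1]exprS [RHS]exprS powRM; last 2 first.
- exact: ltW.
- by rewrite exprn_ge0// ltW.
by rewrite ih lamp.
Qed.

Definition far_integral m : \bar R :=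
  (\int[mu]_(y in [set y | lam ^+ m < enorm y]%R) (f y * enorm y `^ (- (d%:R + 2 * s)))%:E)%E.

Let w y := f y * enorm y `^ (- p).

Let w0 y : 0 <= w y. Proof. by rewrite mulr_ge0// powR_ge0. Qed.

Let mw (D : set (Rlebesgue R d)) : measurable_fun D (fun y => (w y)%:E).
Proof.
have h := measurable_funM mf (@measurable_enorm_powR R d (- p)).
by apply/measurable_EFinP; apply: measurable_funTS; exact: h.
Qed.

Let p0 : 0 <= p. Proof. by rewrite addr_ge0// mulr_ge0// ltW. Qed.

Let annulus_weight j y : annulus j y ->
  (lam ^+ d * nu)^-1 ^+ j.+1 <= enorm y `^ (- p) <= (lam ^+ d * nu)^-1 ^+ j.
Proof.
move=> yj; have y0 := annulus_gt0 yj; have /andP[h1 h2] := yj.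
have lj i : 0 < lam ^+ i by rewrite exprn_gt0.
rewrite powRN !exprVn -!lampj !lef_pV2 ?posrE ?powR_gt0//.
by apply/andP; split; apply: ge0_ler_powR; rewrite ?nnegrE// ltW.
Qed.

Let sum_annuli m : (far_integral m = \sum_(j <oo) \int[mu]_(y in annulus (m + j)) (w y)%:E)%E.
Proof.
rewrite /far_integral far_annuli ge0_integral_bigcup//.
- by move=> j; exact: measurable_annulus.
- by move=> y _; rewrite lee_fin; exact: w0.
- exact: trivIset_annulus.
Qed.

Let c0 : 0 < lam ^+ d * nu. Proof. by rewrite mulr_gt0 ?exprn_gt0// powR_gt0. Qed.

Let geometric_sum (b : R) m : 0 <= b ->
  (\sum_(j <oo) (nu^-1 ^+ (m + j) * b)%:E = (b * nu^-1 ^+ m / (1 - nu^-1))%:E)%E.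
Proof.
move=> b0; have nu0 : 0 < nu by exact: lt_trans ltr01 nu1.
have n1 : `|nu^-1| < 1 by rewrite gtr0_norm ?invr_gt0// invf_lt1.
have := @cvg_geometric_series R (b * nu^-1 ^+ m) nu^-1 n1 => h.
apply/cvg_lim => //.
rewrite (_ : (fun n => _) = EFin \o series (geometric (b * nu^-1 ^+ m) nu^-1)).
  by apply: cvg_EFin; [exact: nearW|exact: h].
apply/funext => n /=; rewrite sumEFin /series/=; congr EFin; apply: eq_bigr => j _.
by rewrite /geometric/= exprD; ring.
Qed.

(** The volume of the annulus grows by lam^d at each step and the weight decays by lam^(d + 2s);
    only the ratio 1 / nu = lam^(-2s) survives. *)
Let weight_pow i : (lam ^+ d * nu)^-1 ^+ i * (lam ^+ i) ^+ d = nu^-1 ^+ i.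
Proof.
rewrite -[(lam ^+ i) ^+ d]exprM mulnC exprM -exprMn; congr (_ ^+ i).
by rewrite invfM mulrAC mulVf ?mul1r// gt_eqF// exprn_gt0.
Qed.

(** On each annulus |y|^-p is replaced by its largest value, and the geometric series is summed. *)
Lemma far_integral_le m b : (forall j, (m <= j)%N -> annulus_avg j <= b) ->
  (far_integral m <= (b * nu^-1 ^+ m / (1 - nu^-1))%:E)%E.
Proof.
move=> ab; have b0 : 0 <= b by apply: le_trans (ab m _) => //; exact: annulus_avg_ge0.
rewrite sum_annuli -geometric_sum//; apply: lee_nneseries => [j _ _|j _].
  by apply: integral_ge0 => y _; rewrite lee_fin.
set i := (m + j)%N.
apply: (@le_trans _ _ (\int[mu]_(y in annulus i) (((lam ^+ d * nu)^-1 ^+ i)%:E * (f y)%:E))%E).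
  apply: ge0_le_integral => //.
  - exact: measurable_annulus.
  - by move=> y _; rewrite lee_fin.
  - by apply: measurable_funeM; apply/measurable_EFinP; exact: measurable_funTS.
  - move=> y yi; rewrite -EFinM lee_fin /w mulrC ler_wpM2r//.
    by have /andP[] := annulus_weight yi.
rewrite ge0_integralZl//; first last.
- by rewrite lee_fin exprn_ge0// invr_ge0 ltW.
- by move=> y _; rewrite lee_fin.
- by apply/measurable_EFinP; exact: measurable_funTS.
- exact: measurable_annulus.
rewrite integral_annulus -EFinM lee_fin mulrA.
rewrite weight_pow.
rewrite ler_wpM2l ?exprn_ge0 ?invr_ge0 ?powR_ge0//.
by apply: ab; rewrite leq_addr.
Qed.

(** With the smallest value of the weight on each annulus instead, one step further in the series.
    This costs the factor lam^d nu, which disappears as lam tends to 1. *)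
Lemma far_integral_ge m b : (forall j, (m <= j)%N -> b <= annulus_avg j) ->
  ((b * nu^-1 ^+ m / (1 - nu^-1) / (lam ^+ d * nu))%:E <= far_integral m)%E.
Proof.
move=> ab; have nu0 : 0 < nu by exact: lt_trans ltr01 nu1.
have n1 : 0 < 1 - nu^-1 by rewrite subr_gt0 invf_lt1.
(* A negative b makes the left-hand side nonpositive; the geometric series is used with nonnegative
   terms only. *)
have [b0|b0] := ltP b 0.
  apply: (@le_trans _ _ 0%E).
    rewrite lee_fin pmulr_lle0 ?invr_gt0// pmulr_lle0 ?invr_gt0//.
    by rewrite pmulr_lle0 ?exprn_gt0 ?invr_gt0// ltW.
  by apply: integral_ge0 => y _; rewrite lee_fin w0.
rewrite mulrC EFinM -geometric_sum// -nneseriesZl; last first.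
  by move=> j _; rewrite lee_fin mulr_ge0// exprn_ge0// invr_ge0 ltW.
rewrite sum_annuli; apply: lee_nneseries => [j _ _|j _].
  by rewrite -EFinM lee_fin !mulr_ge0// ?invr_ge0 ?(ltW c0)// exprn_ge0// invr_ge0 ltW.
set i := (m + j)%N.
apply: (@le_trans _ _ (\int[mu]_(y in annulus i) (((lam ^+ d * nu)^-1 ^+ i.+1)%:E * (f y)%:E))%E); last first.
  apply: ge0_le_integral => //.
  - exact: measurable_annulus.
  - by move=> y _; rewrite -EFinM lee_fin mulr_ge0// exprn_ge0// invr_ge0 ltW.
  - by apply: measurable_funeM; apply/measurable_EFinP; exact: measurable_funTS.
  - move=> y yi; rewrite -EFinM lee_fin /w mulrC ler_wpM2l//.
    by have /andP[] := annulus_weight yi.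
rewrite ge0_integralZl//; first last.
- by rewrite lee_fin exprn_ge0// invr_ge0 ltW.
- by move=> y _; rewrite lee_fin.
- by apply/measurable_EFinP; exact: measurable_funTS.
- exact: measurable_annulus.
rewrite integral_annulus -!EFinM lee_fin [(lam ^+ d * nu)^-1 ^+ i.+1]exprS -[leRHS]mulrA.
rewrite ler_wpM2l ?invr_ge0 ?(ltW c0)// mulrA.
rewrite weight_pow.
rewrite ler_wpM2l ?exprn_ge0 ?invr_ge0 ?powR_ge0//.
by apply: ab; rewrite leq_addr.
Qed.

End weighted.
End annuli.

(** * The kernel and the seminorm *)

Section tonelli_rectangles.
Context {R : realType} {n : nat}.
Notation mu := (@lebesgue R n).
Variable F : 'rV[R]_n * 'rV[R]_n -> \bar R.
Hypothesis F0 : forall z, (0 <= F z)%E.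
Hypothesis mF : measurable_fun (setT : set (Rlebesgue R n * Rlebesgue R n)) F.
Variables A B : set 'rV[R]_n.
Hypothesis mA : measurable (A : set (Rlebesgue R n)).
Hypothesis mB : measurable (B : set (Rlebesgue R n)).

Let G : Rlebesgue R n * Rlebesgue R n -> \bar R := F \_ (A `*` B).

Let mG : measurable_fun setT G.
Proof.
apply/(measurable_restrictT _ _).1; first exact: measurableX.
exact: measurable_funTS.
Qed.

Let G0 z : (0 <= G z)%E.
Proof. by rewrite /G patchE; case: ifP. Qed.

Lemma integral_rectangle1 :
  (\int[mu \x mu]_(z in A `*` B) F z = \int[mu]_(x in A) \int[mu]_(y in B) F (x, y))%E.
Proof.
rewrite [LHS]integral_mkcond (fubini_tonelli1 G)// [RHS]integral_mkcond.
apply: eq_integral => x _; rewrite /fubini_F patchE; case: ifPn => xA.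
  rewrite [RHS]integral_mkcond; apply: eq_integral => y _; rewrite /G !patchE in_setX.
  by rewrite xA.
by apply: integral0_eq => y _; rewrite /G patchE in_setX (negbTE xA).
Qed.

Lemma integral_rectangle2 :
  (\int[mu \x mu]_(z in A `*` B) F z = \int[mu]_(y in B) \int[mu]_(x in A) F (x, y))%E.
Proof.
rewrite [LHS]integral_mkcond (fubini_tonelli2 G)// [RHS]integral_mkcond.
apply: eq_integral => y _; rewrite /fubini_G patchE; case: ifPn => yB.
  rewrite [RHS]integral_mkcond; apply: eq_integral => x _; rewrite /G !patchE in_setX.
  by rewrite yB andbT.
by apply: integral0_eq => x _; rewrite /G patchE in_setX (negbTE yB) andbF.
Qed.

End tonelli_rectangles.

(** * Bounds for the kernel and for the geometric factor *)

Section elementary_bounds.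
Context {R : realType}.
Implicit Types (t r s lam c : R).

(** The constant depends on the bound n of the exponent and not on p, hence will not depend on s. *)
Lemma kernel_le (n : nat) c t r p : 0 < c <= 1 -> 0 < r -> c * r <= t -> 0 <= p <= n%:R ->
  (t `^ p)^-1 <= c ^- n * r `^ (- p).
Proof.
move=> /andP[c0 c1] r0 crt /andP[p0 pn].
have cr : 0 < c * r by rewrite mulr_gt0.
apply: (@le_trans _ _ ((c * r) `^ p)^-1).
  rewrite lef_pV2 ?posrE ?powR_gt0//; last exact: lt_le_trans crt.
  by apply: ge0_ler_powR => //; rewrite nnegrE ltW// (lt_le_trans cr).
rewrite powRM ?(ltW c0) ?(ltW r0)// invfM powRN ler_wpM2r ?invr_ge0 ?powR_ge0//.
rewrite lef_pV2 ?posrE ?powR_gt0 ?exprn_gt0//.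
by rewrite -powR_mulrn ?(ltW c0)//; apply: ger_powR => //; rewrite c0.
Qed.

Lemma kernel_ge (n : nat) c t r p : 1 <= c -> 0 < r -> 0 < t <= c * r -> 0 <= p <= n%:R ->
  c ^- n * r `^ (- p) <= (t `^ p)^-1.
Proof.
move=> c1 r0 /andP[t0 tcr] /andP[p0 pn].
have c0 : 0 < c by exact: lt_le_trans ltr01 c1.
have cr : 0 < c * r by rewrite mulr_gt0.
apply: (@le_trans _ _ ((c * r) `^ p)^-1); last first.
  rewrite lef_pV2 ?posrE ?powR_gt0//.
  by apply: ge0_ler_powR => //; rewrite nnegrE ltW.
rewrite powRM ?(ltW c0) ?(ltW r0)// invfM powRN ler_wpM2r ?invr_ge0 ?powR_ge0//.
rewrite lef_pV2 ?posrE ?powR_gt0 ?exprn_gt0//.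
by rewrite -powR_mulrn ?(ltW c0)//; apply: ler_powR.
Qed.

(** The two kernels differ by the factor t^(2 (s0 - s)), at most D^2. *)
Lemma kernel_near_le (n : nat) t D s s0 : 1 <= D -> 0 <= t <= D -> 0 < s -> s <= s0 -> s0 <= 1 ->
  (t `^ (n%:R + 2 * s))^-1 <= D ^+ 2 * (t `^ (n%:R + 2 * s0))^-1.
Proof.
move=> D1 /andP[t0 tD] sp ss0 s01; have D0 : 0 <= D by exact: le_trans ler01 D1.
have ps (r : R) : 0 < r -> 0 < n%:R + 2 * r by move=> r0; rewrite ltr_wpDl// mulr_gt0.
move: t0; rewrite le_eqVlt => /predU1P[<-|t0].
  (* At t = 0 both sides are 0, since 0 to a nonzero power is 0 and the inverse of 0 is 0. *)
  by rewrite !powR0 ?gt_eqF ?ps// ?invr0 ?mulr0// (lt_le_trans sp).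
have -> : n%:R + 2 * s0 = (n%:R + 2 * s) + 2 * (s0 - s) by ring.
rewrite [t `^ (_ + 2 * (s0 - s))]powRD; last by apply/implyP => _; rewrite gt_eqF.
rewrite invfM mulrCA ler_peMr ?invr_ge0 ?powR_ge0// ler_pdivlMr ?powR_gt0// mul1r.
apply: (@le_trans _ _ (D `^ (2 * (s0 - s)))).
  by apply: ge0_ler_powR; rewrite ?nnegrE ?(ltW t0)// mulr_ge0// subr_ge0.
by rewrite -powR_mulrn//; apply: ler_powR => //; lra.
Qed.

Lemma ln_bounds (e : R) : 0 < e -> e / (1 + e) <= ln (1 + e) <= e.
Proof.
move=> e0; have e1 : 0 < 1 + e by rewrite addr_gt0.
apply/andP; split; last first.
  rewrite -ler_expR lnK ?posrE//; exact: expR_ge1Dx.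
have h : - ln (1 + e) <= - (e / (1 + e)).
  rewrite -lnV ?posrE//.
  have -> : - (e / (1 + e)) = (1 + e)^-1 - 1 by field; rewrite gt_eqF.
  have /le_ln1Dx : -1 < (1 + e)^-1 - 1 by rewrite ltrBrDl subrr invr_gt0.
  by rewrite addrC subrK.
by rewrite -lerN2.
Qed.

(* s times the sum of the powers of 1 / (1 + e) ^ (2 s), which tends to
   1 / (2 ln (1 + e)) as s tends to 0. *)
Lemma geometric_factor_bounds (e s : R) : 0 < e -> 0 < s <= 1 / 2 ->
  (2 * e)^-1 <= s / (1 - ((1 + e) `^ (2 * s))^-1) <= (1 + e) ^+ 2 / (2 * e).
Proof.
move=> e0 /andP[s0 s2]; set nu := _ `^ _; have e1 : 0 < 1 + e by rewrite addr_gt0.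
have /andP[l1 l2] := ln_bounds e0.
have l0 : 0 < ln (1 + e) by apply: lt_le_trans l1; rewrite divr_gt0.
pose c := 2 * s * ln (1 + e); have c0 : 0 < c by rewrite !mulr_gt0.
have nuE : nu = expR c by rewrite /nu /powR gt_eqF.
have nu0 : 0 < nu by rewrite nuE expR_gt0.
have n1 : 1 + c <= nu by rewrite nuE; exact: expR_ge1Dx.
have n2 : 1 - c <= nu^-1 by rewrite nuE -expRN; exact: expR_ge1Dx.
have n3 : nu <= 1 + e.
  apply: le_trans (_ : (1 + e) `^ 1 <= _); last by rewrite powRr1// ltW.
  by apply: ler_powR; lra.
have n4 : 0 < 1 - nu^-1 by rewrite subr_gt0 invf_lt1//; lra.
apply/andP; split.
  rewrite ler_pdivlMr//; apply: (@le_trans _ _ ((2 * e)^-1 * c)).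
    by rewrite ler_wpM2l ?invr_ge0 ?mulr_ge0 ?(ltW e0)//; lra.
  rewrite ler_pdivrMl ?mulr_gt0// /c -!mulrA ler_pM2l// mulrC ler_wpM2r//.
  exact: ltW.
rewrite ler_pdivrMr//.
have h : c / nu <= 1 - nu^-1.
  have -> : 1 - nu^-1 = (nu - 1) / nu by rewrite mulrBl mul1r divff// gt_eqF.
  by rewrite ler_wpM2r ?invr_ge0 ?(ltW nu0)//; lra.
apply: (@le_trans _ _ ((1 + e) ^+ 2 / (2 * e) * (c / nu))); last first.
  by rewrite ler_wpM2l// divr_ge0 ?sqr_ge0// mulr_ge0// ltW.
have h2 : s <= (1 + e) / (2 * e) * c.
  rewrite mulrAC ler_pdivlMr ?mulr_gt0// /c.
  have : e <= (1 + e) * ln (1 + e) by rewrite mulrC -ler_pdivrMr.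
  have := ltW s0; nra.
apply: le_trans h2 _.
rewrite !mulrA ler_pdivlMr// [_ * nu]mulrC expr2 -!mulrA.
apply: ler_pM => //; first exact: ltW.
by rewrite !mulr_ge0 ?invr_ge0 ?mulr_ge0 ?(ltW e1) ?(ltW c0)// ltW.
Qed.

Lemma expr_sub1_bounds (e : R) n : 0 <= e ->
  n.+1%:R * e <= (1 + e) ^+ n.+1 - 1 <= n.+1%:R * e * (1 + e) ^+ n.
Proof.
move=> e0; apply/andP; split.
  by rewrite lerBrDl; exact: bernoulli_ler.
rewrite subrX1; have -> : 1 + e - 1 = e by ring.
rewrite mulrAC mulrC ler_wpM2r//.
have -> : n.+1%:R * (1 + e) ^+ n = \sum_(i < n.+1) (1 + e) ^+ n.
  by rewrite sumr_const card_ord mulr_natl.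
apply: ler_sum => i _; apply: ler_weXn2l; first by rewrite lerDl.
by rewrite -ltnS.
Qed.

End elementary_bounds.

(** Expanding the square shows that the integral is a quadratic polynomial in w: on a set of finite
    measure, |u| <= 1 + u^2 makes u itself integrable. *)
Lemma integral_sqr_sub {R : realType} n (D : set 'rV[R]_n) (u : 'rV[R]_n -> R) :
  measurable (D : set (Rlebesgue R n)) -> (lebesgue n D < +oo)%E -> L2 D u ->
  exists A B C : R, forall w : R,
    (\int[lebesgue n]_(x in D) (`|u x - w| ^+ 2)%:E)%E = (A - B * w + C * w ^+ 2)%:E.
Proof.
move=> mD fD [mu2 iu2]; pose m := @lebesgue R n.
have msq : measurable_fun (D : set (Rlebesgue R n)) (fun x => u x ^+ 2).
  exact: measurable_funX.
have I2 : m.-integrable D (EFin \o (fun x => u x ^+ 2)).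
  apply/integrableP; split; first exact/measurable_EFinP.
  by under eq_integral => x _ do rewrite /= ger0_norm ?sqr_ge0//.
have I0 (c : R) : m.-integrable D (EFin \o cst c).
  apply/integrableP; split; first exact/measurable_EFinP.
  rewrite [X in (X < _)%E](_ : _ = (\int[m]_(x in D) `|c|%:E)%E)//.
  by rewrite integral_cst//; apply: lte_mul_pinfty.
have I1 : m.-integrable D (EFin \o u).
  apply: (@le_integrable _ _ _ m _ mD _ (EFin \o (fun x => 1 + u x ^+ 2))).
  - exact/measurable_EFinP.
  - move=> x _ /=; rewrite lee_fin [leRHS]ger0_norm ?addr_ge0 ?sqr_ge0//.
    rewrite -[X in _ <= 1 + X]real_normK ?num_real//; move: `|u x| => z.
    by have := sqr_ge0 (z - 1); nra.
  - exact: (integrableD mD (I0 1) I2).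
exists (\int[m]_(x in D) (u x ^+ 2)), (2 * \int[m]_(x in D) u x), (\int[m]_(x in D) 1) => w.
have Iw : m.-integrable D (EFin \o (fun x => (2 * w) * u x)).
  exact: (integrableZl mD _ I1).
have Iu : m.-integrable D (EFin \o (fun x => u x ^+ 2 - 2 * w * u x)) by exact: (integrableB mD I2 Iw).
have Iw2 : m.-integrable D (EFin \o (fun x => w ^+ 2 * cst 1 x)) by exact: (integrableZl mD _ (I0 1)).
have If : m.-integrable D (EFin \o (fun x => u x ^+ 2 - 2 * w * u x + w ^+ 2 * 1)).
  exact: (integrableD mD Iu Iw2).
have -> : (\int[lebesgue n]_(x in D) (`|u x - w| ^+ 2)%:E)%E =
    (\int[m]_(x in D) (u x ^+ 2 - 2 * w * u x + w ^+ 2 * 1)%:E)%E.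
  apply: eq_integral => x _; congr EFin.
  by rewrite real_normK ?num_real//; ring.
rewrite -[LHS]fineK; last exact: integrable_fin_num.
congr EFin; rewrite -[LHS]/(\int[m]_(x in D) (u x ^+ 2 - 2 * w * u x + w ^+ 2 * 1)).
rewrite RintegralD// RintegralB// !RintegralZl//; last exact: (I0 1).
congr (_ - _ + _); last by rewrite mulrC.
by rewrite [LHS]mulrAC.
Qed.

Lemma measurable_enorm_sub {R : realType} n :
  measurable_fun (setT : set (Rlebesgue R n * Rlebesgue R n))
    (fun z : 'rV[R]_n * 'rV[R]_n => enorm (z.1 - z.2)).
Proof.
apply: (@measurableT_comp _ _ _ _ _ _ (@Num.sqrt R)).
  by apply: continuous_measurable_fun; exact: sqrt_continuous.
apply: measurable_sum => i.
have h : measurable_fun (setT : set (Rlebesgue R n * Rlebesgue R n))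
   (fun z : 'rV[R]_n * 'rV[R]_n => (z.1 - z.2) ord0 i).
  under eq_fun do rewrite !mxE.
  apply: measurable_funB.
    exact: (measurableT_comp (@measurable_coord R n i) measurable_fst).
  exact: (measurableT_comp (@measurable_coord R n i) measurable_snd).
exact: measurable_funM.
Qed.

Section kernel.
Context {R : realType} {n : nat}.
Variables (u : 'rV[R]_n -> R) (s : R).

Definition Hs_kernel (z : 'rV[R]_n * 'rV[R]_n) : R :=
  `|u z.1 - u z.2| ^+ 2 / (enorm (z.1 - z.2)) `^ (n%:R + 2 * s).

Lemma Hs_kernel_ge0 z : 0 <= Hs_kernel z.
Proof. by rewrite divr_ge0 ?sqr_ge0 ?powR_ge0. Qed.

Lemma Hs_kernelC x y : Hs_kernel (x, y) = Hs_kernel (y, x).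
Proof. by rewrite /Hs_kernel/= distrC enormB. Qed.

Lemma measurable_Hs_kernel : lebesgue_measurable_fun setT u ->
  measurable_fun (setT : set (Rlebesgue R n * Rlebesgue R n)) Hs_kernel.
Proof.
move=> mu; rewrite (_ : Hs_kernel = fun z : 'rV[R]_n * 'rV[R]_n =>
  (u z.1 - u z.2) ^+ 2 * enorm (z.1 - z.2) `^ (- (n%:R + 2 * s))); last first.
  by apply/funext => z; rewrite /Hs_kernel powRN real_normK ?num_real.
apply: measurable_funM.
  apply: measurable_funX; apply: measurable_funB.
    exact: (measurableT_comp mu measurable_fst).
  exact: (measurableT_comp mu measurable_snd).
apply: (@measurableT_comp _ _ _ _ _ _ (fun t : R => t `^ _)); first exact: measurable_powR.
exact: measurable_enorm_sub.
Qed.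

End kernel.

(** * The radial limit *)

Lemma measurable_integral1 {R : realType} n (F : 'rV[R]_n * 'rV[R]_n -> \bar R) (A : set 'rV[R]_n) :
  (forall z, (0 <= F z)%E) ->
  measurable_fun (setT : set (Rlebesgue R n * Rlebesgue R n)) F ->
  measurable (A : set (Rlebesgue R n)) ->
  measurable_fun (setT : set (Rlebesgue R n)) (fun y => (\int[lebesgue n]_(x in A) F (x, y))%E).
Proof.
move=> F0 mF mA.
pose G : Rlebesgue R n * Rlebesgue R n -> \bar R := F \_ (A `*` setT).
have mG : measurable_fun setT G.
  apply/(measurable_restrictT _ _).1; first exact: measurableX.
  exact: measurable_funTS.
have G0 z : (0 <= G z)%E by rewrite /G patchE; case: ifP.
rewrite (_ : (fun y => _) = fubini_G (@lebesgue R n) G).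
  exact: measurable_fun_fubini_tonelli_G.
apply/funext => y; rewrite [LHS]integral_mkcond; apply: eq_integral => x _.
by rewrite /G !patchE in_setX in_setT andbT.
Qed.

Lemma expr_unbounded {R : realType} (lam a : R) : 1 < lam ->
  exists N, forall j, (N <= j)%N -> a < lam ^+ j.
Proof.
move=> lam1; have l10 : 0 < lam - 1 by rewrite subr_gt0.
exists (Num.truncn (`|a| / (lam - 1))).+1 => j Nj.
have : `|a| / (lam - 1) < j%:R.
  by apply: lt_le_trans (truncnS_gt _) _; rewrite ler_nat.
rewrite ltr_pdivrMr// => aj; have := @bernoulli_ler R (lam - 1) j (ltW l10).
rewrite [1 + (lam - 1)]addrC subrK; apply: lt_le_trans.
by rewrite (le_lt_trans (ler_norm a))// (lt_trans aj)// ltrDr.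
Qed.

Section at_infinity.
Context {R : realType} {k : nat}.
Notation d := k.+1.
Variables (Omega : set 'rV[R]_d) (u u_inf : 'rV[R]_d -> R) (R0 M : R).
Hypothesis mO : measurable (Omega : set (Rlebesgue R d)).
Hypothesis OR : forall x, Omega x -> enorm x <= R0.
Hypothesis uM : forall x, (~` Omega) x -> `|u x| <= M.
Hypothesis mu : lebesgue_measurable_fun (~` Omega) u.
Hypothesis u_lim : forall theta, esphere theta -> u (r *: theta) @[r --> +oo] --> u_inf theta.

(** Inside Omega there is no bound on u. The extension by zero is bounded on the whole space and has
    the same values far away. *)
Definition outer_part : 'rV[R]_d -> R := u \_ (~` Omega).
(** The extension of [u_inf] that is constant along rays, a function to which Lebesgue measure
    applies. *)
Definition radial_limit : 'rV[R]_d -> R := (u_inf \o radial) \_ [set y | 0 < enorm y].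

Lemma outer_partE y : (~` Omega) y -> outer_part y = u y.
Proof. by move=> /mem_set h; rewrite /outer_part patchE h. Qed.

Lemma radial_limitE y : 0 < enorm y -> radial_limit y = u_inf (radial y).
Proof. by move=> h; rewrite /radial_limit patchE mem_set. Qed.

Lemma measurable_outer_part : measurable_fun (setT : set (Rlebesgue R d)) outer_part.
Proof. by apply/(measurable_restrictT _ _).1 => //; exact: measurableC. Qed.

Lemma outer_part_bounded y : `|outer_part y| <= `|M|.
Proof.
rewrite /outer_part patchE; case: ifPn => [|_]; last by rewrite normr0.
by rewrite inE => /uM h; apply: le_trans h (ler_norm _).
Qed.

Lemma outer_part_cvg lam y : 1 < lam -> 0 < enorm y ->
  outer_part (lam ^+ j *: y) @[j --> \oo] --> radial_limit y.
Proof.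
move=> lam1 y0; rewrite radial_limitE//.
have Sy : esphere (radial y) by exact: enorm_radial.
have lim : (fun j => u ((lam ^+ j * enorm y) *: radial y)) @ \oo --> u_inf (radial y).
  apply: (cvg_comp _ _ _ (u_lim Sy)).
  apply/cvgryPgt => A; have [N hN] := expr_unbounded (A / enorm y) lam1.
  exists N => // j /= Nj; have := hN _ Nj.
  by rewrite ltr_pdivrMr.
apply: cvg_trans lim; apply: near_eq_cvg.
have [N hN] := expr_unbounded (R0 / enorm y) lam1.
exists N => // j /= Nj; rewrite -scalerA radialK// outer_partE//.
move=> /OR; apply/negP; rewrite -ltNge enormZ.
rewrite ger0_norm ?exprn_ge0 ?(le_trans ler01 (ltW lam1))//.
by rewrite -ltr_pdivrMr// hN.
Qed.

(** Obtained as a pointwise limit of measurable functions, along the radii 2^j. *)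
Lemma measurable_radial_limit : measurable_fun (setT : set (Rlebesgue R d)) radial_limit.
Proof.
have mD : measurable ([set y | 0 < enorm y] : set (Rlebesgue R d)).
  rewrite (_ : [set y | _] = [set y | `]0, +oo[%classic (enorm y)]).
    by apply: measurable_enorm_itv; exact: measurable_itv.
  by apply/seteqP; split => y; rewrite /= in_itv/= andbT.
apply/(measurable_restrictT _ mD).1.
apply: (@measurable_fun_cvg _ (Rlebesgue R d) R _ (fun j (y : 'rV[R]_d) => outer_part (2 ^+ j *: y))).
  move=> j; apply: measurable_funTS.
  have j0 : 0 < 2 ^+ j :> R by [].
  exact: (measurableT_comp measurable_outer_part (measurable_scale j0)).
move=> y y0; have := @outer_part_cvg 2 y; rewrite radial_limitE//; apply => //.
by rewrite ltr1n.
Qed.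

Lemma radial_limit_bounded y : `|radial_limit y| <= `|M|.
Proof.
case: (ltP 0 (enorm y)) => y0; last first.
  by rewrite /radial_limit patchE memNset ?normr0//=; apply/negP; rewrite -leNgt.
have l2 : 1 < 2 :> R by rewrite ltr1n.
apply: (cvgr_to_le (cvg_norm (outer_part_cvg l2 y0))).
by apply: nearW => j; exact: outer_part_bounded.
Qed.

Lemma radial_limit_scale c y : 0 < c -> 0 < enorm y -> radial_limit (c *: y) = radial_limit y.
Proof.
move=> c0 y0; rewrite !radial_limitE ?radial_scale//.
by rewrite enormZ mulr_gt0// normr_gt0 gt_eqF.
Qed.

End at_infinity.

(** * Near and far interactions *)

Section far_field.
Context {R : realType} {k : nat}.
Notation d := k.+1.
Notation mu := (@lebesgue R d).
Variables (Omega : set 'rV[R]_d) (u : 'rV[R]_d -> R) (R0 : R) (q : R -> R).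
Hypothesis mO : measurable (Omega : set (Rlebesgue R d)).
Hypothesis OR : forall x, Omega x -> enorm x <= R0.
Hypothesis mu_u : lebesgue_measurable_fun setT u.
Hypothesis qE : forall w, (\int[mu]_(x in Omega) (`|u x - w| ^+ 2)%:E = (q w)%:E)%E.
Hypothesis mq : measurable_fun setT q.
Variables (lam e s : R) (m : nat).
Hypothesis lam1 : 1 < lam.
Hypothesis e01 : 0 < e < 1.
Hypothesis R0e : R0 <= e * lam ^+ m.
Hypothesis s01 : 0 < s <= 1.

Let Y : set 'rV[R]_d := [set y | lam ^+ m < enorm y].
Let p := d%:R + 2 * s.
Let f := q \o outer_part Omega u.

Let mY : measurable (Y : set (Rlebesgue R d)).
Proof.
rewrite (_ : Y = [set y | `]lam ^+ m, +oo[%classic (enorm y)]).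
  by apply: measurable_enorm_itv; exact: measurable_itv.
by apply/seteqP; split => y; rewrite /Y /= in_itv/= andbT.
Qed.

Let e0 : 0 < e. Proof. by case/andP: e01. Qed.
Let e1 : 0 < 1 - e. Proof. by case/andP: e01 => _ h; rewrite subr_gt0. Qed.
Let s0 : 0 < s. Proof. by case/andP: s01. Qed.
Let lm : 0 < lam ^+ m. Proof. by rewrite exprn_gt0// (lt_trans ltr01 lam1). Qed.

Let p02 : 0 <= p <= d.+2%:R.
Proof.
rewrite /p addr_ge0 ?mulr_ge0 ?(ltW s0)//= -[d.+2]addn2 natrD lerD2l.
by case/andP: s01 => _ h; rewrite ler_piMr.
Qed.

Let q0 w : 0 <= q w.
Proof. by rewrite -lee_fin -qE; apply: integral_ge0 => x _; rewrite lee_fin sqr_ge0. Qed.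

Let R0y y : Y y -> R0 <= e * enorm y.
Proof. by move=> Yy; apply: le_trans R0e _; rewrite ler_pM2l// ltW. Qed.

Let outY y : Y y -> outer_part Omega u y = u y.
Proof.
move=> Yy; apply: outer_partE => /OR h.
have y0 : 0 < enorm y by exact: lt_trans lm Yy.
have := le_trans h (R0y Yy); apply/negP; rewrite -ltNge gtr_pMl//.
by case/andP: e01.
Qed.

(** The purpose of [R0e]: seen from a far point y, the whole of Omega lies within e |y| of the
    origin. *)
Let dist_bounds x y : Omega x -> Y y ->
  (1 - e) * enorm y <= enorm (x - y) <= (1 + e) * enorm y.
Proof.
move=> /OR xR Yy; have ey := R0y Yy.
have h1 := enorm_triangle 0 x y; have h2 := enorm_triangle x y 0.
rewrite !subr0 sub0r enormN in h1 h2; rewrite [enorm (y - x)]enormB in h2.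
by apply/andP; split; lra.
Qed.

Let msq D w : measurable_fun (D : set (Rlebesgue R d)) (fun x => (`|u x - w| ^+ 2)%:E).
Proof.
apply/measurable_EFinP; apply: measurable_funX.
apply: measurableT_comp; first exact: normr_measurable.
by apply: measurable_funB; [exact: measurable_funTS|exact: measurable_cst].
Qed.

Let mK := measurable_Hs_kernel s mu_u.

Let mKx y D : measurable_fun (D : set (Rlebesgue R d)) (fun x => (Hs_kernel u s (x, y))%:E).
Proof.
apply/measurable_EFinP; apply: measurable_funTS.
by apply: (measurableT_comp mK); exact: measurable_fun_pair.
Qed.

Let mf : measurable_fun (setT : set (Rlebesgue R d)) f.
Proof.
apply: (measurableT_comp mq); apply: measurable_outer_part => //.
exact: measurable_funTS.
Qed.

Definition far_interaction : \bar R :=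
  (\int[mu]_(y in Y) \int[mu]_(x in Omega) (Hs_kernel u s (x, y))%:E)%E.

Let inner_scaled (a : R) y : Y y -> 0 <= a ->
  (\int[mu]_(x in Omega) (a%:E * (`|u x - u y| ^+ 2)%:E) = (a * f y)%:E)%E.
Proof.
move=> Yy a0; rewrite ge0_integralZl//.
  by rewrite qE -EFinM /f/= outY.
Qed.

Let mfar (b : R) : measurable_fun (Y : set (Rlebesgue R d))
  (fun y => (b * (f y * enorm y `^ (- p)))%:E).
Proof.
have h := measurable_funM mf (@measurable_enorm_powR R d (- p)).
apply/measurable_EFinP; apply: measurable_funTS.
by apply: measurable_funM => //; exact: h.
Qed.

Let minner : measurable_fun (Y : set (Rlebesgue R d))
  (fun y => (\int[mu]_(x in Omega) (Hs_kernel u s (x, y))%:E)%E).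
Proof.
apply: measurable_funTS; apply: (@measurable_integral1 _ _ (EFin \o Hs_kernel u s)) => //.
  by move=> z; rewrite lee_fin Hs_kernel_ge0.
exact/measurable_EFinP.
Qed.

Let far_scaled (b : R) : 0 <= b ->
  (\int[mu]_(y in Y) (b * (f y * enorm y `^ (- p)))%:E = b%:E * far_integral lam f s m)%E.
Proof.
move=> b0; rewrite /far_integral -ge0_integralZl//.
- have := mfar 1; under eq_fun do rewrite mul1r; exact.
- by move=> y _; rewrite lee_fin mulr_ge0 ?powR_ge0// q0.
Qed.

(** Replacing |x - y| by |y| costs a factor with exponent d + 2, an upper bound of d + 2s; what
    remains of the inner integral is q(u(y)). *)
Lemma far_interaction_le :
  (far_interaction <= ((1 - e) ^- d.+2)%:E * far_integral lam f s m)%E.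
Proof.
have b0 : 0 <= (1 - e) ^- d.+2 by rewrite invr_ge0 exprn_ge0// ltW.
rewrite -far_scaled//; apply: ge0_le_integral => //.
- by move=> y _; apply: integral_ge0 => x _; rewrite lee_fin Hs_kernel_ge0.
move=> y Yy; have y0 : 0 < enorm y by exact: lt_trans lm Yy.
have a0 : 0 <= (1 - e) ^- d.+2 * enorm y `^ (- p) by rewrite mulr_ge0 ?powR_ge0.
rewrite [leRHS](_ : _ = ((1 - e) ^- d.+2 * enorm y `^ (- p) * f y)%:E); last first.
  by congr EFin; rewrite mulrCA mulrC.
rewrite -(inner_scaled Yy a0); apply: ge0_le_integral.
- exact: mO.
- by move=> x _; rewrite lee_fin Hs_kernel_ge0.
- exact: mKx.
- by apply: measurable_funeM; exact: msq.
- move=> x Ox; rewrite -EFinM lee_fin /Hs_kernel/= mulrC ler_wpM2r ?sqr_ge0//.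
  have /andP[h1 _] := dist_bounds Ox Yy.
  by apply: kernel_le => //; rewrite e1/= gerBl ltW.
Qed.

Lemma far_interaction_ge :
  (((1 + e) ^- d.+2)%:E * far_integral lam f s m <= far_interaction)%E.
Proof.
have b0 : 0 <= (1 + e) ^- d.+2 by rewrite invr_ge0 exprn_ge0// addr_ge0// ltW.
rewrite -far_scaled//; apply: ge0_le_integral => //.
- by move=> y _; rewrite lee_fin !mulr_ge0 ?powR_ge0// q0.
move=> y Yy; have y0 : 0 < enorm y by exact: lt_trans lm Yy.
have a0 : 0 <= (1 + e) ^- d.+2 * enorm y `^ (- p) by rewrite mulr_ge0 ?powR_ge0.
rewrite [leLHS](_ : _ = ((1 + e) ^- d.+2 * enorm y `^ (- p) * f y)%:E); last first.
  by congr EFin; rewrite mulrCA mulrC.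
rewrite -(inner_scaled Yy a0); apply: ge0_le_integral.
- exact: mO.
- by move=> x _; rewrite -EFinM lee_fin mulr_ge0 ?sqr_ge0.
- by apply: measurable_funeM; exact: msq.
- exact: mKx.
- move=> x Ox; rewrite -EFinM lee_fin /Hs_kernel/= [leRHS]mulrC ler_wpM2r ?sqr_ge0//.
  have /andP[h1 h2] := dist_bounds Ox Yy.
  by apply: kernel_ge => //; rewrite ?lerDl ?(ltW e0)// h2 (lt_le_trans _ h1)// mulr_gt0.
Qed.

Let Hs_seminorm2E t : Hs_seminorm2 t Omega u =
  (\int[mu \x mu]_(z in QOmega Omega) (Hs_kernel u t z)%:E)%E.
Proof. by []. Qed.

Definition near_pairs : set ('rV[R]_d * 'rV[R]_d) :=
  QOmega Omega `&` [set z | enorm z.1 <= lam ^+ m /\ enorm z.2 <= lam ^+ m].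

Let mball : measurable ([set y | enorm y <= lam ^+ m] : set (Rlebesgue R d)).
Proof.
rewrite (_ : [set y | _] = [set y | `]-oo, lam ^+ m]%classic (enorm y)]).
  by apply: measurable_enorm_itv; exact: measurable_itv.
by apply/seteqP; split => y; rewrite /= in_itv.
Qed.

Lemma measurable_QOmega : measurable (QOmega Omega : set (Rlebesgue R d * Rlebesgue R d)).
Proof. by apply: measurableC; apply: measurableX; exact: measurableC. Qed.

Let mN : measurable (near_pairs : set (Rlebesgue R d * Rlebesgue R d)).
Proof. by apply: measurableI; [exact: measurable_QOmega|exact: (measurableX mball mball)]. Qed.

Let ballO x : Omega x -> enorm x <= lam ^+ m.
Proof.
move=> /OR h; apply: le_trans h (le_trans R0e _); rewrite ger_pMl//.
by case/andP: e01 => _ /ltW.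
Qed.

(** Two far points both lie outside Omega, so such a pair is excluded from [QOmega]. *)
Lemma QOmega_decomposition : QOmega Omega = near_pairs `|` (Omega `*` Y `|` Y `*` Omega).
Proof.
have YO y : Y y -> ~ Omega y.
  by move=> Yy /ballO; apply/negP; rewrite -ltNge.
apply/seteqP; split => [[x y] Qxy|[x y]]; last first.
  move=> [[]//|[[Ox Yy]|[Yx Oy]]] [/= nx ny]; exact: nx || exact: ny.
case: (leP (enorm x) (lam ^+ m)) => hx; case: (leP (enorm y) (lam ^+ m)) => hy.
- by left.
- right; left; split => //=; apply: contrapT => nx.
  by apply: Qxy; split => //; exact: YO.
- right; right; split => //=; apply: contrapT => ny.
  by apply: Qxy; split => //; exact: YO.
- by exfalso; apply: Qxy; split; exact: YO.
Qed.

Lemma Hs_seminorm2_decomposition : Hs_seminorm2 s Omega u =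
  (\int[mu \x mu]_(z in near_pairs) (Hs_kernel u s z)%:E +
   (far_interaction + far_interaction))%E.
Proof.
have mKE D : measurable_fun (D : set (Rlebesgue R d * Rlebesgue R d)) (EFin \o Hs_kernel u s).
  by apply/measurable_EFinP; exact: measurable_funTS.
have K0 z : (0 <= (Hs_kernel u s z)%:E)%E by rewrite lee_fin Hs_kernel_ge0.
have mOY : measurable (Omega `*` Y : set (Rlebesgue R d * Rlebesgue R d)) by exact: measurableX.
have mYO : measurable (Y `*` Omega : set (Rlebesgue R d * Rlebesgue R d)) by exact: measurableX.
have bY y : Y y -> enorm y <= lam ^+ m -> False.
  by move=> Yy; apply/negP; rewrite -ltNge.
rewrite Hs_seminorm2E QOmega_decomposition ge0_integral_setU//; first last.
- apply/disj_setPS => -[x y] [[_ [/= hx hy]] [[_ Yy]|[Yx _]]].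
    exact: (bY _ Yy).
  exact: (bY _ Yx).
- exact: measurableU.
rewrite ge0_integral_setU//; last first.
  by apply/disj_setPS => -[x y] [[/= /ballO hx _] [Yx _]]; exact: (bY _ Yx).
congr (_ + (_ + _))%E.
  exact: (integral_rectangle2 K0 (mKE setT) mO mY).
apply: etrans (integral_rectangle1 K0 (mKE setT) mY mO) _.
apply: eq_integral => y _; apply: eq_integral => x _ /=.
by rewrite Hs_kernelC.
Qed.

(** Two near points are at distance at most 2 lam^m, the D of [kernel_near_le]. *)
Lemma near_integral_le t : s <= t <= 1 -> 1 <= 2 * lam ^+ m ->
  (\int[mu \x mu]_(z in near_pairs) (Hs_kernel u s z)%:E <=
   ((2 * lam ^+ m) ^+ 2)%:E * Hs_seminorm2 t Omega u)%E.
Proof.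
move=> /andP[st t1] D1.
have mKE D r : measurable_fun (D : set (Rlebesgue R d * Rlebesgue R d)) (EFin \o Hs_kernel u r).
  by apply/measurable_EFinP; apply: measurable_funTS; exact: measurable_Hs_kernel.
have K0 r z : (0 <= (Hs_kernel u r z)%:E)%E by rewrite lee_fin Hs_kernel_ge0.
have c0 : (0 <= ((2 * lam ^+ m) ^+ 2)%:E)%E by rewrite lee_fin sqr_ge0.
rewrite Hs_seminorm2E -ge0_integralZl//; first last.
- exact: mKE.
- exact: measurable_QOmega.
apply: (@le_trans _ _ (\int[mu \x mu]_(z in near_pairs)
   (((2 * lam ^+ m) ^+ 2)%:E * (Hs_kernel u t z)%:E))%E); last first.
  apply: ge0_subset_integral => //.
  - exact: measurable_QOmega.
  - by apply: measurable_funeM; exact: mKE.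
  - by move=> z _; rewrite mule_ge0.
  - by move=> z [].
apply: ge0_le_integral => //.
- exact: mKE.
- by apply: measurable_funeM; exact: mKE.
- move=> z [_ [hx hy]]; rewrite -EFinM lee_fin /Hs_kernel mulrCA ler_wpM2l ?sqr_ge0//.
  apply: kernel_near_le => //; rewrite enorm_ge0/=.
  apply: le_trans (enorm_triangle 0 _ _) _.
  by rewrite subr0 sub0r enormN; lra.
Qed.

End far_field.

(** Polar coordinates are applied for each fixed x, before the order of integration is exchanged;
    Tonelli is then used for Lebesgue measures only. *)
Lemma integral_domain_sphere {R : realType} {k : nat} (Omega : set 'rV[R]_k.+1)
    (u u_inf U : 'rV[R]_k.+1 -> R) (q : R -> R) :
  measurable (Omega : set (Rlebesgue R k.+1)) -> lebesgue_measurable_fun setT u ->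
  lebesgue_measurable_fun setT U -> (forall y, 0 < enorm y -> U y = u_inf (radial y)) ->
  (forall w, (\int[lebesgue k.+1]_(x in Omega) (`|u x - w| ^+ 2)%:E = (q w)%:E)%E) ->
  (\int[lebesgue k.+1]_(x in Omega)
     \int[hausdorff k k.+1]_(th in esphere) (`|u x - u_inf th| ^+ 2)%:E =
   k.+1%:R%:E * \int[lebesgue k.+1]_(y in pball) (q (U y))%:E)%E.
Proof.
move=> mO mu mU UE qE; have mp := @measurable_pball R k.
pose F (z : 'rV[R]_k.+1 * 'rV[R]_k.+1) := (`|u z.2 - U z.1| ^+ 2)%:E.
have F0 z : (0 <= F z)%E by rewrite lee_fin sqr_ge0.
have mF : measurable_fun (setT : set (Rlebesgue R k.+1 * Rlebesgue R k.+1)) F.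
  apply/measurable_EFinP; apply: measurable_funX.
  apply: measurableT_comp; first exact: normr_measurable.
  apply: measurable_funB; first exact: (measurableT_comp mu measurable_snd).
  exact: (measurableT_comp mU measurable_fst).
have sphereE x : (\int[hausdorff k k.+1]_(th in esphere) (`|u x - u_inf th| ^+ 2)%:E =
    k.+1%:R%:E * \int[lebesgue k.+1]_(y in pball) F (y, x))%E.
  rewrite (@integral_sphere _ _ (fun th => `|u x - u_inf th| ^+ 2)).
  - congr (_ * _)%E; apply: eq_integral => y; rewrite inE => /andP[y0 _].
    by rewrite /F/= UE.
  - by move=> th; rewrite sqr_ge0.
  - apply: (@eq_measurable_fun _ _ (Rlebesgue R k.+1) _ _ (fun y => `|u x - U y| ^+ 2)).
      by move=> y; rewrite inE => /andP[y0 _]; rewrite /= UE.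
    apply: measurable_funX; apply: measurableT_comp; first exact: normr_measurable.
    by apply: measurable_funB; [exact: measurable_cst|exact: measurable_funTS].
under eq_integral do rewrite sphereE.
rewrite ge0_integralZl; first last.
- by rewrite lee_fin.
- by move=> x _; apply: integral_ge0 => y _; exact: F0.
- by apply: measurable_funTS; exact: measurable_integral1.
- exact: mO.
congr (_ * _)%E; rewrite -(integral_rectangle2 F0 mF mp mO) (integral_rectangle1 F0 mF mp mO).
by apply: eq_integral => y _; rewrite -qE.
Qed.

(** * The far integral for small s *)

Section annulus_estimates.
Context {R : realType} {k : nat}.
Notation d := k.+1.
Variables (f : 'rV[R]_d -> R) (K J e s : R) (m : nat).
Hypotheses (f0 : forall y, 0 <= f y) (fK : forall y, f y <= K).
Hypothesis mf : measurable_fun (setT : set (Rlebesgue R d)) f.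
Hypothesis J0 : 0 <= J.
Hypothesis e0 : 0 < e.
(** The tolerance is e^2 because both the limit (1 + e)^d - 1 and 1 / (the sum of the weights times
    s) are of order e: the error left after summation is then of order e. *)
Hypothesis fm : forall j, (m <= j)%N ->
  `|annulus_avg (1 + e) f j - ((1 + e) ^+ d - 1) * J| <= e ^+ 2.
Hypothesis s01 : 0 < s <= (2 * m.+1%:R)^-1.

Let nu := (1 + e) `^ (2 * s).

Let s0 : 0 < s. Proof. by case/andP: s01. Qed.
Let lam1 : 1 < 1 + e. Proof. by rewrite ltrDl. Qed.
Let lam0 : 0 < 1 + e. Proof. exact: lt_trans ltr01 lam1. Qed.

Let s2 : s <= 1 / 2.
Proof.
case/andP: s01 => _ h; apply: le_trans h _.
by rewrite div1r lef_pV2 ?posrE ?mulr_gt0// ler_peMr// ler1n.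
Qed.

Let s012 : 0 < s <= 1 / 2. Proof. by rewrite s0 s2. Qed.

Let nu1 : 1 <= nu.
Proof.
rewrite /nu -[leLHS](powRr0 (1 + e)); apply: ler_powR; first exact: ltW.
by rewrite mulr_ge0// ltW.
Qed.
Let nu0 : 0 < nu. Proof. exact: lt_le_trans ltr01 nu1. Qed.

(** The smallness of s relative to m ensures that starting the geometric series at m, and losing one
    more step in the lower bound, costs at most the factor 1 + e. *)
Let nu_pow : nu ^+ m.+1 <= 1 + e.
Proof.
rewrite -powR_mulrn ?(ltW nu0)// /nu -powRrM.
rewrite -[leRHS]powRr1 ?(ltW lam0)//; apply: ler_powR; first exact: ltW.
case/andP: s01 => _; rewrite -ler_pdivlMr ?mulr_gt0 ?invr_gt0 ?mulr_gt0//.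
by move=> h; rewrite div1r -ler_pdivlMl// -invfM.
Qed.

Lemma far_integral_upper :
  (s%:E * far_integral (1 + e) f s m <=
   ((1 + e) ^+ 2 * (d%:R * J * (1 + e) ^+ k + e) / 2)%:E)%E.
Proof.
have /andP[_ a2] := expr_sub1_bounds k (ltW e0).
have /andP[_ g2] := geometric_factor_bounds e0 s012; rewrite -/nu in g2.
pose b := ((1 + e) ^+ d - 1) * J + e ^+ 2.
have bj j : (m <= j)%N -> annulus_avg (1 + e) f j <= b.
  by move=> /fm; rewrite ler_norml => /andP[_]; rewrite lerBlDl.
have b0 : 0 <= b by apply: le_trans (bj _ (leqnn m)); exact: annulus_avg_ge0.
have bB : b <= e * (d%:R * J * (1 + e) ^+ k + e).
  rewrite /b mulrDr -expr2 lerD2r.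
  by apply: le_trans (ler_wpM2r J0 a2) _; rewrite le_eqVlt; apply/orP; left; apply/eqP; ring.
have h := far_integral_le lam1 f0 fK mf s0 bj.
have s0' : (0 <= s%:E)%E by rewrite lee_fin ltW.
apply: le_trans (lee_wpmul2l s0' h) _; rewrite -EFinM lee_fin -/nu.
have nm : nu^-1 ^+ m <= 1 by rewrite exprn_ile1// ?invr_ge0 ?(ltW nu0)// invf_le1.
have -> : s * (b * nu^-1 ^+ m / (1 - nu^-1)) = b * nu^-1 ^+ m * (s / (1 - nu^-1)) by ring.
apply: (@le_trans _ _ (e * (d%:R * J * (1 + e) ^+ k + e) * ((1 + e) ^+ 2 / (2 * e)))).
  apply: ler_pM => //.
  - by rewrite mulr_ge0// exprn_ge0// invr_ge0 ltW.
  - by rewrite divr_ge0 ?(ltW s0)// subr_ge0 invf_le1.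
  - by apply: le_trans bB; rewrite ler_piMr.
rewrite le_eqVlt; apply/orP; left; apply/eqP; field.
by rewrite gt_eqF.
Qed.

Lemma far_integral_lower :
  (((1 + e) ^- d.+1 * (d%:R * J - e) / 2)%:E <= s%:E * far_integral (1 + e) f s m)%E.
Proof.
have s0' : (0 <= s%:E)%E by rewrite lee_fin ltW.
have [dJ|dJ] := leP (d%:R * J) e.
  apply: (@le_trans _ _ 0%E).
    rewrite lee_fin pmulr_lle0// pmulr_rle0 ?invr_gt0 ?exprn_gt0//.
    by rewrite subr_le0.
  apply: mule_ge0 => //; apply: integral_ge0 => y _.
  by rewrite lee_fin mulr_ge0 ?powR_ge0.
have /andP[a1 _] := expr_sub1_bounds k (ltW e0).
have /andP[g1 _] := geometric_factor_bounds e0 s012; rewrite -/nu in g1.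
pose b := e * (d%:R * J - e).
have bj j : (m <= j)%N -> b <= annulus_avg (1 + e) f j.
  move=> /fm; rewrite ler_norml => /andP[+ _]; rewrite lerBrDl.
  apply: le_trans; rewrite /b mulrBr -expr2 lerD2r.
  by rewrite mulrCA mulrA ler_wpM2r.
have b0 : 0 < b by rewrite mulr_gt0// subr_gt0.
have h := far_integral_ge lam1 f0 fK mf s0 bj.
apply: le_trans (lee_wpmul2l s0' h); rewrite -EFinM lee_fin -/nu.
have -> : s * (b * nu^-1 ^+ m / (1 - nu^-1) / ((1 + e) ^+ d * nu)) =
    b * (1 + e) ^- d * (nu ^- m.+1 * (s / (1 - nu^-1))).
  by rewrite exprVn [nu ^+ m.+1]exprS !invfM; ring.
have -> : (1 + e) ^- d.+1 * (d%:R * J - e) / 2 =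
   b * (1 + e) ^- d * ((1 + e)^-1 * (2 * e)^-1).
  rewrite exprS invfM /b; field.
  by rewrite !gt_eqF ?exprn_gt0.
rewrite ler_pM2l; last by rewrite mulr_gt0// invr_gt0 exprn_gt0.
apply: ler_pM => //; rewrite ?invr_ge0 ?mulr_ge0 ?(ltW lam0) ?(ltW e0)//.
by rewrite lef_pV2 ?posrE ?exprn_gt0.
Qed.

End annulus_estimates.

(** * The limit *)

Lemma bounded_set_enorm {R : realType} n (A : set 'rV[R]_n) : bounded_set A ->
  exists2 r : R, 0 < r & forall x, A x -> enorm x <= r.
Proof.
move=> /pinfty_ex_gt0[M M0 hM]; exists (n%:R * `|M| + 1); first by rewrite ltr_wpDl// mulr_ge0.
move=> x /hM xM; apply: (@le_trans _ _ (n%:R * `|M|)); last by rewrite lerDl.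
apply: enorm_le_coord => i; apply: le_trans (le_trans xM (ler_norm _)).
by rewrite [leRHS]mx_normrE; apply: (le_bigmax _ (fun ij => `|x ij.1 ij.2|) (ord0, i)).
Qed.

Section bound_asymptotics.
Context {R : realType}.
Implicit Types (c e : R) (k : nat).

(** The bounds for s times the far interaction, with c = d J: a kernel factor with exponent d + 2,
    here [k.+3], times the bound on the far integral. Both tend to c / 2 with e. *)
Definition upper_bound c k e : R :=
  (1 - e) ^- k.+3 * ((1 + e) ^+ 2 * (c * (1 + e) ^+ k + e) / 2).
Definition lower_bound c k e : R :=
  (1 + e) ^- k.+3 * ((1 + e) ^- k.+2 * (c - e) / 2).

Let cvg0 : e @[e --> (0 : R)^'+] --> (0 : R). Proof. exact: cvg_at_right_filter cvg_id. Qed.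

Let cvg_exp (f : R -> R) (l : R) k : f e @[e --> (0 : R)^'+] --> l ->
  f e ^+ k @[e --> (0 : R)^'+] --> l ^+ k.
Proof. by move=> h; have := cvg_comp _ _ h (@exprn_continuous R k l); exact. Qed.

Let cvg1D : 1 + e @[e --> (0 : R)^'+] --> (1 : R).
Proof. by rewrite -[X in _ --> X]addr0; apply: cvgD => //; exact: cvg_cst. Qed.

Let cvg1DX k : (1 + e) ^+ k @[e --> (0 : R)^'+] --> (1 : R).
Proof. by rewrite -[X in _ --> X](expr1n _ k); exact: cvg_exp. Qed.

Let cvg1DV k : (1 + e) ^- k @[e --> (0 : R)^'+] --> (1 : R).
Proof. by rewrite -[X in _ --> X]invr1; apply: cvgV => //; rewrite oner_eq0. Qed.

Let cvg1BV k : (1 - e) ^- k @[e --> (0 : R)^'+] --> (1 : R).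
Proof.
rewrite -[X in _ --> X]invr1; apply: cvgV; first by rewrite oner_eq0.
rewrite -[X in _ --> X](expr1n _ k); apply: cvg_exp.
by rewrite -[X in _ --> X]subr0; apply: cvgB => //; exact: cvg_cst.
Qed.

Lemma upper_bound_cvg c k : upper_bound c k e @[e --> (0 : R)^'+] --> c / 2.
Proof.
rewrite (_ : c / 2 = 1 * (1 * (c * 1 + 0) / 2)); last by rewrite !mul1r mulr1 addr0.
apply: cvgM; first exact: cvg1BV.
apply: cvgM; last exact: cvg_cst.
apply: cvgM; first exact: cvg1DX.
by apply: cvgD => //; apply: cvgM; [exact: cvg_cst|exact: cvg1DX].
Qed.

Lemma lower_bound_cvg c k : lower_bound c k e @[e --> (0 : R)^'+] --> c / 2.
Proof.
rewrite (_ : c / 2 = 1 * (1 * (c - 0) / 2)); last by rewrite !mul1r subr0.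
apply: cvgM; first exact: cvg1DV.
apply: cvgM; last exact: cvg_cst.
apply: cvgM; first exact: cvg1DV.
by apply: cvgB => //; exact: cvg_cst.
Qed.

End bound_asymptotics.

Section limit.
Context {R : realType} {k : nat}.
Notation d := k.+1.
Notation mu := (@lebesgue R d).
Variables (Omega : set 'rV[R]_d) (u u_inf : 'rV[R]_d -> R) (R0 M t A B C : R).
Hypothesis mO : measurable (Omega : set (Rlebesgue R d)).
Hypothesis OR : forall x, Omega x -> enorm x <= R0.
Hypothesis uM : forall x, (~` Omega) x -> `|u x| <= M.
Hypothesis mu_u : lebesgue_measurable_fun setT u.
Hypothesis u_lim : forall theta, esphere theta -> u (r *: theta) @[r --> +oo] --> u_inf theta.
Hypothesis t01 : 0 < t < 1.
Hypothesis ut : (Hs_seminorm2 t Omega u < +oo)%E.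
Let q (w : R) := A - B * w + C * w ^+ 2.
Hypothesis qE : forall w, (\int[mu]_(x in Omega) (`|u x - w| ^+ 2)%:E = (q w)%:E)%E.

Let U := radial_limit u_inf.
Let f := q \o outer_part Omega u.
Let K := `|A| + `|B| * `|M| + `|C| * `|M| ^+ 2.

Let q0 w : 0 <= q w.
Proof. by rewrite -lee_fin -qE; apply: integral_ge0 => x _; rewrite lee_fin sqr_ge0. Qed.

Let qK w : `|w| <= `|M| -> q w <= K.
Proof.
move=> wM; apply: lerD.
  apply: lerD; first exact: ler_norm.
  by apply: le_trans (ler_norm _) _; rewrite normrN normrM ler_wpM2l.
apply: le_trans (ler_norm _) _; rewrite normrM ler_wpM2l// normrX.
by rewrite lerXn2r ?nnegrE.
Qed.

Let mq : measurable_fun setT q.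
Proof.
apply: measurable_funD; last first.
  by apply: measurable_funM => //; exact: measurable_funX.
by apply: measurable_funB => //; exact: measurable_funM.
Qed.

Let cq : continuous q.
Proof.
move=> w; apply: cvgD; last first.
  by apply: cvgM; [exact: cvg_cst|exact: exprn_continuous].
by apply: cvgB; [exact: cvg_cst|apply: cvgM; [exact: cvg_cst|exact: cvg_id]].
Qed.

Let mu_O : lebesgue_measurable_fun (~` Omega) u. Proof. exact: measurable_funTS. Qed.

Let mf : measurable_fun (setT : set (Rlebesgue R d)) f.
Proof. exact: (measurableT_comp mq (measurable_outer_part mO mu_O)). Qed.

Let mU : measurable_fun (setT : set (Rlebesgue R d)) U.
Proof. exact: measurable_radial_limit mO OR mu_O u_lim. Qed.

Let f0 y : 0 <= f y. Proof. exact: q0. Qed.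
Let fK y : f y <= K. Proof. by apply: qK; exact: outer_part_bounded. Qed.
Let UK y : q (U y) <= K. Proof. by apply: qK; exact: (radial_limit_bounded OR uM u_lim). Qed.

Let J := fine (\int[mu]_(y in pball) (q (U y))%:E)%E.

Let pball_fin : (\int[mu]_(y in pball) (q (U y))%:E < +oo)%E.
Proof.
have K0 : 0 <= K by exact: le_trans (f0 0) (fK 0).
apply: (@le_lt_trans _ _ (\int[mu]_(y in pball) K%:E)%E).
  apply: ge0_le_integral => //.
  - exact: measurable_pball.
  - by move=> y _; rewrite lee_fin.
  - apply/measurable_EFinP; apply: measurable_funTS.
    exact: (measurableT_comp mq mU).
  - by move=> y _; rewrite lee_fin.
rewrite integral_cst; last exact: measurable_pball.
apply: lte_mul_pinfty; [by rewrite lee_fin|by []|].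
apply: le_lt_trans (ltry ((2 * 1) ^+ d)).
apply: le_trans (lebesgue_ball_le 0 ler01); apply: le_outer_measure => y /andP[_ h].
by rewrite /eball/= subr0.
Qed.

Let J0 : 0 <= J.
Proof. by rewrite fine_ge0//; apply: integral_ge0 => y _; rewrite lee_fin. Qed.

Lemma domain_sphere_fin : (\int[mu]_(x in Omega)
     \int[hausdorff k d]_(th in esphere) (`|u x - u_inf th| ^+ 2)%:E = (d%:R * J)%:E)%E.
Proof.
rewrite (@integral_domain_sphere _ _ _ _ _ U q)//; last first.
  by move=> y y0; rewrite /U radial_limitE.
rewrite EFinM /J fineK// ge0_fin_numE//.
by apply: integral_ge0 => y _; rewrite lee_fin.
Qed.

Let annulus_cvg e : 0 < e ->
  annulus_avg (1 + e) f j @[j --> \oo] --> ((1 + e) ^+ d - 1) * J.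
Proof.
move=> e0; have lam1 : 1 < 1 + e by rewrite ltrDl.
refine (annulus_avg_cvg lam1 f0 fK mf (g := q \o U) _ _ _ _ pball_fin).
- by move=> y; exact: q0.
- exact: (measurableT_comp mq mU).
- by move=> c y c0 y0; rewrite /= /U radial_limit_scale.
- move=> y y0; apply: (cvg_comp _ _ (outer_part_cvg OR u_lim lam1 y0)).
  exact: cq.
Qed.

(** All choices are explicit: e from eps, then m from e, then the range of s from m. The constant
    [D] of the near part grows with m, but m is fixed before s tends to 0. *)
Lemma Hs_seminorm2_squeeze eps : 0 < eps ->
  exists2 s1 : R, 0 < s1 & forall s, 0 < s < s1 ->
    ((d%:R * J / 2 - eps)%:E <= (s / 2)%:E * Hs_seminorm2 s Omega u <=
     (d%:R * J / 2 + eps)%:E)%E.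
Proof.
move=> eps0; have eps20 : 0 < eps / 2 by rewrite divr_gt0.
have [e [e0 e1 up lo]] : exists e, [/\ 0 < e, e < 1,
    upper_bound (d%:R * J) k e <= d%:R * J / 2 + eps / 2 &
    d%:R * J / 2 - eps <= lower_bound (d%:R * J) k e].
  (* The upper estimate keeps eps / 2 for the near part; the lower one can spend all of eps, the
     near part being nonnegative. *)
  have /cvgrPdist_le/(_ _ eps20) h1 := @upper_bound_cvg R (d%:R * J) k.
  have /cvgrPdist_le/(_ _ eps0) h2 := @lower_bound_cvg R (d%:R * J) k.
  near (0 : R)^'+ => e; exists e; split.
  - by near: e; exact: nbhs_right_gt.
  - by near: e; apply: nbhs_right_lt.
  - have : `|d%:R * J / 2 - upper_bound (d%:R * J) k e| <= eps / 2 by near: e.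
    by rewrite ler_norml lerBrDl => /andP[h _]; lra.
  - have : `|d%:R * J / 2 - lower_bound (d%:R * J) k e| <= eps by near: e.
    by rewrite ler_norml => /andP[_ h]; lra.
have lam1 : 1 < 1 + e by rewrite ltrDl.
have [N1 hN1] := expr_unbounded (R0 / e) lam1.
have e20 : 0 < e ^+ 2 by rewrite exprn_gt0.
have /cvgrPdist_le/(_ _ e20)[N2 _ hN2] := annulus_cvg e0.
pose m := maxn N1 N2.
have Rm : R0 <= e * (1 + e) ^+ m.
  by rewrite mulrC -ler_pdivrMr// ltW// hN1// leq_maxl.
have fm j : (m <= j)%N -> `|annulus_avg (1 + e) f j - ((1 + e) ^+ d - 1) * J| <= e ^+ 2.
  by move=> mj; rewrite distrC; apply: hN2; rewrite /= (leq_trans (leq_maxr _ _) mj).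
have /andP[t0 t1] := t01.
pose Ht := fine (Hs_seminorm2 t Omega u).
have HtE : Hs_seminorm2 t Omega u = Ht%:E.
  rewrite /Ht fineK// ge0_fin_numE//; apply: integral_ge0 => z _.
  by rewrite lee_fin (Hs_kernel_ge0 u t z).
have Ht0 : 0 <= Ht.
  by rewrite -lee_fin -HtE; apply: integral_ge0 => z _; rewrite lee_fin (Hs_kernel_ge0 u t z).
pose D := (2 * (1 + e) ^+ m) ^+ 2 * Ht.
have D0 : 0 <= D by rewrite mulr_ge0 ?sqr_ge0.
have D1 : 0 < D + 1 by rewrite ltr_wpDl.
(* The three bounds serve, in order, the comparison with the seminorm of order t, the estimates of
   the far integral, and a near part of at most eps / 2; D + 1 avoids a division by 0. *)
exists (Num.min t (Num.min (2 * m.+1%:R)^-1 (eps / (D + 1)))).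
  by rewrite !lt_min t0 invr_gt0 mulr_gt0//= divr_gt0.
move=> s; rewrite !lt_min => /andP[s0 /andP[st /andP[sm sD]]].
have s01 : 0 < s <= 1 by rewrite s0 ltW// (lt_trans st).
have sm' : 0 < s <= (2 * m.+1%:R)^-1 by rewrite s0 ltW.
have e01 : 0 < e < 1 by rewrite e0.
have s0' : (0 <= s%:E)%E by rewrite lee_fin ltW.
have fu := far_integral_upper f0 fK mf J0 e0 fm sm'.
have fl := far_integral_lower f0 fK mf J0 e0 fm sm'.
have gu := far_interaction_le mO OR mu_u qE mq lam1 e01 Rm s01.
have gl := far_interaction_ge mO OR mu_u qE mq lam1 e01 Rm s01.
have nl : (\int[mu \x mu]_(z in near_pairs Omega (1 + e) m) (Hs_kernel u s z)%:E <= D%:E)%E.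
  rewrite /D EFinM -HtE; apply: (near_integral_le mO mu_u s01).
    by rewrite !ltW.
  have : 1 <= (1 + e) ^+ m by rewrite exprn_ege1// ltW.
  by move: (_ ^+ m) => z; lra.
have := Hs_seminorm2_decomposition mO OR mu_u s lam1 e01 Rm.
set N := (\int[_]_(z in _) _)%E in nl *; set H := far_interaction _ _ _ _ _ => HE.
have N0 : (0 <= N)%E by apply: integral_ge0 => z _; rewrite lee_fin Hs_kernel_ge0.
have H0 : (0 <= H)%E.
  by apply: integral_ge0 => y _; apply: integral_ge0 => x _; rewrite lee_fin Hs_kernel_ge0.
(* The two mirror-image far parts cancel the factor 1 / 2. *)
have sHE : ((s / 2)%:E * Hs_seminorm2 s Omega u = (s / 2)%:E * N + s%:E * H)%E.
  have s20 : (s / 2)%:E \is a fin_num by [].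
  rewrite HE muleDr//; last by rewrite ge0_adde_def// inE adde_ge0.
  congr (_ + _)%E; rewrite -mule2n -[(H *+ 2)%E]mule_natl muleA -EFinM.
  by rewrite divfK.
have sHu : (s%:E * H <= (upper_bound (d%:R * J) k e)%:E)%E.
  apply: le_trans (lee_wpmul2l s0' gu) _; rewrite muleCA /upper_bound EFinM.
  by apply: lee_wpmul2l => //; rewrite lee_fin invr_ge0 exprn_ge0// subr_ge0 ltW.
have sHl : ((lower_bound (d%:R * J) k e)%:E <= s%:E * H)%E.
  apply: le_trans (lee_wpmul2l s0' gl); rewrite muleCA /lower_bound EFinM.
  by apply: lee_wpmul2l => //; rewrite lee_fin invr_ge0 exprn_ge0// addr_ge0// ltW.
rewrite sHE; apply/andP; split.
  apply: (@le_trans _ _ (s%:E * H)%E); first exact: le_trans sHl.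
  by rewrite leeDr// mule_ge0// lee_fin divr_ge0// ltW.
apply: (@le_trans _ _ ((eps / 2)%:E + (upper_bound (d%:R * J) k e)%:E)%E).
  apply: leeD => //; apply: (@le_trans _ _ ((s / 2)%:E * D%:E)%E).
    by apply: lee_wpmul2l => //; rewrite lee_fin divr_ge0// ltW.
  rewrite -EFinM lee_fin mulrAC ler_pM2r ?invr_gt0//.
  move: sD; rewrite ltr_pdivlMr// => /ltW; apply: le_trans.
  by rewrite ler_pM2l// lerDl.
by rewrite -EFinD lee_fin; lra.
Unshelve. all: by end_near. Qed.

End limit.

Theorem theorem2p11 (R : realType) (d : nat) (d_gt0 : (0 < d)%N)
    (Omega : set 'rV[R]_d) (u u_inf : 'rV[R]_d -> R) (s0 : R)
    (Omega_lip : bounded_lipschitz_domain Omega)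
    (u_loc : L2loc u)
    (s0_itv : 0 < s0 < 1)
    (u_Hs0 : Hs s0 Omega u)
    (u_bounded : exists M : R, forall x, (~` Omega) x -> `|u x| <= M)
    (u_meas : lebesgue_measurable_fun (~` Omega) u)
    (u_lim : forall theta, esphere theta ->
       u (r *: theta) @[r --> +oo] --> u_inf theta)
    (u_unif :
       ('N[hausdorff d.-1 d]_+oo
          [(fun theta => (u (r *: theta) - u_inf theta)%:E) \_ esphere])%E
         @[r --> +oo] --> 0%E) :
  ((s / 2)%:E * Hs_seminorm2 s Omega u)%E @[s --> 0^'+] -->
  ((2^-1)%:E *
    \int[lebesgue d]_(x in Omega)
      \int[hausdorff d.-1 d]_(theta in esphere)
        (`|u x - u_inf theta| ^+ 2)%:E)%E.
Proof.
(* With d = k.+1, the dimension [d.-1] of the surface measure reduces to k. *)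
case: d d_gt0 Omega u u_inf Omega_lip u_loc u_Hs0 u_bounded u_meas u_lim u_unif => // k _.
move=> Omega u u_inf [_ oO _ bO _] _ [mu L2u ut] [M uM] _ u_lim _.
have mO : measurable (Omega : set (Rlebesgue R k.+1)) by exact: measurable_open.
have [R0 R00 OR] := bounded_set_enorm bO.
have fO : (lebesgue k.+1 Omega < +oo)%E.
  apply: (@lebesgue_bounded_lt_pinfty _ _ _ (R0 + R0)) => x y Ox Oy.
  apply: le_trans (enorm_triangle 0 x y) _.
  by rewrite subr0 sub0r enormN lerD ?OR.
have [A [B [C qE]]] := integral_sqr_sub mO fO L2u.
rewrite (domain_sphere_fin mO OR uM mu u_lim qE).
have sq := Hs_seminorm2_squeeze mO OR uM mu u_lim s0_itv ut qE.
set J := fine _ in sq *; rewrite -EFinM mulrC.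
(* Convergence in the extended reals to a finite limit: the quantity is finite for small s by the
   squeeze with tolerance 1, and its real value converges by the squeeze with tolerance eps. *)
apply/fine_cvgP; split.
  have [s1 s10 h] := sq 1 ltr01.
  near=> s; have /h/andP[h1 h2] : 0 < s < s1.
    by apply/andP; split; near: s; [exact: nbhs_right_gt|exact: nbhs_right_lt].
  by rewrite fin_numE -ltNye -ltey (lt_le_trans (ltNyr _) h1) (le_lt_trans h2 (ltry _)).
apply/cvgrPdist_le => eps eps0; have [s1 s10 h] := sq eps eps0.
near=> s; have /h : 0 < s < s1.
  by apply/andP; split; near: s; [exact: nbhs_right_gt|exact: nbhs_right_lt].
rewrite /=; case: ((s / 2)%:E * _)%E => [r| |] /andP[]; rewrite ?leye_eq ?leeNy_eq// !lee_fin.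
by rewrite /= ler_norml => h1 h2; apply/andP; split; lra.
Unshelve. all: by end_near. Qed.
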